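(* Let $n\ge 2$ be an integer, $\alpha>0$ real, and let $X_1,\ldots,X_n$ be independent random variables, each with density $(\Gamma(\alpha))^{-1}e^{-x}x^{\alpha-1}$, $x>0$. Let $\bar X=\frac1n\sum_{i=1}^n X_i$ and $S^2=(n-1)^{-1}\sum_{i=1}^n (X_i-\bar X)^2$. Then, for every $r>0$, with $z=r^2$, and for every $\lambda>0$, $$\Pr\{(n-1)S^2\le z=r^2\}=\sum_{j=0}^\infty \frac{\Gamma(\alpha n+2j)}{\Gamma(\alpha n)\,j!\,n^j}\left(\frac{d}{dz}\right)^j H_{\alpha,n,2j}(\sqrt z)\qquad (\mathrm A)$$ $$=\frac{r^{\alpha n}}{\Gamma(\alpha n)}\sum_{j=0}^\infty\left(\sum_{k=0}^\infty \binom{(\alpha n+k)/2+j-1}{j}\frac{\mu_{\alpha,n,2j+k}}{\alpha n+k}\,\frac{(-r)^k}{k!}\right)\frac1{n^j}$$ $$=\sum_{j=0}^\infty\left(\sum_{k=0}^\infty \delta_{\alpha,n,j,k,\lambda}\binom{\alpha n+k-1}{k}G_{\alpha n+k}(\lambda r)\right)\left(\frac{\lambda^2}{n}\right)^j,$$ where $$\delta_{\alpha,n,j,k,\lambda}=\sum_{\ell=0}^k(-1)^\ell\binom{k}{\ell}\binom{(\alpha n+\ell)/2+j-1}{j}\frac{\mu_{\alpha,n,2j+\ell}}{\lambda^{\alpha n+2j+\ell}}.$$ The series $(\mathrm A)$ is absolutely convergent with terms of order $O\big(j^{-(n+1)/2}\big)$ as $j\to\infty$, where the $O$-constant depends only on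 $\alpha$ and $n$.
   Context: For $\beta>0$, $G_\beta(x)=\frac1{\Gamma(\beta)}\int_0^x \xi^{\beta-1}e^{-\xi}\,d\xi$ ($x\ge0$) is the gamma distribution function of order $\beta$. $\Phi$ denotes the (random) angle between the vectors $(X_1,\ldots,X_n)$ and $(1,\ldots,1)$ in $\mathbb R^n$, i.e. $\sqrt n\cos\Phi=\big(\sum_i X_i\big)\big(\sum_i X_i^2\big)^{-1/2}$. The moments are $\mu_{\alpha,n,k}=\mathbb E\big((\sqrt n\cos\Phi)^{\alpha n+k}\big)$ for integers $k\ge0$. For integers $m\ge0$ and $r>0$, $H_{\alpha,n,m}(r)=\mathbb E\big(G_{\alpha n+m}(r\sqrt n\cos\Phi)\big)$, which is also equal to $\frac{r^{\alpha n+m}}{\Gamma(\alpha n+m)}\sum_{k=0}^\infty\frac{\mu_{\alpha,n,m+k}}{\alpha n+m+k}\frac{(-r)^k}{k!}$. For real $x$ and integer $j\ge 0$, $\binom{x}{j}=x(x-1)\cdots(x-j+1)/j!$ (with value $1$ for $j=0$). *)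

(* Defs.v *)
From HB Require Import structures.
From mathcomp Require Import all_boot all_order all_algebra.
From mathcomp Require Import all_classical all_reals all_analysis.
Set Implicit Arguments.
Unset Strict Implicit.
Unset Printing Implicit Defensive.
Import Order.TTheory GRing.Theory Num.Theory.
Import numFieldNormedType.Exports.
Local Open Scope classical_set_scope.
Local Open Scope ring_scope.

Section SpecialFunctions.
Context {R : realType}.
Implicit Types (b x : R) (j : nat).

Definition Gamma b : R :=
  \int[lebesgue_measure]_(t in `]0, +oo[) (t `^ (b - 1) * expR (- t)).

Definition gamma_cdf b x : R :=
  (Gamma b)^-1 *
  \int[lebesgue_measure]_(t in `[0, x]) (t `^ (b - 1) * expR (- t)).

Definition gamma_pdf b x : R :=
  if 0 < x then (Gamma b)^-1 * expR (- x) * x `^ (b - 1) else 0.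

Definition gbinom x j : R := (\prod_(i < j) (x - i%:R)) / j`!%:R.

End SpecialFunctions.

Section Geometry.
Context {R : realType} {n : nat}.
Implicit Types u v : 'I_n -> R.

Definition dot u v : R := \sum_(i < n) u i * v i.

(* By the library's conventions [angle 0 v] is acos 0; with gamma
   distributed coordinates this concerns a null event only. *)
Definition angle u v : R :=
  acos (dot u v / (Num.sqrt (dot u u) * Num.sqrt (dot v v))).

End Geometry.

Section Probability.
Context {d : measure_display} {T : measurableType d} {R : realType}.
Variable P : probability T R.

Definition mutually_independent n (X : 'I_n -> {RV P >-> R}) : Prop :=
  forall (J : {set 'I_n}) (B : 'I_n -> set R),
    (forall i, measurable (B i)) ->
    P (\bigcap_(i in [set` J]) (X i @^-1` B i)) =
    (\prod_(i in J) P (X i @^-1` B i))%E.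

Definition has_density (X : {RV P >-> R}) (f : R -> R) : Prop :=
  forall A : set R, measurable A ->
    distribution P X A = (\int[lebesgue_measure]_(x in A) (f x)%:E)%E.

Variables (n : nat) (X : 'I_n -> {RV P >-> R}).

Definition Phi (w : T) : R := angle (fun i => X i w) (fun=> 1).

Definition sample_mean (w : T) : R := n%:R^-1 * \sum_(i < n) X i w.

Definition sample_var (w : T) : R :=
  (n%:R - 1)^-1 * \sum_(i < n) (X i w - sample_mean w) ^+ 2.

Variable alpha : R.

Definition moment (k : nat) : R :=
  fine ('E_P[fun w =>
          ((Num.sqrt n%:R * cos (Phi w)) `^ (alpha * n%:R + k%:R))%R])%E.

Definition H (m : nat) (r : R) : R :=
  fine ('E_P[fun w =>
          (gamma_cdf (alpha * n%:R + m%:R)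
             (r * (Num.sqrt n%:R * cos (Phi w))))%R])%E.

Definition delta (j k : nat) (lambda : R) : R :=
  \sum_(l < k.+1)
    (-1) ^+ l * 'C(k, l)%:R
    * gbinom ((alpha * n%:R + l%:R) / 2 + j%:R - 1) j
    * (moment (2 * j + l)
       / lambda `^ (alpha * n%:R + (2 * j)%:R + l%:R)).

(* The three expansions: [termA] is the j-th term of the first;
   [innerB] and [innerC] are the summands, indexed by k, of the inner sums
   forming the coefficients of n^-j and (lambda^2/n)^j in the other two. *)
Definition termA (z : R) (j : nat) : R :=
  Gamma (alpha * n%:R + (2 * j)%:R)
  / (Gamma (alpha * n%:R) * j`!%:R * n%:R ^+ j)
  * derive1n j (fun y => H (2 * j) (Num.sqrt y)) z.

Definition innerB (r : R) (j k : nat) : R :=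
  gbinom ((alpha * n%:R + k%:R) / 2 + j%:R - 1) j
  * (moment (2 * j + k) / (alpha * n%:R + k%:R))
  * ((- r) ^+ k / k`!%:R).

Definition innerC (r lambda : R) (j k : nat) : R :=
  delta j k lambda * gbinom (alpha * n%:R + k%:R - 1) k
  * gamma_cdf (alpha * n%:R + k%:R) (lambda * r).

End Probability.

(* Main.v *)
(* Write b = alpha n and let S, Q and W be the sums of the X_i, of their
   squares and of the squares of their deviations from S / n. Put
   U = sqrt n cos Phi = S / sqrt Q and t = U^2 / n, so that 1 - t = W / Q.

   The law of u X has density u^-b exp((1 - 1/u) S) with respect to the law of
   X. Integrating over u yields P(W <= r^2) = E G_b(r S / sqrt W), that is,
   E G_b(r U / sqrt (1 - t)). By the binomial series,
   G_b(x / sqrt (1 - t)) = sum_j a_j(x) t^j with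
     a_j(x) = x^b / Gamma(b)
       * sum_k binom((b + k)/2 + j - 1, j) (-x)^k / ((b + k) k!),
   and the j-th term of each of the three expansions is E (a_j(r U) t^j): for
   the first one differentiates the power series of H term by term, for the
   third one uses that, for g_s(x) = int_0^x v^(s-1) e^-v dv, the sum over k of
   g_(s+k)(x) / k! is x^s / s.

   Summability and the size of the terms follow from two bounds. First,
   |a_j(x)| <= C / j for all x > 0: by Gamma integrals, a_j is an average of
   functions y^(-nu/2) J_nu(2 sqrt y), which are controlled by an energy that
   decreases in y. Second, E t^j = O(j^(-(n-1)/2)), because 1 - t <= eps forces
   all X_i into a relative neighbourhood of size O(sqrt eps) of X_1, an event of
   probability O(eps^((n-1)/2)). *)
Require Import Defs.
From HB Require Import structures.
From mathcomp Require Import all_boot all_order all_algebra.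
From mathcomp Require Import all_classical all_reals all_analysis.
From mathcomp Require Import measurable_realfun ring lra.
Set Implicit Arguments.
Unset Strict Implicit.
Unset Printing Implicit Defensive.
Import Order.TTheory GRing.Theory Num.Theory.
Import numFieldNormedType.Exports.
Local Open Scope classical_set_scope.
Local Open Scope ring_scope.

(** * Series with coefficients of geometric growth *)

Section Sequences.
Context {R : realType}.
Implicit Types (h g a : nat -> R) (x y : R).

(** The delicate point is a bound for a_j(x) that is uniform in both j and x. The first factor (b +
    k)/2 of the rising factorial cancels the denominator b + k, so a_j(x) is x^b / (2 j Gamma(b))
    times the series with coefficients (-1)^k binom((b + k)/2 + j - 1, j - 1) / k!. That binomial
    contains 1 / Gamma(b/2 + 1 + k/2), which duplication turns into 2^k Gamma((b + 1)/2 + k/2) /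
    Gamma(b + 1 + k) up to a constant. Gamma factors in the numerator are averages over dilations,
    which preserve bounds of the form x^b |f(x)| <= C; the denominator leaves phi_b. However, y^b
    phi_b(y) is unbounded in general. The order is therefore raised to b + m at the price of a
    polynomial in k, and this polynomial is absorbed into the factors Gamma((b + 1)/2 + i + k/2), i
    <= m, of the average.

    All constants are fixed before the probability space, which makes the O-constant depend only on
    alpha and n. With n >= 2 the exponent (n + 1)/2 is at least 3/2, so the terms are summable. *)

Lemma le_series_cvg (a g : nat -> R) :
  (forall k, `|a k| <= g k) -> cvgn (series g) ->
  cvgn (series (fun k => `|a k|)).
Proof.
by move=> ag; apply: series_le_cvg => // k; exact: le_trans (ag k).
Qed.

Lemma le_series_cvgn (a g : nat -> R) :
  (forall k, `|a k| <= g k) -> cvgn (series g) -> cvgn (series a).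
Proof. by move=> ag cg; apply: normed_cvg; exact: le_series_cvg cg. Qed.

(** Dominated convergence for series. One index [K] makes the tail of [g], hence the tails of [l]
    and of every [c N], at most e / 4; only a finite sum then depends on [N]. *)
Lemma tannery (c : nat -> nat -> R) (l g : nat -> R) :
  (forall N k, `|c N k| <= g k) -> cvgn (series g) ->
  (forall k, c N k @[N --> \oo] --> l k) ->
  limn (series (c N)) @[N --> \oo] --> limn (series l).
Proof.
move=> cg sg cl.
have g0 k : 0 <= g k by exact: le_trans (cg 0%N k).
have lg k : `|l k| <= g k.
  apply: (@ler_cvg_to _ \oo _ _ (fun N => `|c N k|) (cst (g k))).
  - by apply: cvg_norm; exact: cl.
  - exact: cvg_cst.
  - exact: nearW.
apply/cvgrPdist_lt => e e0.
have e4 : 0 < e / 4 by rewrite divr_gt0.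
have [K _ HK] : \forall K \near \oo, `|limn (series g) - series g K| < e / 4.
  by move/cvgrPdist_lt : sg => /(_ _ e4).
have tail (u : nat -> R) : (forall k, `|u k| <= g k) ->
    `|limn (series u) - series u K| <= e / 4.
  move=> ug.
  have cu := le_series_cvgn ug sg.
  have gKe : `|limn (series g) - series g K| <= e / 4 by apply/ltW/HK => /=.
  apply: (le_trans _ gKe).
  apply: (@ler_cvg_to _ \oo _ _ (fun n => `|series u n - series u K|)
    (fun n => `|series g n - series g K|)).
  - by apply: cvg_norm; apply: cvgB => //; exact: cvg_cst.
  - by apply: cvg_norm; apply: cvgB => //; exact: cvg_cst.
  - exists K => // n /= Kn.
    rewrite !sub_series_geq//.
    rewrite (le_trans (ler_norm_sum _ _ _))//.
    rewrite [leRHS]ger0_norm ?sumr_ge0//.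
    by apply: ler_sum => i _.
have cK : \forall N \near \oo, `|series l K - series (c N) K| < e / 4.
  move: (e / 4) e4; apply/cvgrPdist_lt.
  rewrite /series /=; elim: K {HK tail} => [|K IH].
    by under eq_cvg do rewrite big_geq//; rewrite big_geq//; exact: cvg_cst.
  under eq_cvg do rewrite big_nat_recr//=.
  by rewrite big_nat_recr//=; apply: cvgD.
near=> N.
rewrite (_ : _ - _ = (limn (series l) - series l K) +
  (series l K - series (c N) K) - (limn (series (c N)) - series (c N) K));
  last by ring.
have h1 := tail _ lg.
have h2 := tail _ (cg N).
have h3 : `|series l K - series (c N) K| < e / 4 by near: N; exact: cK.
have := ler_normB (limn (series l) - series l K + (series l K - series (c N) K))
  (limn (series (c N)) - series (c N) K).
have := ler_normD (limn (series l) - series l K) (series l K - series (c N) K).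
lra.
Unshelve. all: by end_near. Qed.

Lemma cvg_series_lim (a : nat -> R) l : series a @ \oo --> l -> limn (series a) = l.
Proof. by move=> h; apply/cvg_lim. Qed.

(* The exponential generating series [egf] of such a sequence is entire. *)
Definition geo h := exists C M, forall k, `|h k| <= C * M ^+ k.

Lemma geoP h : geo h -> exists C M, [/\ 0 < C, 1 <= M & forall k, `|h k| <= C * M ^+ k].
Proof.
move=> [C [M CM]]; exists (`|C| + 1), (`|M| + 1); split.
- by rewrite ltr_wpDl.
- by rewrite lerDr.
- move=> k; apply: le_trans (CM k) _.
  apply: le_trans (ler_norm _) _; rewrite normrM normrX.
  apply: ler_pM => //; first by rewrite lerDl.
  by apply: lerXn2r; rewrite ?nnegrE ?lerDl ?addr_ge0.
Qed.

Lemma geo_le h g : (forall k, `|h k| <= `|g k|) -> geo g -> geo h.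
Proof. by move=> hg [C [M CM]]; exists C, M => k; exact: le_trans (hg k) _. Qed.

Lemma geo_ext h g : h =1 g -> geo g -> geo h.
Proof. by move=> hg; apply: geo_le => k; rewrite hg. Qed.

Lemma geo_cst c : geo (fun=> c).
Proof. by exists `|c|, 1 => k; rewrite expr1n mulr1. Qed.

Lemma geo_bound h c : (forall k, `|h k| <= c) -> geo h.
Proof. by move=> hc; exists c, 1 => k; rewrite expr1n mulr1. Qed.

Lemma geo_exp c : geo (fun k => c ^+ k).
Proof. by exists 1, `|c| => k; rewrite mul1r normrX. Qed.

Lemma geoM h g : geo h -> geo g -> geo (fun k => h k * g k).
Proof.
move=> [C [M CM]] [D [N DN]]; exists (C * D), (M * N) => k.
by rewrite normrM exprMn mulrACA ler_pM.
Qed.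

Lemma geoZ c h : geo h -> geo (fun k => c * h k).
Proof. by apply: geoM; exact: geo_cst. Qed.

Lemma geoD h g : geo h -> geo g -> geo (fun k => h k + g k).
Proof.
move=> /geoP[C [M [C0 M1 CM]]] /geoP[D [N [D0 N1 DN]]].
exists (C + D), (M * N) => k.
apply: le_trans (ler_normD _ _) _; rewrite mulrDl exprMn lerD//.
- apply: le_trans (CM k) _; rewrite ler_pM2l//.
  by rewrite ler_peMr ?exprn_ege1// exprn_ge0// (le_trans _ M1).
- apply: le_trans (DN k) _; rewrite ler_pM2l//.
  by rewrite ler_peMl ?exprn_ege1// exprn_ge0// (le_trans _ N1).
Qed.

Lemma geo_nat : geo (fun k => k%:R).
Proof.
exists 1, 2 => k; rewrite mul1r normr_nat -natrX ler_nat.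
by apply/ltnW/ltn_expl.
Qed.

Lemma geo_sum n (h : nat -> nat -> R) : (forall i, geo (h i)) ->
  geo (fun k => \sum_(i < n) h i k).
Proof.
move=> gh; elim: n => [|n IH].
  by apply: (geo_ext _ (geo_cst 0)) => k; rewrite big_ord0.
by apply: (geo_ext _ (geoD IH (gh n))) => k; rewrite big_ord_recr.
Qed.

Lemma geo_prod n (h : nat -> nat -> R) : (forall i, geo (h i)) ->
  geo (fun k => \prod_(i < n) h i k).
Proof.
move=> gh; elim: n => [|n IH].
  by apply: (geo_ext _ (geo_cst 1)) => k; rewrite big_ord0.
by apply: (geo_ext _ (geoM IH (gh n))) => k; rewrite big_ord_recr.
Qed.

Lemma geoS h : geo h -> geo (fun k => h k.+1).
Proof.
move=> [C [M CM]]; exists (C * M), M => k.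
by rewrite -mulrA -exprS.
Qed.

Lemma geo_pred h : geo h -> geo (fun k => h k.-1).
Proof.
move=> /geoP[C [M [C0 M1 CM]]]; exists C, M => k.
apply: le_trans (CM _) _; rewrite ler_pM2l//.
by apply: ler_weXn2l => //; exact: leq_pred.
Qed.

End Sequences.

(* Locked because conversion checks would otherwise unfold the limit. *)
HB.lock Definition egf {R : realType} (h : nat -> R) (y : R) : R :=
  limn (series (fun k => h k / k`!%:R * y ^+ k)).
Canonical egf_unlockable := Unlockable egf.unlock.

Section Egf.
Context {R : realType}.
Implicit Types (h g a : nat -> R) (x y : R).

Lemma eq_limn_series (a a' : nat -> R) : a =1 a' -> limn (series a) = limn (series a').
Proof. by move=> /funext ->. Qed.

Lemma egfE h y : egf h y = limn (series (fun k => h k / k`!%:R * y ^+ k)).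
Proof. by rewrite unlock. Qed.

Lemma is_cvg_egf_norm h y : geo h -> cvgn (series (fun k => `|h k / k`!%:R * y ^+ k|)).
Proof.
move=> /geoP[C [M [C0 M1 CM]]].
apply: (@series_le_cvg _ _ (fun k => C * exp_coeff (M * `|y|) k)) => //.
- by move=> k; rewrite mulr_ge0 ?(ltW C0)// exp_coeff_ge0// mulr_ge0// (le_trans _ M1).
- move=> k; rewrite !normrM normfV (ger0_norm (ler0n _ _)) normrX.
  rewrite /exp_coeff /= exprMn mulrAC !mulrA ler_wpM2r ?invr_ge0//.
  by rewrite ler_wpM2r ?exprn_ge0//.
- exact/is_cvg_seriesZ/is_cvg_series_exp_coeff.
Qed.

Lemma is_cvg_egf h y : geo h -> cvgn (series (fun k => h k / k`!%:R * y ^+ k)).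
Proof. by move=> gh; apply: normed_cvg; exact: is_cvg_egf_norm. Qed.

Lemma eq_egf h g y : h =1 g -> egf h y = egf g y.
Proof. by move=> /funext ->. Qed.

Lemma egfZ c h y : geo h -> egf (fun k => c * h k) y = c * egf h y.
Proof.
move=> gh; rewrite unlock -[RHS](lim_seriesZ c (is_cvg_egf gh)).
by apply: eq_limn_series => k /=; rewrite !fctE/= -!mulrA.
Qed.

Lemma egfD h g y : geo h -> geo g -> egf (fun k => h k + g k) y = egf h y + egf g y.
Proof.
move=> gh gg; rewrite unlock -lim_seriesD; [|exact: is_cvg_egf..].
by apply: eq_limn_series => k /=; rewrite !fctE/= -!mulrDl.
Qed.

Lemma egf_sum n (h : nat -> nat -> R) y : (forall i, geo (h i)) ->
  egf (fun k => \sum_(i < n) h i k) y = \sum_(i < n) egf (h i) y.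
Proof.
move=> gh; elim: n => [|n IH].
  rewrite big_ord0 -[RHS](mul0r (egf (h 0%N) y)) -egfZ//.
  by apply: eq_egf => k; rewrite big_ord0 mul0r.
rewrite big_ord_recr/= -IH -egfD//; last exact: geo_sum.
by apply: eq_egf => k; rewrite big_ord_recr.
Qed.

Lemma egf_scale h c y : egf (fun k => h k * c ^+ k) y = egf h (c * y).
Proof.
by rewrite unlock; apply: eq_limn_series => k /=; rewrite exprMn; ring.
Qed.

Lemma egf_exp y : egf (fun=> 1) y = expR y.
Proof. by rewrite unlock /expR; apply: eq_limn_series => k /=; rewrite mulrC mul1r. Qed.

Lemma egf_at0 h : egf h 0 = h 0%N.
Proof.
rewrite unlock; apply: cvg_series_lim; rewrite -cvg_shiftS.
rewrite (_ : (fun n => _) = cst (h 0%N)); first exact: cvg_cst.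
apply/funext => n /=.
rewrite /series/= big_nat_recl//= expr0 mulr1 fact0 divr1.
by rewrite big1 ?addr0// => i _; rewrite expr0n/= mulr0.
Qed.

Lemma pseries_diffs_egf h :
  pseries_diffs (fun k => h k / k`!%:R) = (fun k => h k.+1 / k`!%:R).
Proof.
apply/funext => k; rewrite /pseries_diffs factS natrM.
have := fact_gt0 k; rewrite -(ltr0n R) => k0.
by field; rewrite gt_eqF//= gt_eqF.
Qed.

Lemma is_derive_egf h y : geo h -> is_derive y 1 (egf h) (egf (fun k => h k.+1) y).
Proof.
move=> gh.
have := @pseries_snd_diffs _ (fun k => h k / k`!%:R) (`|y| + 1) y.
rewrite 2!pseries_diffs_egf !unlock; apply.
- exact: is_cvg_egf.
- exact/is_cvg_egf/geoS.
- exact/is_cvg_egf/(geoS (geoS gh)).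
- by rewrite [ltRHS]ger0_norm ?addr_ge0// ltrDl.
Qed.

(** Multiplication by y shifts the coefficients. At k = 0 the truncated predecessor reads [h 0], and
    the factor k removes it. *)
Lemma mul_egf h y : geo h -> y * egf h y = egf (fun k => k%:R * h k.-1) y.
Proof.
move=> gh; have gh' : geo (fun k => k%:R * h k.-1).
  by apply: geoM; [exact: geo_nat|exact: geo_pred].
rewrite unlock; apply/esym/cvg_series_lim; rewrite -cvg_shiftS/=.
rewrite (_ : (fun n => _) = (fun n => y * series (fun k => h k / k`!%:R * y ^+ k) n)).
  by apply: cvgMr; exact: is_cvg_egf.
apply/funext => n; rewrite /series/= big_nat_recl//= !mul0r add0r big_distrr/=.
apply: eq_bigr => k _; rewrite factS natrM exprS.
have := fact_gt0 k; rewrite -(ltr0n R) => k0.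
by field; rewrite gt_eqF//= gt_eqF.
Qed.

(** Nonnegativity of [B] makes the partial sums over j increase to [l k], so the series of
    [h k * l k] dominates and [tannery] gives the interchange. *)
Lemma egf_series_swap h (B : nat -> nat -> R) (l : nat -> R) y :
  (forall j k, 0 <= B j k) -> (forall k, series (B^~ k) @ \oo --> l k) ->
  geo (fun k => h k * l k) ->
  series (fun j => egf (fun k => h k * B j k) y) @ \oo --> egf (fun k => h k * l k) y.
Proof.
move=> B0 Bl ghl.
have Bn n k : 0 <= series (B^~ k) n by rewrite /series/=; apply: sumr_ge0.
have nd k : nondecreasing_seq (series (B^~ k)).
  by apply/nondecreasing_seqP => n; rewrite seriesSr lerDl.
have Bln n k : series (B^~ k) n <= l k.
  rewrite -(cvg_series_lim (Bl k)); apply: nondecreasing_cvgn_le => //.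
  by apply/cvg_ex; exists (l k).
have l0 k : 0 <= l k by exact: le_trans (Bn 0%N k) (Bln _ k).
have Bjl j k : B j k <= l k.
  apply: le_trans (Bln j.+1 k); rewrite seriesSr lerDr; exact: Bn.
have gB j : geo (fun k => h k * B j k).
  apply: geo_le ghl => k; rewrite !normrM ler_wpM2l// !ger0_norm//.
rewrite (_ : series _ = (fun n => egf (fun k => h k * series (B^~ k) n) y)).
  rewrite unlock; apply: (@tannery _ _ _ (fun k => `|h k * l k / k`!%:R * y ^+ k|)).
  - move=> n k; rewrite !normrM; do 2 rewrite ler_wpM2r//.
    by rewrite ler_wpM2l// !ger0_norm.
  - exact: is_cvg_egf_norm.
  - by move=> k; apply: cvgMl; apply: cvgMl; apply: cvgMr; exact: Bl.
apply/funext => n; rewrite {1}/series/= big_mkord -(egf_sum _ (h := fun j k => h k * B j k))//.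
by apply: eq_egf => k; rewrite /series/= big_distrr/= big_mkord.
Qed.

End Egf.

(** * Gamma integrals *)

Section IntegralSeries.
Lemma EFin_limn_series {R : realType} (u : nat -> R) : cvgn (series u) ->
  (\sum_(k <oo) (u k)%:E = (limn (series u))%:E)%E.
Proof.
move=> cu; rewrite -EFin_lim//.
by apply: congr_lim; apply/funext => n /=; rewrite sumEFin.
Qed.

Context {d} {T : measurableType d} {R : realType}.
Variable mu : {measure set T -> \bar R}.
Variables (D : set T) (mD : measurable D).

(** The L1 bounds [c] are summable, so by monotone convergence the sum of the [|f k|] is integrable;
    it dominates all partial sums. *)
Lemma integral_series (f : nat -> T -> R) (c : nat -> R) :
  (forall k, measurable_fun D (f k)) -> cvgn (series c) ->
  (forall k, (\int[mu]_(x in D) (`|f k x|%R)%:E <= (c k)%:E)%E) ->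
  (forall x, D x -> cvgn (series (fun k => `|f k x|))) ->
  mu.-integrable D (EFin \o (fun x => limn (series (f^~ x)))) /\
  series (fun k => \int[mu]_(x in D) f k x) @ \oo -->
    \int[mu]_(x in D) limn (series (f^~ x)).
Proof.
move=> mf cc fc fx.
have c0 k : 0 <= c k.
  by rewrite -lee_fin; apply: le_trans (fc k); apply: integral_ge0.
have mabs k : measurable_fun D (fun x => (`|f k x|)%:E).
  by apply/measurable_EFinP; exact: measurableT_comp.
pose g x := (\sum_(k <oo) (`|f k x|%R)%:E)%E.
have gE x : D x -> g x = (limn (series (fun k => `|f k x|)))%:E.
  move=> Dx; rewrite /g EFin_limn_series//; exact: fx.
have mg : measurable_fun D g.
  by apply: ge0_emeasurable_sum => // k x Dx _; rewrite lee_fin.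
have fint k : mu.-integrable D (EFin \o f k).
  apply/integrableP; split; first exact/measurable_EFinP.
  by under eq_integral do rewrite /= ; apply: le_lt_trans (fc k) (ltry _).
have intg : mu.-integrable D g.
  apply/integrableP; split => //.
  rewrite (eq_integral g); last first.
    move=> x; rewrite inE => Dx; rewrite gee0_abs//.
    by apply: nneseries_ge0 => *; rewrite lee_fin.
  rewrite /g integral_nneseries//.
  apply: (@le_lt_trans _ _ (\sum_(k <oo) (c k)%:E)%E).
    by apply: lee_nneseries => // *; exact: integral_ge0.
  by rewrite EFin_limn_series// ltry.
have fxs x : D x -> cvgn (series (f^~ x)) by move=> Dx; apply: normed_cvg; exact: fx.
have mF : measurable_fun D (fun x => limn (series (f^~ x))).
  apply: (@measurable_fun_cvg _ _ _ D (fun n x => series (f^~ x) n)) => //.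
  by move=> n; rewrite /series/=; apply: measurable_sum => k; exact: mf.
have := @dominated_convergence _ _ _ mu D mD (fun n x => (series (f^~ x) n)%:E)
  (fun x => (limn (series (f^~ x)))%:E) g.
case.
- move=> n; apply/measurable_EFinP.
  by rewrite /series/=; apply: measurable_sum => k; exact: mf.
- exact/measurable_EFinP.
- apply: aeW => x Dx; apply: cvg_EFin; first exact: nearW.
  exact: fxs.
- exact: intg.
- apply: aeW => x n Dx; rewrite gE// lee_fin.
  rewrite (le_trans (ler_norm_sum _ _ _))//.
  apply: (nondecreasing_cvgn_le _ (fx _ Dx) n).
  by apply/nondecreasing_seqP => m; rewrite seriesSr lerDl.
move=> iF _ cF; split => //.
move: cF; rewrite (_ : [sequence _]_n =
  EFin \o (series (fun k => \int[mu]_(x in D) f k x))); last first.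
  apply/funext => n /=; rewrite /series/=.
  under eq_integral do rewrite -sumEFin.
  rewrite integral_sum//= -sumEFin; apply: eq_bigr => k _.
  by rewrite /Rintegral fineK//; exact: (integrable_fin_num mD (fint k)).
rewrite -[X in _ --> X]fineK; last exact: integrable_fin_num.
by move/fine_cvgP => [_]; apply: cvg_trans; apply: near_eq_cvg; exact: nearW.
Qed.

End IntegralSeries.

Section PowerIntegral.
Context {R : realType}.
Notation mu := (@lebesgue_measure R).
Implicit Types (s x : R).

Lemma measurable_powRexp s : measurable_fun setT (fun t : R => t `^ (s - 1) * expR (- t)).
Proof.
apply: measurable_funM; first exact: measurable_powR.
by apply: measurableT_comp => //; exact: measurableT_comp.
Qed.

Lemma integral_derive (F f : R -> R) (a b : R) : a < b ->
  (forall t, a <= t <= b -> is_derive t 1 F (f t)) ->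
  (forall t, a <= t <= b -> {for t, continuous f}) ->
  (\int[mu]_(t in `[a, b]) (f t)%:E = (F b - F a)%:E)%E.
Proof.
move=> ab dF cf.
have cF t : a <= t <= b -> {for t, continuous F}.
  by move=> /dF[? _]; apply/differentiable_continuous/derivable1_diffP.
rewrite (@continuous_FTC2 _ f F)//.
- apply: continuous_in_subspaceT => t; rewrite inE/= in_itv/=; exact: cf.
- split.
  + by move=> t; rewrite in_itv/= => /andP[at_ tb]; have [] := dF t; rewrite ?ltW.
  + by apply/cvg_at_right_filter/cF; rewrite lexx ltW.
  + by apply/cvg_at_left_filter/cF; rewrite lexx ltW.
- move=> t; rewrite in_itv/= => /andP[at_ tb]; rewrite derive1E.
  by apply: derive_val; apply: dF; rewrite !ltW.
Qed.

(** For s < 1 the integrand is singular at 0, so the fundamental theorem of calculus is applied on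
    [x / (n + 1), x] and these intervals exhaust ]0, x] by monotone convergence. *)
Lemma integral_powR s x : 0 < s -> 0 < x ->
  (\int[mu]_(t in `[0%R, x]) (t `^ (s - 1))%R%:E = (x `^ s / s)%R%:E)%E.
Proof.
move=> s0 x0.
have mp (A : set R) : measurable A -> measurable_fun A (fun t : R => (t `^ (s - 1))%:E).
  move=> mA; apply/measurable_EFinP; by apply: measurable_funTS; exact: measurable_powR.
rewrite -integral_itv_obnd_cbnd//; last exact: mp.
pose F n := `[x / n.+1%:R, x]%classic.
have -> : `]0, x]%classic = \bigcup_n F n.
  apply/seteqP; split => [t/=|t [n _]]; rewrite /F/= !in_itv/=.
    move=> /andP[t0 tx]; exists (Num.truncn (x / t)) => //=.
    rewrite in_itv/= tx andbT ler_pdivrMr// mulrC -ler_pdivrMr//.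
    by apply/ltW; apply: truncnS_gt.
  move=> /andP[nt ->]; rewrite andbT; apply: lt_le_trans nt.
  by rewrite divr_gt0.
have nF : nondecreasing_seq F.
  apply/nondecreasing_seqP => n; apply/subsetPset => t.
  rewrite /F/= !in_itv/= => /andP[nt ->]; rewrite andbT.
  by apply: le_trans nt; rewrite ler_pM2l// lef_pV2 ?posrE// ler_nat.
have := @ge0_nondecreasing_set_cvg_integral _ (measurableTypeR R) R F
  (fun t : R => (t `^ (s - 1))%:E) mu nF (fun=> measurable_itv _)
  (fun=> mp _ (measurable_itv _)) (fun _ _ _ => powR_ge0 _ _).
move=> /(cvg_lim (@ereal_hausdorff R)) <-.
apply/cvg_lim => //.
rewrite (_ : (fun n => _) =
    (fun n => (x `^ s / s - (x / n.+1%:R) `^ s / s)%:E)); last first.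
  apply/funext => -[|n].
    by rewrite /F divr1 subrr set_itv1 integral_set1.
  have xn : 0 < x / n.+2%:R by rewrite divr_gt0.
  apply: (@integral_derive (fun t => t `^ s / s) (fun t => t `^ (s - 1))).
  - by rewrite ltr_pdivrMr// ltr_pMr// ltr1n.
  - move=> t /andP[xt _]; have t0 := lt_le_trans xn xt.
    rewrite (_ : (fun u : R => u `^ s / s) = s^-1 *: (fun u : R => u `^ s)); last first.
      by apply/funext => u; rewrite !fctE /GRing.scale/= mulrC.
    have := @is_deriveZ _ _ _ (fun u : R => u `^ s) s^-1 t 1 _ (is_derive1_powR s t0).
    by rewrite /GRing.scale/= mulKf// gt_eqF.
  - move=> t /andP[xt _]; have t0 := lt_le_trans xn xt.
    apply/differentiable_continuous/derivable1_diffP.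
    by have [] := is_derive1_powR (s - 1) t0.
apply: cvg_EFin; first exact: nearW.
rewrite -[X in _ --> X]subr0; apply: cvgB; first exact: cvg_cst.
rewrite -(mul0r s^-1); apply: cvgMl.
have /cvg_at_rightP := powR_cvg0 s0; apply; split => [n|].
  by rewrite divr_gt0.
rewrite -(mulr0 x); apply: cvgMr; exact: cvg_harmonic.
Qed.

End PowerIntegral.

Section IncompleteGamma.
Context {R : realType}.
Notation mu := (@lebesgue_measure R).
Implicit Types (s x : R).

Lemma gt0_powRD x r s : 0 < x -> x `^ (r + s) = x `^ r * x `^ s.
Proof. by move=> x0; rewrite powRD// (gt_eqF x0) implybT. Qed.

Lemma powRDn s t k : 0 < s -> 0 <= t ->
  t `^ (s - 1) * t ^+ k = t `^ (s + k%:R - 1) :> R.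
Proof.
move=> s0; rewrite le_eqVlt => /predU1P[<-|t0].
  case: k => [|k]; first by rewrite expr0 mulr1 addr0.
  rewrite expr0n/= mulr0 powR0//.
  by rewrite gt_eqF// -natr1 addrA addrK ltr_pwDl.
by rewrite addrAC (gt0_powRD (s - 1))// powR_mulrn// ltW.
Qed.

Lemma integrable_powRM s x (g : R -> R) : 0 < s -> 0 < x ->
  measurable_fun setT g -> (forall t, 0 <= t -> `|g t| <= 1) ->
  mu.-integrable `[0, x] (EFin \o (fun t => t `^ (s - 1) * g t)) /\
  (\int[mu]_(t in `[0%R, x]) (`|t `^ (s - 1) * g t|%R)%:E <= (x `^ s / s)%R%:E)%E.
Proof.
move=> s0 x0 mg g1.
have mf : measurable_fun (`[0, x]%classic : set (measurableTypeR R)) (fun t : R => t `^ (s - 1) * g t).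
  by apply: measurable_funTS; apply: measurable_funM => //; exact: measurable_powR.
have le1 : (\int[mu]_(t in `[0%R, x]) (`|t `^ (s - 1) * g t|%R)%:E <= (x `^ s / s)%R%:E)%E.
  rewrite -integral_powR//; apply: ge0_le_integral => //.
  - by apply/measurable_EFinP; exact: measurableT_comp.
    - by apply/measurable_EFinP; apply: measurable_funTS; exact: measurable_powR.
  - move=> t /=; rewrite in_itv/= => /andP[t0 _]; rewrite lee_fin normrM.
    by rewrite [X in X * _]ger0_norm ?powR_ge0// ler_piMr ?powR_ge0// g1.
split => //; apply/integrableP; split; first exact/measurable_EFinP.
by apply: le_lt_trans le1 _; rewrite ltry.
Qed.

(** Used with g = 1 to expand the incomplete gamma integral in powers of x, and with g(t) = e^-t and
    h = 1, where the series e^t cancels g, to sum incomplete gamma integrals of increasing order. *)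
Lemma integral_powRM_egf s x (g : R -> R) h : 0 < s -> 0 < x ->
  measurable_fun setT g -> (forall t, 0 <= t -> `|g t| <= 1) -> geo h ->
  series (fun k => h k / k`!%:R *
    \int[mu]_(t in `[0, x]) (t `^ (s + k%:R - 1) * g t)) @ \oo -->
  \int[mu]_(t in `[0, x]) (t `^ (s - 1) * g t * egf h t).
Proof.
move=> s0 x0 mg g1 gh.
have sk0 k : 0 < s + k%:R by rewrite ltr_pwDl.
have mD : measurable (`[0, x]%classic : set (measurableTypeR R)) by exact: measurable_itv.
pose f k t := h k / k`!%:R * (t `^ (s + k%:R - 1) * g t).
have fE k t : 0 <= t -> f k t = t `^ (s - 1) * g t * (h k / k`!%:R * t ^+ k).
  by move=> t0; rewrite /f -powRDn//; ring.
have mf k : measurable_fun (`[0, x]%classic : set (measurableTypeR R)) (f k).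
  apply: measurable_funM; first exact: measurable_cst.
  by apply: measurable_funTS; apply: measurable_funM => //; exact: measurable_powR.
have := @integral_series _ (measurableTypeR R) R mu _ mD f
  (fun k => x `^ s / s * `|h k / k`!%:R * x ^+ k|) mf.
case.
- apply: is_cvg_seriesZ; exact: is_cvg_egf_norm.
- move=> k; rewrite /f.
  under eq_integral do rewrite normrM EFinM.
  rewrite ge0_integralZl_EFin//; last first.
    apply/measurable_EFinP; apply: measurableT_comp => //.
    by apply: measurable_funTS; apply: measurable_funM => //; exact: measurable_powR.
  have [_ hk] := integrable_powRM (sk0 k) x0 mg g1.
  apply: le_trans (lee_wpmul2l _ hk) _; first by rewrite lee_fin.
  have x0' := ltW x0; have xk := exprn_ge0 k x0'.
  rewrite -EFinM lee_fin [leRHS](_ : _ = `|h k / k`!%:R| * (x `^ s / s * x ^+ k)) ?ler_wpM2l//; last by rewrite normrM (ger0_norm xk) mulrCA.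
  rewrite gt0_powRD// powR_mulrn// [leRHS]mulrAC ler_wpM2l ?mulr_ge0 ?powR_ge0//.
  by rewrite lef_pV2 ?posrE// lerDl.
- move=> t /=; rewrite in_itv/= => /andP[t0 _].
  rewrite (_ : (fun k => `|f k t|) =
    (fun k => `|t `^ (s - 1) * g t| * `|h k / k`!%:R * t ^+ k|)); last first.
    by apply/funext => k; rewrite fE// normrM.
  apply: is_cvg_seriesZ; exact: is_cvg_egf_norm.
move=> _.
have E k : \int[mu]_(t in `[0, x]) f k t =
    h k / k`!%:R * \int[mu]_(t in `[0, x]) (t `^ (s + k%:R - 1) * g t).
  by rewrite /f RintegralZl//; have [] := integrable_powRM (sk0 k) x0 mg g1.
rewrite (funext E).
rewrite (_ : Rintegral _ _ _ =
  \int[mu]_(t in `[0, x]) (t `^ (s - 1) * g t * egf h t))//.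
apply: eq_Rintegral => t; rewrite inE/= in_itv/= => /andP[t0 _].
rewrite unlock -[RHS](lim_seriesZ (t `^ (s - 1) * g t)); last exact: is_cvg_egf.
by apply: eq_limn_series => k; rewrite fE.
Qed.

(** The lower incomplete gamma function. *)
Definition igamma s x := \int[mu]_(t in `[0, x]) (t `^ (s - 1) * expR (- t)).

Lemma expRN_le1 t : 0 <= t -> `|expR (- t)| <= 1 :> R.
Proof. by move=> t0; rewrite ger0_norm ?expR_ge0// expR_le1 oppr_le0. Qed.

Lemma measurable_expRN : measurable_fun setT (fun t : R => expR (- t)).
Proof. by apply: measurableT_comp => //; exact: measurableT_comp. Qed.

Lemma Rintegral_powR s x : 0 < s -> 0 < x ->
  \int[mu]_(t in `[0, x]) (t `^ (s - 1)) = x `^ s / s.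
Proof. by move=> s0 x0; rewrite /Rintegral integral_powR. Qed.

Lemma geo_inv s : 0 < s -> geo (fun k => (s + k%:R)^-1).
Proof.
move=> s0; apply: (@geo_bound _ _ s^-1) => k.
have sk : 0 < s + k%:R by rewrite ltr_pwDl.
by rewrite ger0_norm ?invr_ge0 ?(ltW sk)// lef_pV2 ?posrE// lerDl.
Qed.

Lemma geo_sign_inv s : 0 < s -> geo (fun k => (-1) ^+ k / (s + k%:R)).
Proof. by move=> s0; apply: geoM; [exact: geo_exp|exact: geo_inv]. Qed.

Lemma egf_expN t : egf (fun k => (-1) ^+ k) t = expR (- t) :> R.
Proof.
rewrite -(mulN1r t) -egf_exp -egf_scale.
by apply: eq_egf => k; rewrite mul1r.
Qed.

Lemma igamma_egf s x : 0 < s -> 0 <= x ->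
  igamma s x = x `^ s * egf (fun k => (-1) ^+ k / (s + k%:R)) x.
Proof.
move=> s0; rewrite le_eqVlt => /predU1P[<-|x0].
  by rewrite /igamma set_itv1 Rintegral_set1 powR0 ?mul0r// gt_eqF.
have n1 (t : R) : 0 <= t -> `|cst 1 t| <= 1 :> R by rewrite normr1.
have := integral_powRM_egf s0 x0 (measurable_cst (1 : R)) n1 (geo_exp (-1)).
rewrite (_ : Rintegral _ _ _ = igamma s x); last first.
  apply: eq_Rintegral => t _.
  by rewrite /= mulr1 egf_expN.
move=> /cvg_series_lim <-.
rewrite unlock -[RHS](lim_seriesZ (x `^ s)); last by apply: is_cvg_egf; exact: geo_sign_inv.
apply: eq_limn_series => k; under eq_Rintegral do rewrite mulr1.
rewrite Rintegral_powR// ?ltr_pwDl//.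
by rewrite gt0_powRD// powR_mulrn ?ltW// !fctE/= /GRing.scale/=; ring.
Qed.

Lemma igamma_series s x : 0 < s -> 0 < x ->
  series (fun k => igamma (s + k%:R) x / k`!%:R) @ \oo --> x `^ s / s.
Proof.
move=> s0 x0.
have := integral_powRM_egf s0 x0 measurable_expRN expRN_le1 (geo_cst 1).
rewrite (_ : Rintegral _ _ _ = x `^ s / s); last first.
  rewrite -Rintegral_powR//; apply: eq_Rintegral => t _.
  by rewrite egf_exp -mulrA [X in _ * X]mulrC expRxMexpNx_1 mulr1.
by under eq_fun do rewrite mul1r mulrC.
Qed.

Lemma igamma_ge0 s x : 0 <= igamma s x.
Proof. by apply: Rintegral_ge0 => t _; rewrite mulr_ge0 ?powR_ge0 ?expR_ge0. Qed.

(** The identity of integration by parts, obtained by comparing power series coefficients; the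
    singularity of t^(s-1) at 0 then needs no separate treatment. *)
Lemma igammaS s x : 0 < s -> 0 <= x ->
  igamma (s + 1) x = s * igamma s x - x `^ s * expR (- x).
Proof.
move=> s0 x0; have s10 : 0 < s + 1 by rewrite addr_gt0.
have gi := geo_sign_inv s0; have gi1 := geo_sign_inv s10.
rewrite !igamma_egf// powRD ?(gt_eqF s10)// powRr1// -mulrA (mulrCA s) -mulrBr.
congr (_ * _); rewrite mul_egf// -egf_expN -egfZ//.
rewrite -(mulN1r (egf _ _)) -egfZ; last exact: geo_exp.
rewrite -egfD; [|exact: geoZ|exact/geoZ/geo_exp].
apply: eq_egf => -[|k]; first by rewrite /= mul0r expr0 addr0 mul1r divff ?gt_eqF// mulN1r subrr.
have sk : 0 < s + k.+1%:R by rewrite ltr_pwDl.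
have E : s + 1 + k%:R = s + k.+1%:R by rewrite -natr1; ring.
rewrite /= E exprS -natr1 in sk *.
by field; rewrite gt_eqF.
Qed.

End IncompleteGamma.

Section GammaFunction.
Context {R : realType}.
Notation mu := (@lebesgue_measure R).
Implicit Types (s x : R).

Lemma powR_le1D s x m : 0 <= s -> s <= m%:R -> 0 <= x -> x `^ s <= 1 + x ^+ m.
Proof.
move=> s0 sm x0; have [x1|x1] := leP x 1.
  apply: (@le_trans _ _ 1); last by rewrite lerDl exprn_ge0.
  by rewrite -[leRHS](congr1 (@^~ s) (@powR1 R)); apply: ge0_ler_powR; rewrite ?nnegrE.
apply: (@le_trans _ _ (x ^+ m)); last by rewrite lerDr.
by rewrite -powR_mulrn// ler_powR// ltW.
Qed.

Lemma exprn_expRN_le x m : 0 <= x -> x ^+ m * expR (- x) <= m`!%:R.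
Proof.
move=> x0; rewrite expRN ler_pdivrMr ?expR_gt0//.
have m0 : (0 : R) < m`!%:R by rewrite ltr0n fact_gt0.
rewrite -ler_pdivrMl// mulrC.
case: m m0 => [|m] m0; first by rewrite fact0 divr1 expr0 (le_trans _ (expR_ge1Dx x))// lerDl.
by apply: le_trans (expR_ge1Dxn m x0); rewrite lerDr.
Qed.

Lemma powR_expRN_bounded s : 0 <= s ->
  exists B, 0 < B /\ forall x, 0 <= x -> x `^ s * expR (- x) <= B.
Proof.
move=> s0; pose m := (Num.truncn s).+1.
exists (1 + m`!%:R); split; first by rewrite ltr_pwDl.
move=> x x0; have sm : s <= m%:R by apply/ltW/truncnS_gt.
apply: (@le_trans _ _ ((1 + x ^+ m) * expR (- x))).
  by rewrite ler_wpM2r ?expR_ge0// powR_le1D.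
rewrite mulrDl mul1r lerD// ?exprn_expRN_le//.
by rewrite expR_le1 oppr_le0.
Qed.

Lemma igamma1 x : 0 < x -> igamma 1 x = 1 - expR (- x).
Proof.
move=> x0; rewrite /igamma /Rintegral.
under eq_integral do rewrite subrr powRr0 mul1r.
have dF (t : R) : is_derive t 1 (fun u : R => - expR (- u)) (expR (- t)).
  by apply: is_derive_eq; rewrite /GRing.scale/=; ring.
rewrite (_ : integral _ _ _ = (- expR (- x) - (- expR (- 0)))%:E)/=.
  by rewrite oppr0 expR0; ring.
apply: (@integral_derive _ (fun u : R => - expR (- u)) (fun u : R => expR (- u))) => // t _.
by apply: continuous_comp; [exact: continuousN|exact: continuous_expR].
Qed.

Lemma igamma_nat m x : 0 < x -> igamma m.+1%:R x <= m`!%:R.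
Proof.
move=> x0; elim: m => [|m IH].
  by rewrite igamma1// fact0 gerBl expR_ge0.
rewrite -natr1 igammaS ?ltr0n ?(ltW x0)//.
apply: (@le_trans _ _ (m.+1%:R * igamma m.+1%:R x)).
  by rewrite gerBl mulr_ge0 ?powR_ge0 ?expR_ge0.
by rewrite factS natrM ler_wpM2l.
Qed.

Lemma measurable_itvR (i : interval R) : measurable ([set` i] : set (measurableTypeR R)).
Proof. exact: measurable_itv. Qed.

Lemma integrable_igamma s x : 0 < s -> 0 < x ->
  mu.-integrable `[0, x] (EFin \o (fun t : R => t `^ (s - 1) * expR (- t))).
Proof.
by move=> s0 x0; have [] := integrable_powRM s0 x0 (@measurable_expRN R) (@expRN_le1 R).
Qed.

Lemma igammaD_le s x m : 1 <= s -> s - 1 <= m%:R -> 0 < x ->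
  igamma s x <= 1 + m`!%:R.
Proof.
move=> s1 sm x0; have s0 : 0 < s by exact: lt_le_trans s1.
apply: (@le_trans _ _ (igamma 1 x + igamma m.+1%:R x)); last first.
  by apply: lerD; [exact: (@igamma_nat 0)|exact: igamma_nat].
have i1 := integrable_igamma ltr01 x0; have im := integrable_igamma (ltr0Sn R m) x0.
rewrite /igamma -RintegralD//; apply: le_Rintegral => //.
- exact: integrable_igamma.
- by have := integrableD (measurable_itvR _) i1 im.
- move=> t; rewrite /= in_itv/= => /andP[t0 _].
  rewrite -mulrDl ler_wpM2r ?expR_ge0// subrr powRr0.
  rewrite -natr1 addrK powR_mulrn// powR_le1D// subr_ge0//.
Qed.

(** For s < 1 the integrand is unbounded at 0, so the recurrence moves to order s + 1, where t^s <=
    1 + t^m allows comparison with integer orders. *)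
Lemma igamma_bounded s : 0 < s -> exists B, 0 < B /\ forall x, 0 <= x -> igamma s x <= B.
Proof.
move=> s0; pose m := (Num.truncn s).+1.
have [B [B0 hB]] := powR_expRN_bounded (ltW s0).
have P : 0 < (1 + m`!%:R + B) / s by rewrite divr_gt0// !addr_gt0// ltr0n fact_gt0.
exists ((1 + m`!%:R + B) / s); split => // x.
rewrite le_eqVlt => /predU1P[<-|x0]; first by rewrite /igamma set_itv1 Rintegral_set1 ltW.
rewrite ler_pdivlMr// mulrC.
have -> : s * igamma s x = igamma (s + 1) x + x `^ s * expR (- x).
  by rewrite igammaS ?ltW// subrK.
apply: lerD; last by apply: hB; exact: ltW.
apply: igammaD_le => //; first by rewrite lerDr ltW.
by rewrite addrK; apply/ltW/truncnS_gt.
Qed.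

(** [Gamma s] is the increasing limit of [igamma s n], and the uniform bound gives integrability.
    The recurrence and the positivity of [Gamma] are inherited from [igamma] through this limit. *)
Lemma integrable_gamma s : 0 < s ->
  mu.-integrable `]0, +oo[ (EFin \o (fun t : R => t `^ (s - 1) * expR (- t))) /\
  igamma s n%:R @[n --> \oo] --> Gamma s.
Proof.
move=> s0; have [B [B0 hB]] := igamma_bounded s0.
pose f := fun t : R => t `^ (s - 1) * expR (- t).
have f0 t : 0 <= f t by rewrite mulr_ge0 ?powR_ge0 ?expR_ge0.
have mf (A : set R) : measurable A -> measurable_fun (A : set (measurableTypeR R)) (EFin \o f).
  move=> mA; apply/measurable_EFinP; apply: measurable_funTS.
  by apply: measurable_funM; [exact: measurable_powR|exact: measurable_expRN].
pose F n : set R := `[0, n%:R]%classic.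
have FE : `[0, +oo[%classic = \bigcup_n F n.
  apply/seteqP; split => [t/=|t [n _]]; rewrite /F/= !in_itv/= ?andbT.
    move=> t0; exists (Num.truncn t).+1 => //=.
    by rewrite in_itv/= t0/=; apply/ltW/truncnS_gt.
  by case/andP.
have nF : nondecreasing_seq F.
  apply/nondecreasing_seqP => n; apply/subsetPset => t.
  rewrite /F/= !in_itv/= => /andP[-> tn]/=.
  by apply: (le_trans tn); rewrite ler_nat.
have := @ge0_nondecreasing_set_cvg_integral _ (measurableTypeR R) R F
  (EFin \o f) mu nF (fun=> measurable_itvR _)
  (fun=> mf _ (measurable_itvR _)) (fun _ t _ => f0 t).
rewrite -FE -(integral_itv_obnd_cbnd (r := 0)); last exact: mf.
have IE n : (\int[mu]_(t in F n) (f t)%:E)%E = (igamma s n%:R)%:E.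
  rewrite /igamma /Rintegral fineK// /F.
  case: n => [|n]; first by rewrite set_itv1 integral_set1.
  exact: (integrable_fin_num (measurable_itvR _) (integrable_igamma s0 (ltr0Sn R n))).
rewrite (_ : (fun i => _) = (fun n => (igamma s n%:R)%:E)); last exact/funext.
move=> cI.
have Iint : (\int[mu]_(t in `]0%R, +oo[) (f t)%:E <= B%:E)%E.
  have /(cvg_lim (@ereal_hausdorff R)) <- := cI.
  apply: lime_le; first by apply/cvg_ex; eexists; exact: cI.
  by apply: nearW => n; rewrite lee_fin hB.
split.
  apply/integrableP; split; first exact: mf.
  apply: le_lt_trans (ltry B); apply: le_trans Iint; rewrite le_eqVlt; apply/orP; left.
  apply/eqP; apply: eq_integral => t _; apply: gee0_abs.
  by rewrite lee_fin; exact: f0.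
have fin : (\int[mu]_(t in `]0%R, +oo[) (f t)%:E)%E \is a fin_num.
  rewrite ge0_fin_numE; first by apply: le_lt_trans Iint _; rewrite ltry.
  by apply: integral_ge0 => t _; rewrite lee_fin.
move: cI; rewrite -[X in _ --> X]fineK// => /fine_cvgP[_].
by apply: cvg_trans; apply: near_eq_cvg; exact: nearW.
Qed.

Lemma cvg_powR_expRN s : 0 < s -> n%:R `^ s * expR (- n%:R) @[n --> \oo] --> (0 : R).
Proof.
move=> s0; have [B [B0 hB]] := powR_expRN_bounded (ltW (addr_gt0 s0 ltr01)).
rewrite -cvg_shiftS/=.
apply: (@squeeze_cvgr _ _ _ _ (cst 0) (fun n => B * harmonic n)).
- apply: nearW => n; rewrite /= mulr_ge0 ?powR_ge0 ?expR_ge0//=.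
  rewrite /harmonic/= ler_pdivlMr// mulrAC -[X in _ * X * _](powRr1 (ler0n _ n.+1)).
  by rewrite -gt0_powRD// hB.
- exact: cvg_cst.
- by rewrite -(mulr0 B); apply: cvgMr; exact: cvg_harmonic.
Qed.

Lemma GammaS s : 0 < s -> Gamma (s + 1) = s * Gamma s.
Proof.
move=> s0; have [_ h0] := integrable_gamma s0.
have [_ h1] := integrable_gamma (addr_gt0 s0 ltr01).
rewrite -(cvg_lim _ h1)//; apply/cvg_lim => //.
rewrite (_ : (fun n => _) = (fun n =>
    s * igamma s n%:R - n%:R `^ s * expR (- n%:R))); last first.
  by apply/funext => n; rewrite igammaS.
rewrite -[s * _]subr0; apply: cvgB; last exact: cvg_powR_expRN.
exact: (cvgM (cvg_cst s) h0).
Qed.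

Lemma le_igamma s x y : 0 < s -> 0 < x -> x <= y -> igamma s x <= igamma s y.
Proof.
move=> s0 x0 xy; have y0 := lt_le_trans x0 xy.
have fx := integrable_fin_num (measurable_itvR _) (integrable_igamma s0 x0).
have fy := integrable_fin_num (measurable_itvR _) (integrable_igamma s0 y0).
rewrite -lee_fin /igamma /Rintegral !fineK//.
apply: ge0_subset_integral => //.
- by have [] := integrableP _ _ _ (integrable_igamma s0 y0).
- by move=> t _; rewrite lee_fin mulr_ge0 ?powR_ge0 ?expR_ge0.
- by apply: subset_itvl; rewrite bnd_simp.
Qed.

Lemma Gamma_gt0 s : 0 < s -> 0 < Gamma s.
Proof.
move=> s0; have [_ h] := integrable_gamma s0.
apply: (@lt_le_trans _ _ (igamma s 1)); last first.
  rewrite -(cvg_lim _ h)//; apply: limr_ge; first by apply/cvg_ex; eexists; exact: h.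
  near=> n; apply: le_igamma => //; rewrite ler1n; near: n; exact: nbhs_infty_gt.
(* On [0, 1] the exponential is at least e^-1, which leaves the positive value e^-1 / s. *)
apply: (@lt_le_trans _ _ (\int[mu]_(t in `[0, 1]) (t `^ (s - 1) * expR (- 1)))).
  rewrite RintegralZr ?Rintegral_powR// ?powR1 ?mul1r ?mulr_gt0 ?invr_gt0 ?expR_gt0//.
  have c1 (t : R) : 0 <= t -> `|cst 1 t| <= 1 :> R by rewrite normr1.
  have [+ _] := integrable_powRM s0 ltr01 (measurable_cst (1 : R)) c1.
  by apply: eq_integrable => // t _; rewrite /= mulr1.
have c1 (t : R) : 0 <= t -> `|cst (expR (-1)) t| <= 1 :> R.
  by move=> _; exact: expRN_le1.
apply: le_Rintegral => //.
- by have [] := integrable_powRM s0 ltr01 (measurable_cst (expR (-1))) c1.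
- exact: integrable_igamma.
- move=> t; rewrite /= in_itv/= => /andP[t0 t1].
  by rewrite ler_wpM2l ?powR_ge0// ler_expR lerN2.
Unshelve. all: by end_near. Qed.

Lemma GammaD_prod s n : 0 < s -> Gamma (s + n%:R) = (\prod_(i < n) (s + i%:R)) * Gamma s.
Proof.
move=> s0; elim: n => [|n IH]; first by rewrite addr0 big_ord0 mul1r.
have sn : 0 < s + n%:R by rewrite ltr_pwDl.
by rewrite -natr1 addrA (GammaS sn) IH big_ord_recr /= mulrA (mulrC (s + n%:R)).
Qed.

(** Reversing the product turns the falling factorial into the rising one that starts at s. *)
Lemma gbinom_prod s j : gbinom (s + j%:R - 1) j = (\prod_(i < j) (s + i%:R)) / j`!%:R.
Proof.
rewrite /gbinom; congr (_ / _).
rewrite (reindex_inj rev_ord_inj)/=; apply: eq_bigr => i _.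
by rewrite natrB// -natr1; ring.
Qed.

Lemma gbinom_Gamma s j : 0 < s -> gbinom (s + j%:R - 1) j * Gamma s = Gamma (s + j%:R) / j`!%:R.
Proof. by move=> s0; rewrite GammaD_prod// gbinom_prod mulrAC. Qed.

End GammaFunction.

Section Scaling.
Context {R : realType}.
Notation mu := (@lebesgue_measure R).

Lemma GammaE (s : R) :
  Gamma s = \int[mu]_(t in `]0, +oo[) (t `^ (s - 1) * expR (- t)).
Proof. by []. Qed.

Opaque Gamma.

(** Both sides are measures in A that agree on half-open intervals, which determine Lebesgue
    measure. *)
Lemma lebesgue_measure_scale (c : R) (A : set (measurableTypeR R)) : 0 < c ->
  measurable A -> mu A = (c%:E * mu ( *%R c @^-1` A))%E.
Proof.
move=> c0 mA.
have mc : measurable_fun setT ( *%R c : measurableTypeR R -> measurableTypeR R).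
  exact: mulrl_measurable.
pose m0 : {measure set (measurableTypeR R) -> \bar R} :=
  pushforward mu ( *%R c : measurableTypeR R -> measurableTypeR R).
pose m : {measure set (measurableTypeR R) -> \bar R} := mscale (NngNum (ltW c0)) (m0 mc).
rewrite [LHS](@lebesgue_measure_unique R m)//.
move=> _ [[a b]] _ <-.
transitivity (c%:E * mu `](a / c)%R, (b / c)%R]%classic)%E; last first.
  rewrite /mscale/= /m0 /pushforward; congr (_ * mu _)%E.
  by apply/seteqP; split => x /=; rewrite !in_itv/= ltr_pdivrMr// ler_pdivlMr// (mulrC c).
rewrite !lebesgue_measure_itv/= !lte_fin ltr_pM2r ?invr_gt0//.
case: ifPn => _; last by rewrite mule0.
by rewrite -EFinB -EFinM; congr EFin; rewrite -mulrBl mulrCA divff ?gt_eqF// mulr1.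
Qed.

Lemma ge0_integral_scale (c : R) (f : R -> \bar R) : 0 < c ->
  measurable_fun setT f -> (forall x, 0 <= f x)%E ->
  (\int[mu]_(x in `]0%R, +oo[) f x =
   c%:E * \int[mu]_(x in `]0%R, +oo[) f (c * x)%R)%E.
Proof.
move=> c0 mf f0.
have mc : measurable_fun setT ( *%R c : measurableTypeR R -> measurableTypeR R).
  exact: mulrl_measurable.
pose m0 : {measure set (measurableTypeR R) -> \bar R} :=
  pushforward mu ( *%R c : measurableTypeR R -> measurableTypeR R).
pose m := m0 mc.
have -> : (\int[mu]_(x in `]0%R, +oo[) f (c * x)%R = \int[m]_(x in `]0%R, +oo[) f x)%E.
  rewrite /m (ge0_integral_pushforward mc)//; last exact: measurable_funTS mf.
  rewrite (_ : *%R c @^-1` _ = `]0, +oo[%classic)//.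
  by apply/seteqP; split => x /=; rewrite !in_itv/= !andbT pmulr_rgt0.
rewrite -(@ge0_integral_mscale _ _ _ m _ _ (NngNum (ltW c0)))//; last exact: measurable_funTS mf.
apply: eq_measure_integral => A mA _.
exact: lebesgue_measure_scale.
Qed.

Lemma Rintegral_gamma_scale (s c : R) : 0 < s -> 0 < c ->
  (\int[mu]_(t in `]0%R, +oo[) (t `^ (s - 1) * expR (- (c * t)))%R%:E
    = (c `^ (- s) * Gamma s)%R%:E)%E.
Proof.
move=> s0 c0; have [/(integrable_fin_num (measurable_itvR _)) fin _] := integrable_gamma s0.
rewrite EFinM GammaE /Rintegral fineK//.
rewrite [X in (_ * X)%E](@ge0_integral_scale c)//=; last 2 first.
- apply/measurable_EFinP; apply: measurable_funM; first exact: measurable_powR.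
  exact: measurable_expRN.
- by move=> t; rewrite lee_fin mulr_ge0 ?powR_ge0 ?expR_ge0.
have -> : (\int[mu]_(t in `]0%R, +oo[) ((c * t) `^ (s - 1) * expR (- (c * t)))%R%:E =
  (c `^ (s - 1))%:E * \int[mu]_(t in `]0%R, +oo[) (t `^ (s - 1) * expR (- (c * t)))%R%:E)%E.
  rewrite -ge0_integralZl_EFin ?powR_ge0//.
  - apply: eq_integral => t; rewrite inE/= in_itv/= andbT => t0.
    by rewrite -EFinM powRM ?ltW// mulrA.
  - by move=> t _; rewrite lee_fin mulr_ge0 ?powR_ge0 ?expR_ge0.
  - apply/measurable_EFinP; apply: measurable_funTS; apply: measurable_funM.
      exact: measurable_powR.
    by apply: measurableT_comp => //; apply: measurableT_comp => //; exact: mulrl_measurable.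
rewrite muleA muleA -!EFinM -[X in (_ * X * _)%:E](powRr1 (ltW c0)).
rewrite -gt0_powRD// -gt0_powRD// (_ : - s + 1 + (s - 1) = 0) ?powRr0 ?mul1e//; ring.
Qed.

(** Expanding e^(t x) in the integral of x^(s-1) e^(-(1-t) x) over x > 0 and integrating term by
    term gives Gamma(s) times the series; scaling evaluates the same integral as (1 - t)^(-s)
    Gamma(s). *)
Lemma binomial_series (s t : R) : 0 < s -> 0 <= t < 1 ->
  series (fun j => gbinom (s + j%:R - 1) j * t ^+ j) @ \oo --> (1 - t) `^ (- s).
Proof.
move=> s0 /andP[t0 t1]; have G0 := Gamma_gt0 s0.
have t10 : 0 < 1 - t by rewrite subr_gt0.
have nn k : 0 <= gbinom (s + k%:R - 1) k * t ^+ k.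
  have sk : 0 < s + k%:R by rewrite ltr_pwDl.
  rewrite mulr_ge0 ?exprn_ge0// -(pmulr_lge0 _ G0) gbinom_Gamma//.
  exact: divr_ge0 (ltW (Gamma_gt0 sk)) (ler0n _ _).
have IE k : (\int[mu]_(x in `]0%R, +oo[) (x `^ (s - 1) * expR (- x) * (t ^+ k / k`!%:R * x ^+ k))%R%:E =
   (Gamma s * (gbinom (s + k%:R - 1) k * t ^+ k))%:E)%E.
  have sk : 0 < s + k%:R by rewrite ltr_pwDl.
  have [ig _] := integrable_gamma sk.
  rewrite mulrA (mulrC (Gamma s)) gbinom_Gamma// (mulrAC (Gamma (s + k%:R))).
  rewrite (_ : _ * t ^+ k / _ = t ^+ k / k`!%:R * Gamma (s + k%:R)); last by rewrite -mulrA mulrC.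
  rewrite EFinM GammaE /Rintegral fineK; last exact: (integrable_fin_num (measurable_itvR _) ig).
  rewrite -ge0_integralZl_EFin//.
  - apply: eq_integral => x; rewrite inE/= in_itv/= andbT => x0.
    by rewrite -EFinM -powRDn ?ltW//; congr EFin; ring.
  - by move=> x _; rewrite lee_fin mulr_ge0 ?powR_ge0 ?expR_ge0.
  - apply/measurable_EFinP; apply: measurable_funTS; apply: measurable_funM.
      exact: measurable_powR.
    exact: measurable_expRN.
  - by rewrite divr_ge0 ?exprn_ge0.
have : (\sum_(k <oo) (Gamma s * (gbinom (s + k%:R - 1) k * t ^+ k))%:E =
   ((1 - t) `^ (- s) * Gamma s)%:E)%E.
  rewrite -Rintegral_gamma_scale//.
  under eq_eseriesr do rewrite -IE.
  rewrite -integral_nneseries//=; last 2 first.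
  - move=> k; apply/measurable_EFinP; apply: measurable_funTS; apply: measurable_funM.
      apply: measurable_funM; first exact: measurable_powR.
      exact: measurable_expRN.
    by apply: measurable_funM => //; exact: exprn_measurable.
  - move=> k x; rewrite in_itv/= andbT => x0.
    by rewrite lee_fin !mulr_ge0 ?powR_ge0 ?expR_ge0 ?divr_ge0 ?exprn_ge0// ltW.
  apply: eq_integral => x; rewrite inE/= in_itv/= andbT => x0.
  rewrite (_ : (fun n => _) = (fun n => (x `^ (s - 1) * expR (- x) * series (exp_coeff (t * x)) n)%:E)).
    apply/cvg_lim => //; apply: cvg_EFin; first exact: nearW.
    rewrite (_ : x `^ (s - 1) * expR (- ((1 - t) * x)) =
        x `^ (s - 1) * expR (- x) * expR (t * x)); last first.
      by rewrite -mulrA -expRD; congr (_ * expR _); ring.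
    have ce : series (exp_coeff (t * x)) @ \oo --> expR (t * x).
      exact: is_cvg_series_exp_coeff.
    exact: (cvgM (cvg_cst _) ce).
  apply/funext => n; rewrite sumEFin /series/= mulr_sumr; congr EFin.
  by apply: eq_bigr => k _; rewrite /exp_coeff/= exprMn; ring.
move=> E.
have C : cvgn (series (fun k => Gamma s * (gbinom (s + k%:R - 1) k * t ^+ k))).
  apply: nnseries_is_cvg; first by move=> k; rewrite mulr_ge0// ltW.
  by rewrite E ltry.
move: E; rewrite EFin_limn_series// => -[E].
have C' : cvgn (series (fun k => gbinom (s + k%:R - 1) k * t ^+ k)).
  have := is_cvg_seriesZ (k := (Gamma s)^-1) C.
  rewrite (_ : _ *: _ = (fun k => gbinom (s + k%:R - 1) k * t ^+ k))//.
  by apply/funext => k; rewrite fctE /GRing.scale/= mulKf// gt_eqF.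
have -> : (1 - t) `^ (- s) = limn (series (fun k => gbinom (s + k%:R - 1) k * t ^+ k)).
  have G0' : Gamma s != 0 by rewrite gt_eqF.
  apply: (mulfI G0'); rewrite mulrC -E.
  by rewrite -[RHS](lim_seriesZ (Gamma s)).
exact: C'.
Qed.

End Scaling.

Section GammaEgf.
Context {R : realType}.
Notation mu := (@lebesgue_measure R).
Implicit Types (s x y : R).

Lemma powR_half_exp t k : 0 <= t -> Num.sqrt t ^+ k = t `^ (k%:R / 2) :> R.
Proof.
by move=> t0; rewrite mulrC powRrM powR12_sqrt// powR_mulrn// sqrtr_ge0.
Qed.

(** Gamma(a + k/2) is the integral of t^(a-1) e^-t sqrt(t)^k. Growth is required of [h] for the
    pointwise series and of [h] times Gamma for the integrated one, since the second does not follow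
    from the first. *)
Lemma integral_gamma_egf a h X : 0 < a -> 0 <= X -> geo h ->
  geo (fun k => h k * Gamma (a + k%:R / 2)) ->
  mu.-integrable `]0, +oo[
    (EFin \o (fun t => t `^ (a - 1) * expR (- t) * egf h (X * Num.sqrt t))) /\
  \int[mu]_(t in `]0, +oo[) (t `^ (a - 1) * expR (- t) * egf h (X * Num.sqrt t)) =
  egf (fun k => h k * Gamma (a + k%:R / 2)) X.
Proof.
move=> a0 X0 gh ghG.
have ak k : 0 < a + k%:R / 2 by rewrite ltr_pwDl// mulr_ge0.
have mg c : measurable_fun (`]0, +oo[%classic : set (measurableTypeR R)) (fun t : R => t `^ (c - 1) * expR (- t)).
  by apply: measurable_funTS; apply: measurable_funM; [exact: measurable_powR|exact: measurable_expRN].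
pose f k t := h k / k`!%:R * X ^+ k * (t `^ (a + k%:R / 2 - 1) * expR (- t)).
have fE k t : 0 < t -> f k t = t `^ (a - 1) * expR (- t) * (h k / k`!%:R * (X * Num.sqrt t) ^+ k).
  move=> t0; rewrite /f exprMn powR_half_exp ?ltW//.
  by rewrite (_ : a + _ - 1 = (a - 1) + k%:R / 2) ?gt0_powRD//; ring.
have mf k : measurable_fun (`]0, +oo[%classic : set (measurableTypeR R)) (f k).
  by apply: measurable_funM; [exact: measurable_cst|exact: mg].
have If c : 0 < c -> (\int[mu]_(t in `]0%R, +oo[) (t `^ (c - 1) * expR (- t))%R%:E = (Gamma c)%:E)%E.
  move=> c0; have [/(integrable_fin_num (measurable_itvR _)) fin _] := integrable_gamma c0.
  by rewrite GammaE /Rintegral fineK.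
have := @integral_series _ (measurableTypeR R) R mu _ (measurable_itvR `]0, +oo[) f
  (fun k => `|h k * Gamma (a + k%:R / 2) / k`!%:R * X ^+ k|) mf.
case.
- exact: is_cvg_egf_norm.
- move=> k; rewrite /f.
  under eq_integral do rewrite normrM EFinM.
  rewrite ge0_integralZl_EFin//; last first.
    by apply/measurable_EFinP; apply: measurableT_comp => //; exact: mg.
  rewrite (_ : (\int[mu]_(t in _) _)%E = (Gamma (a + k%:R / 2))%:E); last first.
    rewrite -If//; apply: eq_integral => t _.
    by rewrite ger0_norm// mulr_ge0 ?powR_ge0 ?expR_ge0.
  rewrite -EFinM lee_fin -[X in _ * X]ger0_norm ?(ltW (Gamma_gt0 (ak k)))//.
  rewrite -normrM (_ : h k * _ / _ * _ = h k / k`!%:R * X ^+ k * Gamma (a + k%:R / 2))//.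
  by generalize (Gamma (a + k%:R / 2)) => G; ring.
- move=> t /=; rewrite in_itv/= andbT => t0.
  rewrite (_ : (fun k => `|f k t|) = (fun k => `|t `^ (a - 1) * expR (- t)| *
     `|h k / k`!%:R * (X * Num.sqrt t) ^+ k|)); last first.
    by apply/funext => k; rewrite fE// normrM.
  apply: is_cvg_seriesZ; exact: is_cvg_egf_norm.
move=> Ii Is.
have E t : 0 < t -> limn (series (f^~ t)) = t `^ (a - 1) * expR (- t) * egf h (X * Num.sqrt t).
  move=> t0; rewrite unlock -[RHS](lim_seriesZ (t `^ (a - 1) * expR (- t))); last exact: is_cvg_egf.
  by apply: eq_limn_series => k; rewrite fE.
split.
  apply: eq_integrable Ii => // t; rewrite inE/= in_itv/= andbT => t0.
  by rewrite E.
move: Is; rewrite (_ : (fun k => _) = (fun k => h k * Gamma (a + k%:R / 2) / k`!%:R * X ^+ k)); last first.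
  apply/funext => k; rewrite /f RintegralZl//; last by have [] := integrable_gamma (ak k).
  by rewrite -GammaE; generalize (Gamma (a + k%:R / 2)) => G; ring.
move=> /cvg_series_lim; rewrite -egfE => ->.
by apply: eq_Rintegral => t; rewrite inE/= in_itv/= andbT => t0; rewrite E.
Qed.

End GammaEgf.

(** * Bessel functions and the uniform bound on the coefficients *)

Section Bessel.
(* [G] is [Gamma], of which only these properties matter; with an abstract [G]
   conversion checks cannot unfold the integral. *)
Context {R : realType} (G : R -> R).
Context (G_gt0 : forall s, 0 < s -> 0 < G s).
Context (GS : forall s, 0 < s -> G (s + 1) = s * G s).
Implicit Types (nu b y : R).

Lemma GDn s n : 0 < s -> G (s + n%:R) = (\prod_(i < n) (s + i%:R)) * G s.
Proof.
move=> s0; elim: n => [|n IH]; first by rewrite addr0 big_ord0 mul1r.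
have sn : 0 < s + n%:R by rewrite ltr_pwDl.
by rewrite -natr1 addrA (GS sn) IH big_ord_recr /= mulrA (mulrC (s + n%:R)).
Qed.

(** Only the recurrence is available, not monotonicity: two steps in k raise the argument by 1 and
    multiply by a factor of at least 1, so the two starting values bound all others from below. *)
Lemma G_half_ge a k : 1 <= a ->
  Num.min (G a) (G (a + 1 / 2)) <= G (a + k%:R / 2) :> R.
Proof.
move=> a1; have a0 : 0 < a by exact: lt_le_trans a1.
elim/ltn_ind: k => -[|[|k]] IH.
- by rewrite mul0r addr0 ge_min lexx.
- by rewrite ge_min lexx orbT.
- have ak : 0 < a + k%:R / 2 by rewrite ltr_pwDl// mulr_ge0.
  have -> : a + k.+2%:R / 2 = (a + k%:R / 2) + 1.
    by rewrite -addn2 natrD; field.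
  rewrite GS//; apply: le_trans (IH k _) _; first by rewrite ltnS leqW.
  have := G_gt0 ak; generalize (G (a + k%:R / 2)) => Ga G0.
  by rewrite ler_peMl ?(ltW G0)// (le_trans a1)// lerDl mulr_ge0.
Qed.

Lemma geo_G_half_inv a : 1 <= a -> geo (fun k => (G (a + k%:R / 2))^-1).
Proof.
move=> a1; have a0 : 0 < a by exact: lt_le_trans a1.
pose m : R := Num.min (G a) (G (a + 1 / 2)).
have m0 : 0 < m.
  rewrite lt_min (G_gt0 a0); apply: G_gt0.
  by rewrite addr_gt0.
apply: (@geo_bound _ _ m^-1) => k.
have G0 := lt_le_trans m0 (G_half_ge k a1).
by rewrite normfV lef_pV2 ?posrE ?normr_gt0 ?(gt_eqF G0)// (gtr0_norm G0) G_half_ge.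
Qed.

Lemma geo_G_inv a : 1 <= a -> geo (fun k => (G (a + k%:R))^-1).
Proof.
move=> a1; have a0 : 0 < a by exact: lt_le_trans a1.
apply: (@geo_bound _ _ (G a)^-1) => k.
have G0 : 0 < G (a + k%:R) by apply: G_gt0; rewrite ltr_pwDl.
rewrite normfV (gtr0_norm G0) lef_pV2 ?posrE ?(G_gt0 a0)//.
rewrite GDn// ler_peMl ?(ltW (G_gt0 a0))//.
elim: k {G0} => [|k IH]; first by rewrite big_ord0.
rewrite big_ord_recr/= mulr_ege1//.
by apply: (le_trans a1); rewrite lerDl.
Qed.

Definition phicoef nu (k : nat) : R := (-1) ^+ k / G (nu + 1 + k%:R).

(* y^(-nu/2) J_nu(2 sqrt y) *)
Definition phi nu y : R := egf (phicoef nu) y.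

Lemma geo_phicoef nu : 0 <= nu -> geo (phicoef nu).
Proof.
by move=> nu0; apply: geoM; [exact: geo_exp|apply: geo_G_inv; rewrite lerDr].
Qed.

Lemma is_derive_phi nu y : 0 <= nu -> is_derive y 1 (phi nu) (- phi (nu + 1) y).
Proof.
move=> nu0; have := is_derive_egf y (geo_phicoef nu0).
have nu10 : 0 <= nu + 1 by rewrite addr_ge0.
rewrite -(mulN1r (phi _ _)) /phi -egfZ; last exact: geo_phicoef.
rewrite (@eq_egf _ (fun k => phicoef nu k.+1) (fun k => -1 * phicoef (nu + 1) k))//.
move=> k; rewrite /phicoef exprS -mulrA; congr (_ * (_ / G _)).
by rewrite -natr1; ring.
Qed.

(** The three-term recurrence J_(mu-1)(x) + J_(mu+1)(x) = (2 mu / x) J_mu(x) with mu = nu + 1 and x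
    = 2 sqrt y. *)
Lemma phi_rec nu y : 0 <= nu -> y * phi (nu + 2) y = (nu + 1) * phi (nu + 1) y - phi nu y.
Proof.
move=> nu0; have g0 := geo_phicoef nu0.
have g1 : geo (phicoef (nu + 1)) by apply: geo_phicoef; rewrite addr_ge0.
have g2 : geo (phicoef (nu + 2)) by apply: geo_phicoef; rewrite addr_ge0.
rewrite /phi mul_egf// -egfZ// -[in RHS](mulN1r (egf _ _)) -egfZ// -egfD//; last 2 first.
- exact: geoZ.
- exact: geoZ.
apply: eq_egf => -[|k].
  rewrite mul0r /phicoef expr0 !addr0 !mul1r GS; last by rewrite ltr_wpDl.
  have nu1 : 0 < nu + 1 by rewrite ltr_wpDl.
  have G0 := G_gt0 nu1; by field; rewrite !gt_eqF.
rewrite /phicoef /= exprS.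
have p1 : 0 < nu + 2 + k%:R :> R by rewrite ltr_pwDl// ltr_wpDl.
have -> : nu + 2 + 1 + k%:R = nu + 2 + k%:R + 1 by ring.
have -> : nu + 1 + 1 + k.+1%:R = nu + 2 + k%:R + 1 by rewrite -natr1; ring.
have -> : nu + 1 + k.+1%:R = nu + 2 + k%:R by rewrite -natr1; ring.
rewrite GS//; have G0 := G_gt0 p1.
rewrite -natr1; field.
by rewrite !gt_eqF.
Qed.

(* The energy phi_nu^2 + y phi_(nu+1)^2 is nonincreasing in y. *)
Lemma phi_bounded nu y : 0 <= nu -> 0 <= y -> `|phi nu y| <= (G (nu + 1))^-1.
Proof.
move=> nu0 y0.
have nu1 : 0 <= nu + 1 by rewrite addr_ge0.
pose E (t : R) := phi nu t ^+ 2 + t * phi (nu + 1) t ^+ 2.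
have dE (t : R) : is_derive t 1 E (- (2 * nu + 1) * phi (nu + 1) t ^+ 2).
  have d0 := is_derive_phi t nu0.
  have d1 := is_derive_phi t nu1.
  rewrite /E; apply: is_derive_eq.
  rewrite /GRing.scale/= !mulr1.
  have := phi_rec t nu0; rewrite (_ : nu + 1 + 1 = nu + 2); last by ring.
  move: (phi nu t) (phi (nu + 1) t) (phi (nu + 2) t) => p0 p1 p2 h.
  rewrite (_ : t * (p1 * - p2 + p1 * - p2) = - 2 * p1 * (t * p2)); last by ring.
  by rewrite h; ring.
have E0 : E 0 = (G (nu + 1))^-1 ^+ 2.
  by rewrite /E mul0r addr0 /phi egf_at0 /phicoef expr0 addr0 mul1r.
have nG := G_gt0 (ltr_wpDl nu0 ltr01).
rewrite -[leRHS]gtr0_norm ?invr_gt0// -ler_sqr ?nnegrE// !real_normK ?num_real// -E0.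
apply: (@le_trans _ _ (E y)); first by rewrite lerDl mulr_ge0// sqr_ge0.
apply: (@ler0_derive1_le_cc _ E 0 y); rewrite ?in_itv/= ?lexx ?y0//.
- move=> t _; rewrite derive1E (@derive_val _ _ _ _ _ _ _ (dE t)).
  by rewrite mulNr oppr_le0 mulr_ge0 ?sqr_ge0// addr_ge0// mulr_ge0.
- apply: derivable_within_continuous => t _; by have [] := dE t.
Qed.

(** Each use of [phi_rec] divides by y and raises the order by 2. Two consecutive orders are carried
    along because the recurrence needs both. The rate y^-i is cruder than the true Bessel decay. *)
Lemma phi_decay nu i : 0 <= nu -> exists C, forall y, 1 <= y ->
  `|phi (nu + (2 * i)%:R) y| <= C * y ^- i /\
  `|phi (nu + (2 * i)%:R + 1) y| <= C * y ^- i.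
Proof.
move=> nu0; elim: i => [|i [C hC]].
  exists (Num.max (G (nu + 1))^-1 (G (nu + 1 + 1))^-1) => y y1.
  have y0 : 0 <= y by exact: le_trans y1.
  rewrite muln0 addr0 expr0 invr1 mulr1 !le_max; split.
    by rewrite phi_bounded.
  by rewrite (@phi_bounded (nu + 1)) ?orbT// addr_ge0.
set mu := nu + _ in hC.
have mu0 : 0 <= mu by rewrite addr_ge0.
have -> : nu + (2 * i.+1)%:R = mu + 2 by rewrite /mu mulnS natrD; ring.
have C0 : 0 <= C.
  have [h _] := hC 1 (lexx 1); move: h.
  by rewrite expr1n invr1 mulr1; exact: le_trans.
(* [D] serves for order mu + 2 and [(mu + 2) * D + C] for order mu + 3; their sum serves for
   both. *)
pose D := (mu + 2) * C; exists ((mu + 2) * D + C + D) => y y1.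
have y0 : 0 < y by exact: lt_le_trans y1.
have [h0 h1] := hC _ y1.
have Ey : y ^- i.+1 = y^-1 * y ^- i by rewrite exprS invfM.
have yi0 : 0 <= y ^- i by rewrite invr_ge0 exprn_ge0// ltW.
have yi10 : 0 <= y ^- i.+1 by rewrite invr_ge0 exprn_ge0// ltW.
have le_yi : y ^- i.+1 <= y ^- i.
  by rewrite Ey ler_piMl// invf_le1.
have D0 : 0 <= D by rewrite mulr_ge0// addr_ge0.
have rec q p a : y * q = p -> `|p| <= a * y ^- i -> `|q| <= a * y ^- i.+1.
  move=> qp pa; rewrite Ey mulrCA -ler_pdivrMl ?invr_gt0// invrK.
  by rewrite -[X in X * _](gtr0_norm y0) -normrM qp.
have h2 : `|phi (mu + 2) y| <= D * y ^- i.+1.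
  apply: (rec _ _ _ (phi_rec y mu0)).
  rewrite (le_trans (ler_normB _ _))// normrM ger0_norm ?addr_ge0//.
  rewrite /D (_ : (mu + 2) * C * y ^- i = (mu + 1) * (C * y ^- i) + C * y ^- i); last by ring.
  by rewrite lerD// ler_wpM2l// addr_ge0.
have D1 : 0 <= (mu + 2) * D by rewrite mulr_ge0// addr_ge0.
split.
  by apply: (le_trans h2); rewrite ler_wpM2r// lerDr addr_ge0.
have mu1 : 0 <= mu + 1 by rewrite addr_ge0.
have := phi_rec y mu1; rewrite (_ : mu + 1 + 2 = mu + 2 + 1); last by ring.
move=> /rec; apply.
rewrite (le_trans (ler_normB _ _))// normrM ger0_norm ?addr_ge0//.
have -> : mu + 1 + 1 = mu + 2 by ring.
rewrite (_ : _ * y ^- i = (mu + 2) * (D * y ^- i) + C * y ^- i + D * y ^- i); last by ring.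
apply: ler_wpDr; first exact: mulr_ge0.
apply: lerD => //; apply: ler_wpM2l; first exact: addr_ge0.
by apply: (le_trans h2); rewrite ler_wpM2l.
Qed.

(** The order is raised by m = 2 i with i >= b: for y >= 1 the decay y^-i compensates y^b, and for y
    < 1 the function itself is bounded. *)
Lemma phi_powR_bounded b : 0 < b -> exists m C, forall y, 0 < y ->
  y `^ b * `|phi (b + m%:R) y| <= C.
Proof.
move=> b0; pose i := (Num.truncn b).+1; exists (2 * i)%N.
have bi : b <= i%:R by apply/ltW/truncnS_gt.
have [C hC] := phi_decay i (ltW b0).
set nu := b + _ in hC *.
have nu0 : 0 <= nu by rewrite addr_ge0// ltW.
exists (Num.max C (G (nu + 1))^-1) => y y0; rewrite le_max; apply/orP.
have [y1|y1] := leP 1 y; [left|right].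
  have [h _] := hC _ y1.
  have C0 : 0 <= C.
    have [h' _] := hC 1 (lexx 1); move: h'.
    by rewrite expr1n invr1 mulr1; exact: le_trans.
  apply: (le_trans (ler_wpM2l (powR_ge0 _ _) h)).
  rewrite mulrCA ler_piMr// ler_pdivrMr ?exprn_gt0// mul1r.
  by rewrite -powR_mulrn ?(ltW y0)// ler_powR.
rewrite -[leRHS]mul1r ler_pM ?powR_ge0//; last by rewrite phi_bounded// ltW.
have := ge0_ler_powR (ltW b0) _ _ (ltW y1); rewrite (congr1 (@^~ b) (@powR1 R)).
by apply; rewrite nnegrE// ltW.
Qed.

End Bessel.

Section UniformBound.
Context {R : realType} (G : R -> R).
Notation mu := (@lebesgue_measure R).
Context (G_gt0 : forall s, 0 < s -> 0 < G s).
Context (GS : forall s, 0 < s -> G (s + 1) = s * G s).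
Context (GI : forall a, 0 < a ->
  mu.-integrable `]0, +oo[ (EFin \o (fun t => t `^ (a - 1) * expR (- t))) /\
  \int[mu]_(t in `]0, +oo[) (t `^ (a - 1) * expR (- t)) = G a).
Context (GIegf : forall a h X, 0 < a -> 0 <= X -> geo h ->
  geo (fun k => h k * G (a + k%:R / 2)) ->
  mu.-integrable `]0, +oo[
    (EFin \o (fun t => t `^ (a - 1) * expR (- t) * egf h (X * Num.sqrt t))) /\
  \int[mu]_(t in `]0, +oo[) (t `^ (a - 1) * expR (- t) * egf h (X * Num.sqrt t)) =
  egf (fun k => h k * G (a + k%:R / 2)) X).
Context (b : R) (b0 : 0 < b).

(* With Gamma(a + k/2) written as an integral, the left-hand series is an average
   of dilations of [egf h]. *)
Lemma egf_mulG_bounded a h C : b / 2 < a -> geo h ->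
  geo (fun k => h k * G (a + k%:R / 2)) ->
  (forall X, 0 < X -> X `^ b * `|egf h X| <= C) ->
  forall X, 0 < X -> X `^ b * `|egf (fun k => h k * G (a + k%:R / 2)) X| <= C * G (a - b / 2).
Proof.
move=> ba gh ghG hC X X0.
have a0 : 0 < a by apply: lt_trans ba; rewrite divr_gt0.
have [Ii <-] := GIegf a0 (ltW X0) gh ghG.
have ab0 : 0 < a - b / 2 by rewrite subr_gt0.
have [I0 <-] := GI ab0.
apply: (le_trans (ler_wpM2l (powR_ge0 _ _) (le_normr_Rintegral (measurable_itvR _) Ii))).
have In := integrable_norm Ii.
rewrite -(RintegralZl _ (measurable_itvR _) In) -(RintegralZl _ (measurable_itvR _) I0).
apply: le_Rintegral; first exact: measurable_itvR.
- exact: integrableZl (measurable_itvR _) _ _ In.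
- exact: integrableZl (measurable_itvR _) _ _ I0.
move=> t /=; rewrite in_itv/= andbT => t0.
have st : 0 < Num.sqrt t by rewrite sqrtr_gt0.
have := hC (X * Num.sqrt t) (mulr_gt0 X0 st).
rewrite (_ : (X * Num.sqrt t) `^ b = X `^ b * t `^ (2^-1 * b)); last first.
  by rewrite powRM ?(ltW X0) ?(ltW st)// powRrM powR12_sqrt// ltW.
move: (egf h _) => e; rewrite normrM ger0_norm ?mulr_ge0 ?powR_ge0 ?expR_ge0//.
rewrite (_ : 2^-1 * b = b / 2); last by ring.
move=> he.
rewrite (_ : t `^ (a - 1) = t `^ (b / 2) * t `^ (a - b / 2 - 1)); last first.
  by rewrite -gt0_powRD//; congr (_ `^ _); ring.
rewrite (_ : X `^ b * _ = X `^ b * t `^ (b / 2) * `|e| * (t `^ (a - b / 2 - 1) * expR (- t))); last by ring.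
by rewrite ler_wpM2r// mulr_ge0 ?powR_ge0 ?expR_ge0.
Qed.

(* Legendre's duplication formula, up to the value of the constant. *)
Lemma G_dup k :
  G (b / 2 + 1 + k%:R / 2) * G ((b + 1) / 2 + k%:R / 2) * 2 ^+ k * G (b + 1) =
  G (b / 2 + 1) * G ((b + 1) / 2) * G (b + 1 + k%:R).
Proof.
elim: k => [|k IH]; first by rewrite !mul0r !addr0 expr0 mulr1.
have p1 : 0 < (b + 1) / 2 + k%:R / 2 by rewrite ltr_pwDl// divr_gt0// addr_gt0.
have p2 : 0 < b + 1 + k%:R by rewrite ltr_pwDl// addr_gt0.
have -> : b / 2 + 1 + k.+1%:R / 2 = (b + 1) / 2 + k%:R / 2 + 1 by rewrite -natr1; field.
have -> : (b + 1) / 2 + k.+1%:R / 2 = b / 2 + 1 + k%:R / 2 by rewrite -natr1; field.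
have -> : b + 1 + k.+1%:R = b + 1 + k%:R + 1 by rewrite -natr1; ring.
rewrite (GS p1) (GS p2) exprS.
transitivity ((b + 1 + k%:R) * (G (b / 2 + 1 + k%:R / 2) * G ((b + 1) / 2 + k%:R / 2) * 2 ^+ k * G (b + 1))).
  by field.
by rewrite IH; ring.
Qed.

(** With s = (b + 1)/2 + k/2 the factors 2 s + l are b + 1 + k + l, the price of raising the Bessel
    order from b to b + m. In the induction 2 s + m = 2 (s + i) + (m - 2 i), and (s + i) G(s + i) =
    G(s + i + 1). *)
Lemma prod_G m : exists c : nat -> R, forall s, 0 < s ->
  (\prod_(l < m) (2 * s + l%:R)) * G s = \sum_(i < m.+1) c i * G (s + i%:R).
Proof.
elim: m => [|m [c hc]].
  by exists (fun=> 1) => s s0; rewrite big_ord0 big_ord1 addr0.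
exists (fun i => (if i is j.+1 then 2 * c j else 0) +
   (if (i < m.+1)%N then (m%:R - 2 * i%:R) * c i else 0)) => s s0.
rewrite big_ord_recr/= mulrAC hc// big_distrl/=.
under [RHS]eq_bigr do rewrite mulrDl.
rewrite big_split/= [X in _ = X + _]big_ord_recl/= mul0r add0r.
rewrite [X in _ = _ + X]big_ord_recr/= ltnn mul0r addr0 -big_split/=.
apply: eq_bigr => i _; rewrite ltn_ord.
have si : 0 < s + i%:R by rewrite ltr_pwDl.
rewrite (_ : s + (lift ord0 i)%:R = s + i%:R + 1); last by rewrite lift0 -natr1; ring.
by rewrite GS//; ring.
Qed.

Let a0 : R := (b + 1) / 2.
Let a1 : R := b / 2 + 1.
Let a00 : 0 < a0. Proof. by rewrite divr_gt0// addr_gt0. Qed.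
Let a11 : 1 <= a1. Proof. by rewrite lerDr divr_ge0// ltW. Qed.
Let a10 : 0 < a1. Proof. exact: lt_le_trans a11. Qed.
Let D : R := G a1 * G a0 / G (b + 1).
Let b1 : 0 < b + 1. Proof. by rewrite addr_gt0. Qed.
Let D0 : 0 < D. Proof. by rewrite divr_gt0// ?mulr_gt0// G_gt0. Qed.

Lemma geo_lin c1 c2 : geo (fun k => c1 + c2 * k%:R : R).
Proof. by apply: geoD; [exact: geo_cst|apply: geoZ; exact: geo_nat]. Qed.

Let G_dup' k : G (a0 + k%:R / 2) / G (b + 1 + k%:R) =
  D * 2^-1 ^+ k / G (a1 + k%:R / 2).
Proof.
have := G_dup k; rewrite -/a0 -/a1 /D => h.
have p1 : 0 < G (b + 1 + k%:R) by apply: G_gt0; rewrite ltr_pwDl.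
have p2 : 0 < G (a1 + k%:R / 2) by apply: G_gt0; rewrite ltr_pwDl.
have p3 := G_gt0 b1.
have p4 : 0 < 2 ^+ k :> R by rewrite exprn_gt0.
rewrite exprVn (_ : G a1 * G a0 = G (a1 + k%:R / 2) * G (a0 + k%:R / 2) * 2 ^+ k *
  G (b + 1) / G (b + 1 + k%:R)); last by rewrite h mulfK// gt_eqF.
by field; rewrite !gt_eqF.
Qed.

(** The growth hypotheses of the two averages. The factor G(a0 + i + k/2) grows faster than
    geometrically, but by duplication the quotient G(a0 + k/2) / G(b + 1 + k) is a constant times
    2^-k / G(a1 + k/2), and shifts of the arguments cost only polynomials in k or factors bounded by
    1. A further G(a1 + j + k/2) then cancels the remaining denominator up to a polynomial. *)
Let geo_phiG m i : geo (fun k => phicoef G (b + m%:R) k * G (a0 + i%:R + k%:R / 2)) /\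
  forall j, geo (fun k => phicoef G (b + m%:R) k * G (a0 + i%:R + k%:R / 2) *
     G (a1 + j%:R + k%:R / 2)).
Proof.
pose P n a k : R := \prod_(l < n) (a + k%:R / 2 + l%:R).
have gP n a : geo (P n a).
  apply: (@geo_prod _ _ (fun l k => a + k%:R / 2 + l%:R)) => l; apply: (geo_ext _ (geo_lin (a + l%:R) (1 / 2))) => k.
  by field.
have GP n a k : 0 < a -> G (a + n%:R + k%:R / 2) = P n a k * G (a + k%:R / 2).
  by move=> a_gt0; rewrite /P -GDn// ?ltr_pwDl//; congr G; ring.
pose Q k : R := (\prod_(l < m) (b + 1 + k%:R + l%:R))^-1.
have gQ : geo Q.
  apply: (@geo_bound _ _ 1) => k; rewrite /Q normfV invf_le1; last first.
    rewrite normr_gt0 gt_eqF// prodr_gt0// => l _.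
    by rewrite !ltr_pwDl.
  rewrite ger0_norm; last first.
    by apply: prodr_ge0 => l _; rewrite !addr_ge0// ltW.
  elim/big_ind: _ => [//|x y x1 y1|l _]; first exact: mulr_ege1.
  by rewrite -!addrA addrCA lerDl !addr_ge0// ltW.
have E k : phicoef G (b + m%:R) k * G (a0 + i%:R + k%:R / 2) =
    (-1) ^+ k * Q k * P i a0 k * (D * 2^-1 ^+ k) * (G (a1 + k%:R / 2))^-1.
  rewrite /phicoef (_ : b + m%:R + 1 + k%:R = b + 1 + k%:R + m%:R); last by ring.
  have bk : 0 < b + 1 + k%:R by rewrite ltr_pwDl.
  rewrite GDn// GP// -mulrA -[in RHS]mulrA -G_dup' /Q invfM.
  by move: (\prod_(l < m) _) (P i a0 k) (G _) (G _) => *; ring.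
have gE : geo (fun k => (-1) ^+ k * Q k * P i a0 k * (D * 2^-1 ^+ k)).
  apply: geoM; last by apply: geoZ; exact: geo_exp.
  by apply: geoM => //; apply: geoM => //; exact: geo_exp.
split.
  by apply: (geo_ext E); apply: geoM => //; exact: geo_G_half_inv.
move=> j; apply: (geo_ext _ (geoM gE (gP j a1))) => k.
have Gk : 0 < G (a1 + k%:R / 2) by rewrite G_gt0// ltr_pwDl.
rewrite E GP//; move: (Q k) (P i a0 k) (P j a1 k) => q p1 p2.
by field; rewrite gt_eqF.
Qed.

(** Written with [G], the binomial coefficient is G(a1 + J + k/2) / (J! G(a1 + k/2)). [G_dup'] and
    [prod_G] turn it into a combination of coefficients of phi_(b+m) times G(a0 + i + k/2) G(a1 + J
    + k/2) 2^k, and [egf_mulG_bounded] is applied once for each of the two [G] factors. *)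
Lemma egf_gbinom_bounded : exists C, forall J X, 0 < X ->
  X `^ b * `|egf (fun k => (-1) ^+ k * gbinom ((b + k%:R) / 2 + J%:R) J) X| <= C.
Proof.
have [m [C0 hC0]] := phi_powR_bounded G_gt0 GS b0.
have [c hc] := prod_G m.
have CC0 : 0 <= C0 by apply: le_trans (hC0 1 ltr01); rewrite mulr_ge0 ?powR_ge0.
pose F i J := egf (fun k => phicoef G (b + m%:R) k * G (a0 + i%:R + k%:R / 2) *
     G (a1 + J%:R + k%:R / 2)).
have gphi : geo (phicoef G (b + m%:R)).
  by apply: geo_phicoef => //; rewrite addr_ge0// ltW.
have hF i J X : 0 < X -> X `^ b * `|F i J X| <= C0 * G (1 / 2 + i%:R) * G (1 + J%:R).
  move=> X0; have [g1 g2] := geo_phiG m i.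
  have := @egf_mulG_bounded (a0 + i%:R) (phicoef G (b + m%:R)) C0 _ gphi g1 hC0.
  rewrite (_ : a0 + i%:R - b / 2 = 1 / 2 + i%:R); last by rewrite /a0; field.
  have lt1 : b / 2 < a0 + i%:R.
    by rewrite /a0 mulrDl mul1r -addrA ltrDl ltr_pwDl.
  move=> /(_ lt1) h1.
  have := @egf_mulG_bounded (a1 + J%:R) _ _ _ g1 (g2 J) h1 X X0.
  rewrite (_ : a1 + J%:R - b / 2 = 1 + J%:R); last by rewrite /a1; field.
  by apply; rewrite /a1 -addrA ltrDl ltr_pwDl.
(* The second average contributes G(1 + J) = J! G(1), and the J! of the binomial coefficient cancels
   it; hence a constant free of [J]. *)
exists (\sum_(i < m.+1) `|c i| * (C0 * G (1 / 2 + i%:R)) * (G 1 / D)) => J X X0.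
have fJ : 0 < J`!%:R :> R by rewrite ltr0n fact_gt0.
have G1 := G_gt0 ltr01.
have E : egf (fun k => (-1) ^+ k * gbinom ((b + k%:R) / 2 + J%:R) J) X =
   \sum_(i < m.+1) c i * (F i J (2 * X) / (J`!%:R * D)).
  transitivity (\sum_(i < m.+1) egf (fun k => (c i / (J`!%:R * D)) * (phicoef G (b + m%:R) k * G (a0 + i%:R + k%:R / 2) *
     G (a1 + J%:R + k%:R / 2) * 2 ^+ k)) X); last first.
    apply: eq_bigr => i _; rewrite egfZ; last first.
      by apply: geoM; [have [_] := geo_phiG m i; apply|exact: geo_exp].
    by rewrite egf_scale /F; ring.
  rewrite -(egf_sum _ (h := fun i k => (c i / (J`!%:R * D)) * (phicoef G (b + m%:R) k * G (a0 + i%:R + k%:R / 2) *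
     G (a1 + J%:R + k%:R / 2) * 2 ^+ k))); last first.
    by move=> i; apply: geoZ; apply: geoM; [have [_] := geo_phiG m i; apply|exact: geo_exp].
  apply: eq_egf => k; set s := a1 + k%:R / 2.
  have s0 : 0 < s by rewrite ltr_pwDl.
  have t0 : 0 < a0 + k%:R / 2 by rewrite ltr_pwDl.
  have bk : 0 < b + 1 + k%:R by rewrite ltr_pwDl.
  rewrite (_ : (b + k%:R) / 2 + J%:R = s + J%:R - 1); last by rewrite /s /a1; field.
  rewrite gbinom_prod (_ : \prod_(i < J) (s + i%:R) = G (s + J%:R) / G s); last first.
    by rewrite GDn// mulfK// gt_eqF// G_gt0.
  transitivity ((-1) ^+ k / G (b + 1 + k%:R + m%:R) * G (s + J%:R) * 2 ^+ k / (J`!%:R * D) *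
    \sum_(i < m.+1) c i * G (a0 + k%:R / 2 + i%:R)); last first.
    rewrite big_distrr/=; apply: eq_bigr => i _; rewrite /phicoef.
    rewrite (_ : b + m%:R + 1 + k%:R = b + 1 + k%:R + m%:R); last by ring.
    rewrite (_ : a0 + i%:R + k%:R / 2 = a0 + k%:R / 2 + i%:R); last by ring.
    rewrite (_ : a1 + J%:R + k%:R / 2 = s + J%:R); last by rewrite /s; ring.
    by move: (G _) (G _) (G _) => *; ring.
  rewrite -hc// (_ : 2 * (a0 + k%:R / 2) = b + 1 + k%:R); last by rewrite /a0; field.
  rewrite [G (b + 1 + k%:R + m%:R)]GDn//; set p := \prod_(l < m) _.
  have p0 : 0 < p by apply: prodr_gt0 => l _; rewrite ltr_pwDl.
  have := G_dup' k; rewrite -/s.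
  have := G_gt0 s0; have := G_gt0 bk; move: (G (s + _)) (G _) (G s) (G (b + 1 + k%:R)) => g1 g2 g3 g4 g40 g30 dup.
  rewrite (_ : _ * (p * g2) = (-1) ^+ k * g1 * 2 ^+ k / (J`!%:R * D) * (g2 / g4)); last first.
    by field; rewrite !gt_eqF.
  rewrite dup exprVn; field.
  by rewrite !gt_eqF// exprn_gt0.
have X20 : 0 < 2 * X by rewrite mulr_gt0.
rewrite E; apply: (le_trans (ler_wpM2l (powR_ge0 _ _) (ler_norm_sum _ _ _))).
rewrite big_distrr/=; apply: ler_sum => i _.
have h := hF i J _ X20.
have GJ : G (1 + J%:R) = J`!%:R * G 1.
  rewrite GDn//; congr (_ * _); elim: J {E h fJ} => [|J IH]; first by rewrite big_ord0 fact0.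
  by rewrite big_ord_recr/= IH factS natrM mulrC -natr1 addrC.
rewrite !normrM normfV (gtr0_norm (mulr_gt0 fJ D0)) mulrCA -!mulrA ler_wpM2l//.
rewrite (_ : C0 * (G (1 / 2 + i%:R) * (G 1 / D)) = (C0 * G (1 / 2 + i%:R) * G (1 + J%:R)) / (J`!%:R * D)); last first.
  by rewrite GJ; field; rewrite !gt_eqF.
have JD0 := mulr_gt0 fJ D0; rewrite mulrA ler_wpM2r ?invr_ge0 ?(ltW JD0)//.
(* The 2^k of the duplication formula evaluates the series at 2 X, and X^b <= (2 X)^b. *)
apply: le_trans h; rewrite ler_wpM2r// ge0_ler_powR ?nnegrE ?(ltW X0) ?(ltW X20) ?(ltW b0)//.
by rewrite ler_peMl ?(ltW X0)// ler1n.
Qed.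

End UniformBound.

(** * The coefficients of G_b(x / sqrt (1 - t)) in powers of t *)

Section LagrangeCoefficients.
Context {R : realType}.
Implicit Types (b x t : R).

Definition lagr_coef b (j k : nat) : R :=
  (-1) ^+ k * gbinom ((b + k%:R) / 2 + j%:R - 1) j / (b + k%:R).

(* The coefficient of t^j in G_b(x / sqrt (1 - t)). *)
Definition lagr b j x : R := x `^ b / Gamma b * egf (lagr_coef b j) x.

Let half_gt0 b k : 0 < b -> 0 < (b + k%:R) / 2 :> R.
Proof. by move=> b0; rewrite divr_gt0// ltr_pwDl. Qed.

Lemma gbinom_ge0 (s : R) j : 0 < s -> 0 <= gbinom (s + j%:R - 1) j.
Proof.
move=> s0; rewrite gbinom_prod divr_ge0// prodr_ge0// => i _.
by rewrite addr_ge0// ltW.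
Qed.

Lemma geo_gbinom b j : geo (fun k => gbinom ((b + k%:R) / 2 + j%:R - 1) j : R).
Proof.
apply: (geo_ext (g := fun k => (j`!%:R)^-1 * \prod_(i < j) ((b + k%:R) / 2 + i%:R))).
  by move=> k; rewrite gbinom_prod mulrC.
apply: geoZ; apply: (@geo_prod _ _ (fun i k => (b + k%:R) / 2 + i%:R)) => i.
apply: (geo_ext _ (geo_lin (b / 2 + i%:R) (1 / 2))) => k.
by field.
Qed.

Lemma geo_lagr_coef b j : 0 < b -> geo (lagr_coef b j).
Proof.
move=> b0; apply: geoM; last exact: geo_inv.
by apply: geoM; [exact: geo_exp|exact: geo_gbinom].
Qed.

Lemma lagr_bounded b : 0 < b ->
  exists C, forall j x, (0 < j)%N -> 0 < x -> `|lagr b j x| <= C / j%:R.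
Proof.
move=> b0.
have GI (a : R) : 0 < a ->
    lebesgue_measure.-integrable `]0, +oo[ (EFin \o (fun t => t `^ (a - 1) * expR (- t))) /\
    \int[lebesgue_measure]_(t in `]0, +oo[) (t `^ (a - 1) * expR (- t)) = Gamma a.
  by move=> a0; split; [have [] := integrable_gamma a0|rewrite GammaE].
have [C hC] := @egf_gbinom_bounded R Gamma (@Gamma_gt0 R) (@GammaS R) GI (@integral_gamma_egf R) b b0.
exists (C / (2 * Gamma b)) => -[//|j] x _ x0.
have G0 := Gamma_gt0 b0.
have E : egf (lagr_coef b j.+1) x = (2 * j.+1%:R)^-1 *
    egf (fun k => (-1) ^+ k * gbinom ((b + k%:R) / 2 + j%:R) j) x.
  rewrite -egfZ; last first.
    apply: geoM; first exact: geo_exp.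
    apply: (geo_ext _ (geo_gbinom (b + 2) j)) => k.
    by congr gbinom; field.
  apply: eq_egf => k; rewrite /lagr_coef.
  have bk : 0 < b + k%:R by rewrite ltr_pwDl.
  rewrite gbinom_prod (_ : (b + k%:R) / 2 + j%:R = ((b + k%:R) / 2 + 1) + j%:R - 1); last by ring.
  (* The factor i = 0, which is (b + k)/2, is split off: it cancels b + k and leaves 1 / (2 (j +
     1)). *)
  rewrite gbinom_prod big_ord_recl/= addr0 factS natrM.
  rewrite (eq_bigr (fun i : 'I_j => (b + k%:R) / 2 + 1 + i%:R)); last first.
    by move=> i _; rewrite /bump/= add1n -natr1; ring.
  move: (\prod_(i < j) _) => p.
  have j0 : 0 < j`!%:R :> R by rewrite ltr0n fact_gt0.
  by field; rewrite !gt_eqF.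
rewrite /lagr E normrM (ger0_norm (divr_ge0 (powR_ge0 _ _) (ltW G0))) normrM.
rewrite [X in _ * (X * _)]ger0_norm//.
have := hC j x x0; move: (`|egf _ _|) => e h.
rewrite (_ : _ / _ * _ = x `^ b * e * (2 * Gamma b * j.+1%:R)^-1); last first.
  by move: (Gamma b) G0 => G G0; field; rewrite !gt_eqF.
rewrite -[leRHS]mulrA -[X in _ <= _ * X]invfM ler_wpM2r// invr_ge0.
by rewrite !mulr_ge0// ltW.
Qed.

(** The k-th term of the power series of the incomplete gamma function at x / sqrt (1 - t) carries
    (1 - t)^(-(b + k)/2), whose binomial series has nonnegative terms; [egf_series_swap] then
    exchanges the two sums. *)
Lemma lagr_series b t x : 0 < b -> 0 <= t < 1 -> 0 < x ->
  series (fun j => lagr b j x * t ^+ j) @ \oo --> gamma_cdf b (x / Num.sqrt (1 - t)).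
Proof.
move=> b0 /andP[t0 t1] x0.
have u0 : 0 < 1 - t by rewrite subr_gt0.
have s0 : 0 < Num.sqrt (1 - t) by rewrite sqrtr_gt0.
pose h k : R := (-1) ^+ k / (b + k%:R).
pose B j k : R := gbinom ((b + k%:R) / 2 + j%:R - 1) j * t ^+ j.
pose l k : R := (1 - t) `^ (- (b / 2)) * (Num.sqrt (1 - t))^-1 ^+ k.
have gh : geo h := geo_sign_inv b0.
have ghl : geo (fun k => h k * l k) by apply: geoM => //; apply: geoZ; exact: geo_exp.
have Bl k : series (B^~ k) @ \oo --> l k.
  rewrite /l (_ : _ * _ = (1 - t) `^ (- ((b + k%:R) / 2))).
    by apply: binomial_series; [exact: half_gt0|rewrite t0].
  rewrite (_ : - ((b + k%:R) / 2) = - (b / 2) + - (k%:R / 2)); last by ring.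
  rewrite gt0_powRD//; congr (_ * _).
  by rewrite exprVn powRN powR_half_exp// ltW.
have B0 j k : 0 <= B j k.
  by rewrite mulr_ge0 ?exprn_ge0// gbinom_ge0// half_gt0.
have := egf_series_swap B0 Bl ghl => /(_ x).
move=> /(cvgM (cvg_cst (x `^ b / Gamma b))).
rewrite (_ : x `^ b / Gamma b * egf (fun k => h k * l k) x = gamma_cdf b (x / Num.sqrt (1 - t))); last first.
  rewrite /gamma_cdf -/(igamma b _) igamma_egf// ?divr_ge0 ?(ltW x0) ?(ltW s0)//.
  rewrite (@eq_egf _ _ (fun k => (1 - t) `^ (- (b / 2)) * (h k * (Num.sqrt (1 - t))^-1 ^+ k))); last first.
    by move=> k; rewrite /l; ring.
  rewrite egfZ; last by apply: geoM => //; exact: geo_exp.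
  rewrite egf_scale (mulrC _^-1 x) powRM ?(ltW x0) ?invr_ge0 ?(ltW s0)//.
  rewrite (_ : (Num.sqrt (1 - t))^-1 `^ b = (1 - t) `^ (- (b / 2))); first by rewrite /h; move: (Gamma b) (egf _ _) => *; ring.
  rewrite -(powR_inv1 (ltW s0)) -(powR12_sqrt (ltW u0)) -!powRrM.
  by congr (_ `^ _); field.
apply: cvg_trans; apply: near_eq_cvg; apply: nearW => n /=.
 rewrite /series/= big_distrr/=; apply: eq_bigr => j _.
rewrite /lagr -mulrA; congr (_ * _).
rewrite [RHS]mulrC -egfZ; last exact: geo_lagr_coef.
by apply: eq_egf => k; rewrite /h /B /lagr_coef; ring.
Qed.

End LagrangeCoefficients.

(** * Repeated differentiation of y^e times a power series in sqrt y *)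

Section DerivePowEgf.
Context {R : realType}.
Implicit Types (e y z : R).

(** The terms are multiples of y^(e + k/2), so the derivative multiplies the k-th coefficient by e +
    k/2 and lowers e by 1. The shape is preserved, which lets the rule be iterated. *)
Lemma is_derive_powR_egf e h y : geo h -> 0 < y ->
  is_derive y 1 (fun y => y `^ e * egf h (Num.sqrt y))
    (y `^ (e - 1) * egf (fun k => (e + k%:R / 2) * h k) (Num.sqrt y)).
Proof.
move=> gh y0.
have s0 : 0 < Num.sqrt y by rewrite sqrtr_gt0.
have d1 := is_derive1_powR e y0.
have ds := is_derive1_sqrt y0.
have de := is_derive_egf (Num.sqrt y) gh.
have dc := @is_derive1_comp _ (egf h) Num.sqrt y _ _ de ds.
have := @is_deriveM _ _ (fun u : R => u `^ e) (egf h \o Num.sqrt) y 1 _ _ d1 dc.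
move=> D; apply: (@eq_ind _ _ (fun u => is_derive y 1 _ u) D).
rewrite /GRing.scale/= {D}.
have -> : egf (fun k => (e + k%:R / 2) * h k) (Num.sqrt y) =
    e * egf h (Num.sqrt y) + 2^-1 * (Num.sqrt y * egf (fun k => h k.+1) (Num.sqrt y)).
  rewrite mul_egf; last exact: geoS.
  have g1 : geo (fun k => k%:R * h k.-1.+1).
    by apply: geoM; [exact: geo_nat|apply: (geo_pred (h := fun k => h k.+1)); exact: geoS].
  rewrite -egfZ// -egfZ// -egfD; [|exact: geoZ..].
  by apply: eq_egf => -[|k]/=; ring.
have -> : y `^ e = y `^ (e - 1) * y.
  by rewrite -[X in _ * X](powRr1 (ltW y0)) -gt0_powRD// subrK.
set E := egf _ _; set E1 := egf _ _.
set p := y `^ (e - 1); have ys := sqr_sqrtr (ltW y0); rewrite -[X in p * X]ys.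
by field; rewrite gt_eqF.
Qed.

Lemma derive1n_powR_egf (f : R -> R) e h i : geo h ->
  (forall y, 0 < y -> f y = y `^ e * egf h (Num.sqrt y)) ->
  let hi k := (\prod_(l < i) (e - l%:R + k%:R / 2)) * h k in
  forall y, 0 < y ->
    derive1n i f y = y `^ (e - i%:R) * egf hi (Num.sqrt y) /\
    derivable (derive1n i f) y 1.
Proof.
move=> gh fE.
pose hi j k := (\prod_(l < j) (e - l%:R + k%:R / 2)) * h k.
have ghi j : geo (hi j).
  apply: geoM => //; apply: (@geo_prod _ _ (fun l k => e - l%:R + k%:R / 2)) => l.
  apply: (geo_ext _ (geo_lin (e - l%:R) (1 / 2))) => k; by field.
have near (F F' : R -> R) y : 0 < y -> (forall y, 0 < y -> F y = F' y) -> \forall x \near y, F' x = F x.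
  move=> y0 FF'; near=> x; rewrite FF'//; near: x; exact: lt_nbhsr.
have main j y : 0 < y -> derive1n j f y = y `^ (e - j%:R) * egf (hi j) (Num.sqrt y).
  elim: j y => [|j IH] y y0.
    rewrite derive1n0 fE// subr0; congr (_ * _); apply: eq_egf => k.
    by rewrite /hi big_ord0 mul1r.
  rewrite derive1nS derive1E.
  have [D1 D2] := near_eq_is_derive (near _ _ y y0 IH) (is_derive_powR_egf (e - j%:R) (ghi j) y0).
  rewrite D2 -[j.+1%:R]natr1 opprD addrA; congr (_ * _); apply: eq_egf => k.
  by rewrite /hi big_ord_recr/=; ring.
move=> /= y y0; split; first exact: main.
by have [] := near_eq_is_derive (near _ _ y y0 (main i)) (is_derive_powR_egf (e - i%:R) (ghi i) y0).
Unshelve. all: by end_near. Qed.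

End DerivePowEgf.

Section PSeries.
Context {R : realType}.

(** Induction on a telescoping majorant of the partial sums: 1 / v^3 <= 2 / u - 2 / v when v^2 = u^2
    + 1 with u, v > 0. The term at j = 0 is 0 by the convention for powers of 0. *)
Lemma is_cvg_pseries32 : cvgn (series (fun j => (j%:R : R) `^ (- (3 / 2)))).
Proof.
have E j : (j.+1%:R : R) `^ (- (3 / 2)) = (j.+1%:R * Num.sqrt j.+1%:R)^-1.
  rewrite powRN (_ : 3 / 2 = 1 + 2^-1); last by field.
  by rewrite gt0_powRD// powRr1// powR12_sqrt.
apply: nondecreasing_is_cvgn.
  by apply/nondecreasing_seqP => n; rewrite seriesSr lerDl powR_ge0.
exists 4 => _ [n _ <-].
suff h : series (fun j => (j%:R : R) `^ (- (3 / 2))) n.+2 <= 3 - 2 / Num.sqrt n.+1%:R.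
  have : series (fun j => (j%:R : R) `^ (- (3 / 2))) n <= series (fun j => (j%:R : R) `^ (- (3 / 2))) n.+2.
    by rewrite !seriesSr -addrA lerDl addr_ge0// powR_ge0.
  have : 0 <= 2 / Num.sqrt (n.+1%:R : R) by rewrite divr_ge0// sqrtr_ge0.
  by move: h; lra.
elim: n => [|n IH].
  rewrite 2!seriesSr /series/= big_geq// powR0; last by rewrite oppr_eq0 gt_eqF.
  by rewrite powR1 sqrtr1; lra.
rewrite seriesSr; apply: (le_trans (lerD IH (lexx _))); rewrite E.
have u0 : 0 < Num.sqrt (n.+1%:R : R) by rewrite sqrtr_gt0.
have v0 : 0 < Num.sqrt (n.+2%:R : R) by rewrite sqrtr_gt0.
have u2 : Num.sqrt (n.+1%:R : R) ^+ 2 = n.+1%:R by rewrite sqr_sqrtr.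
have v2 : Num.sqrt (n.+2%:R : R) ^+ 2 = n.+2%:R by rewrite sqr_sqrtr.
have uv : Num.sqrt (n.+1%:R : R) <= Num.sqrt (n.+2%:R : R) by rewrite ler_sqrt ?ler_nat.
have : Num.sqrt (n.+2%:R : R) ^+ 2 = Num.sqrt (n.+1%:R : R) ^+ 2 + 1.
  by rewrite u2 v2 natr1.
rewrite (_ : n.+2%:R * Num.sqrt n.+2%:R = Num.sqrt n.+2%:R ^+ 2 * Num.sqrt n.+2%:R :> R); last by rewrite v2.
move: (Num.sqrt n.+1%:R) (Num.sqrt n.+2%:R) {u2 v2 IH} u0 v0 uv => u v u0 v0 uv d.
have -> : (v ^+ 2 * v)^-1 = (v ^+ 2 - u ^+ 2) / v ^+ 3.
  by rewrite (_ : v ^+ 2 - u ^+ 2 = 1) ?div1r -?exprSr//; lra.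
rewrite -subr_ge0 (_ : _ - _ = (v - u) * (2 * v ^+ 2 - u * (u + v)) / (u * v ^+ 3)); last first.
  by field; rewrite !gt_eqF.
apply: divr_ge0; last by rewrite mulr_ge0 ?exprn_ge0 ?ltW.
apply: mulr_ge0; first by rewrite subr_ge0.
by nra.
Qed.
End PSeries.

(** * Moments of a bounded positive random variable *)

Section Expectation.
Context {d : measure_display} {T : measurableType d} {R : realType}.
Variable P : probability T R.

Lemma bounded_integrable (f : T -> R) M : measurable_fun setT f ->
  (forall w, `|f w| <= M) ->
  P.-integrable setT (EFin \o f) /\ (\int[P]_w (`|f w|%R)%:E <= M%:E)%E.
Proof.
move=> mf fM.
have h : (\int[P]_w (`|f w|%R)%:E <= M%:E)%E.
  apply: (@le_trans _ _ (\int[P]_w M%:E)%E).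
    apply: ge0_le_integral => //.
    - by apply/measurable_EFinP; exact: measurableT_comp.
    - by move=> w _; rewrite lee_fin.
  by rewrite integral_cst//= probability_setT mule1.
split => //; apply/integrableP; split; first exact/measurable_EFinP.
by apply: le_lt_trans h _; rewrite ltry.
Qed.

Context (V : T -> R) (mV : measurable_fun setT V) (M : R).
Context (V0 : forall w, 0 < V w) (VM : forall w, V w <= M).
Context (b : R) (b0 : 0 < b).

Definition mom k : R := \int[P]_w (V w `^ (b + k%:R)).

Let M0 : 0 < M. Proof. exact: lt_le_trans (V0 point) (VM point). Qed.

Lemma measurable_Vpow c : measurable_fun setT (fun w => V w `^ c).
Proof. by apply: (measurableT_comp (@measurable_powR R c)). Qed.

Lemma Vpow_le c w : 0 <= c -> `|V w `^ c| <= M `^ c.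
Proof.
move=> c0; rewrite ger0_norm ?powR_ge0//.
by apply: ge0_ler_powR => //; rewrite nnegrE ltW.
Qed.

Lemma geo_mom : geo mom.
Proof.
exists (M `^ b), M => k.
have bk : 0 <= b + k%:R by rewrite addr_ge0// ltW.
have [I h] := bounded_integrable (measurable_Vpow (b + k%:R)) (fun w => Vpow_le w bk).
rewrite -(powR_mulrn _ (ltW M0)) -gt0_powRD//.
apply: (le_trans (le_normr_Rintegral measurableT I)).
rewrite -lee_fin /Rintegral fineK//.
exact: (integrable_fin_num measurableT (integrable_norm I)).
Qed.

(** The bound V <= M supplies summable majorants, so the power series integrates term by term and
    the powers of V become moments. *)
Lemma integral_V_egf h m r : geo h -> 0 <= r ->
  P.-integrable setT (EFin \o (fun w => V w `^ (b + m%:R) * egf h (r * V w))) /\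
  \int[P]_w (V w `^ (b + m%:R) * egf h (r * V w)) = egf (fun k => h k * mom (m + k)) r.
Proof.
move=> gh r0.
have bm : 0 < b + m%:R by rewrite ltr_pwDl.
pose f k w := V w `^ (b + m%:R) * (h k / k`!%:R * (r * V w) ^+ k).
have mf k : measurable_fun setT (f k).
  apply: measurable_funM; first exact: measurable_Vpow.
  apply: measurable_funM => //; apply: measurable_funX.
  by apply: measurable_funM.
have fx w : cvgn (series (fun k => `|f k w|)).
  rewrite (_ : (fun k => _) = (fun k => `|V w `^ (b + m%:R)| * `|h k / k`!%:R * (r * V w) ^+ k|)).
    by apply: is_cvg_seriesZ; exact: is_cvg_egf_norm.
  by apply/funext => k; rewrite /f normrM.
have := @integral_series _ T R P setT measurableT f
  (fun k => M `^ (b + m%:R) * `|h k / k`!%:R * (r * M) ^+ k|) mf.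
case=> //.
- by apply: is_cvg_seriesZ; exact: is_cvg_egf_norm.
- move=> k; apply: (@bounded_integrable (f k) _ (mf k) _).2 => w.
  rewrite /f normrM ler_pM//; first by apply: Vpow_le; exact: ltW.
  rewrite !normrM ler_wpM2l// !normrX lerXn2r ?nnegrE//.
  rewrite !ger0_norm ?mulr_ge0 ?(ltW (V0 _)) ?(ltW M0)//.
  by rewrite ler_wpM2l.
move=> Ii Is.
have E w : limn (series (f^~ w)) = V w `^ (b + m%:R) * egf h (r * V w).
  rewrite egfE -[RHS](lim_seriesZ (V w `^ (b + m%:R))); last exact: is_cvg_egf.
  by apply: eq_limn_series => k.
split; first by apply: eq_integrable Ii => // w _; rewrite /= E.
rewrite egfE -(eq_Rintegral _ (f := fun w => limn (series (f^~ w)))); last first.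
  by move=> w _; rewrite E.
apply/esym; move/cvg_series_lim : Is => <-; apply: eq_limn_series => k.
rewrite /f (@eq_Rintegral _ _ _ P setT (fun w => (h k / k`!%:R * r ^+ k) * V w `^ (b + (m + k)%:R))); last first.
  move=> w _; rewrite exprMn natrD addrA (gt0_powRD (b + m%:R))// (powR_mulrn _ (ltW (V0 w))); ring.
rewrite RintegralZl//; first by rewrite /mom; ring.
apply: (bounded_integrable _ (fun w => Vpow_le w _)).1; first exact: measurable_Vpow.
by rewrite addr_ge0// ltW.
Qed.

End Expectation.

(** The bounds by C / j and by negative powers of j say nothing at index 0, so one term must be left
    free. The sequence [geometric c 0] has c at index 0 and zeros elsewhere, as 0^0 = 1. *)
Lemma is_cvg_series_change0 {R : realType} (g : nat -> R) x :
  cvgn (series g) -> cvgn (series (fun k => if k == 0%N then x else g k)).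
Proof.
move=> gc; rewrite (_ : (fun k => _) = g + geometric (x - g 0%N) 0).
  by apply: is_cvg_seriesD => //; apply: is_cvg_geometric_series; rewrite normr0.
apply/funext => -[|k]; rewrite fctE/= /geometric/= ?expr0 ?exprS ?mul0r ?mulr0 ?addr0//.
by rewrite mulr1 addrC subrK.
Qed.

Lemma le_series_cvgS {R : realType} (a g : nat -> R) :
  (forall k, `|a k.+1| <= g k.+1) -> cvgn (series g) ->
  cvgn (series (fun k => `|a k|)).
Proof.
move=> ag gc; apply: (@le_series_cvg _ a (fun k => if k == 0%N then `|a 0%N| else g k)).
  by case.
exact: is_cvg_series_change0.
Qed.

Lemma prod_shift {R : comPzRingType} (y : R) j :
  (\prod_(i < j) (y + i.+1%:R)) * y = (\prod_(i < j) (y + i%:R)) * (y + j%:R).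
Proof.
elim: j => [|j IH]; first by rewrite !big_ord0 !mul1r addr0.
by rewrite !big_ord_recr/= mulrAC IH.
Qed.

(** * The expansions for a random variable with values in (0, sqrt n) *)

Section Expansion.
Context {d : measure_display} {T : measurableType d} {R : realType}.
Variable P : probability T R.
Context (n : nat) (hn : (2 <= n)%N) (V : T -> R) (mV : measurable_fun setT V).
Context (V0 : forall w, 0 < V w) (Vn : forall w, V w ^+ 2 < n%:R).
Context (b : R) (b0 : 0 < b).

Let n0 : 0 < n%:R :> R. Proof. by rewrite ltr0n (leq_trans _ hn). Qed.
Let VM w : V w <= Num.sqrt n%:R.
Proof. by rewrite -[leLHS]ger0_norm ?(ltW (V0 w))// -sqrtr_sqr ler_wsqrtr// ltW. Qed.

Notation mom := (mom P V b).
Notation Vcos w := (V w ^+ 2 / n%:R).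

Definition mean_gamma_cdf m r : R := \int[P]_w gamma_cdf (b + m%:R) (r * V w).

Definition expansion_term z j : R :=
  Gamma (b + (2 * j)%:R) / (Gamma b * j`!%:R * n%:R ^+ j)
  * derive1n j (fun y => mean_gamma_cdf (2 * j) (Num.sqrt y)) z.

Let geo_mom' : geo mom.
Proof. exact: (geo_mom P mV V0 VM b0). Qed.

Let geo_momD m : geo (fun k => mom (m + k)).
Proof.
elim: m => [|m IH]; first exact: geo_mom'.
by apply: (geo_ext _ (geoS IH)) => k; rewrite addnS.
Qed.

Lemma mean_gamma_cdf_egf m r : 0 <= r ->
  mean_gamma_cdf m r = r `^ (b + m%:R) *
    egf (fun k => (Gamma (b + m%:R))^-1 * ((-1) ^+ k / (b + m%:R + k%:R) * mom (m + k))) r.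
Proof.
move=> r0; have bm : 0 < b + m%:R by rewrite ltr_pwDl.
have gh := geo_sign_inv bm.
have [Ii IE] := integral_V_egf P mV V0 VM b0 m gh r0.
have gm : geo (fun k => (-1) ^+ k / (b + m%:R + k%:R) * mom (m + k)) by exact: geoM.
rewrite egfZ// -IE mulrA -RintegralZl//.
apply: eq_Rintegral => w _; rewrite /gamma_cdf -/(igamma _ _).
rewrite igamma_egf ?mulr_ge0 ?(ltW (V0 w))// powRM ?(ltW (V0 w))//.
by move: (Gamma _) (egf _ _) (V w `^ _) (r `^ _) => *; ring.
Qed.

Definition expansion_coef j r : R := egf (fun k => lagr_coef b j k * mom (2 * j + k)) r.

Let derive1n_mean_gamma_cdf j r i : 0 < r ->
  derivable (derive1n i (fun y => mean_gamma_cdf (2 * j) (Num.sqrt y))) (r ^+ 2) 1 /\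
  derive1n j (fun y => mean_gamma_cdf (2 * j) (Num.sqrt y)) (r ^+ 2) =
    r `^ b / Gamma (b + (2 * j)%:R) * j`!%:R * expansion_coef j r.
Proof.
move=> r0; have r20 : 0 < r ^+ 2 by rewrite exprn_gt0.
have bm : 0 < b + (2 * j)%:R by rewrite ltr_pwDl.
pose h k := (Gamma (b + (2 * j)%:R))^-1 * ((-1) ^+ k / (b + (2 * j)%:R + k%:R) * mom (2 * j + k)).
have gh : geo h by apply: geoZ; apply: geoM => //; exact: geo_sign_inv.
have fE y : 0 < y -> mean_gamma_cdf (2 * j) (Num.sqrt y) = y `^ ((b + (2 * j)%:R) / 2) * egf h (Num.sqrt y).
  move=> y0; rewrite mean_gamma_cdf_egf ?sqrtr_ge0//; congr (_ * _).
  by rewrite -(powR12_sqrt (ltW y0)) -powRrM mulrC.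
have [_ D] := derive1n_powR_egf i gh fE r20.
have [E _] := derive1n_powR_egf j gh fE r20.
split; [exact: D|rewrite {}E {D}].
rewrite sqrtr_sqr (gtr0_norm r0).
have -> : (r ^+ 2) `^ ((b + (2 * j)%:R) / 2 - j%:R) = r `^ b.
  rewrite -powR_mulrn ?(ltW r0)// -powRrM; congr (_ `^ _).
  by rewrite natrM; field.
have gA : geo (fun k => lagr_coef b j k * mom (2 * j + k)).
  by apply: geoM => //; exact: geo_lagr_coef.
rewrite /expansion_coef -!mulrA; congr (_ * _); rewrite mulrA -egfZ//.
apply: eq_egf => k; rewrite /h /lagr_coef gbinom_prod.
have bk : 0 < b + k%:R by rewrite ltr_pwDl.
have bjk : 0 < b + (2 * j)%:R + k%:R by rewrite ltr_pwDl.
have G0 := Gamma_gt0 bm; move: (Gamma _) (mom _) G0 => G mo G0.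
have fj : 0 < j`!%:R :> R by rewrite ltr0n fact_gt0.
(* Read backwards, the product from the j derivatives is the rising factorial of (b + k)/2 + 1.
   [prod_shift] makes it start at (b + k)/2 instead, at the price of the ratio (b + 2 j + k) / (b +
   k), whose numerator cancels the denominator in the series of [mean_gamma_cdf]. *)
have -> : \prod_(l < j) ((b + (2 * j)%:R) / 2 - l%:R + k%:R / 2) =
    (\prod_(i < j) ((b + k%:R) / 2 + i%:R)) * (b + (2 * j)%:R + k%:R) / (b + k%:R).
  apply/eqP; rewrite -subr_eq0; apply/eqP.
  rewrite (reindex_inj rev_ord_inj)/=.
  rewrite (eq_bigr (fun i : 'I_j => (b + k%:R) / 2 + i.+1%:R)); last first.
    by move=> l _; rewrite natrB// natrM -natr1; field.
  have := prod_shift ((b + k%:R) / 2) j; move: (\prod_(_ < j) _) (\prod_(_ < j) _) => p q pq.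
  rewrite (_ : q = q * ((b + k%:R) / 2) * 2 / (b + k%:R)); last by field; rewrite gt_eqF.
  by rewrite pq natrM; field; rewrite gt_eqF.
move: (\prod_(_ < j) _) (j`!%:R) fj => p f fj.
move: (b + (2 * j)%:R + k%:R) (b + k%:R) bk bjk => u v v0 u0.
by field; rewrite !gt_eqF.
Qed.

Lemma expansion_termE j r : 0 < r ->
  expansion_term (r ^+ 2) j = r `^ b / Gamma b * expansion_coef j r / n%:R ^+ j.
Proof.
move=> r0; have [_ E] := derive1n_mean_gamma_cdf j j r0.
have bm : 0 < b + (2 * j)%:R by rewrite ltr_pwDl.
rewrite /expansion_term E.
have := Gamma_gt0 bm; have := Gamma_gt0 b0.
move: (Gamma (b + (2 * j)%:R)) (Gamma b) (expansion_coef _ _) => G1 G2 c G10 G20.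
have fj : 0 < j`!%:R :> R by rewrite ltr0n fact_gt0.
have nj : 0 < n%:R ^+ j :> R by rewrite exprn_gt0.
by field; rewrite !gt_eqF.
Qed.

Lemma derivable_mean_gamma_cdf j i r : 0 < r ->
  derivable (derive1n i (fun y => mean_gamma_cdf (2 * j) (Num.sqrt y))) (r ^+ 2) 1.
Proof. by move=> r0; have [] := derive1n_mean_gamma_cdf j i r0. Qed.

(** Of the power V^(b + 2 j) behind the moments, V^b belongs to [lagr], and V^(2 j) / n^j is t^j. *)
Lemma expansion_term_integral j r : 0 < r ->
  P.-integrable setT (EFin \o (fun w => lagr b j (r * V w) * Vcos w ^+ j)) /\
  expansion_term (r ^+ 2) j = \int[P]_w (lagr b j (r * V w) * Vcos w ^+ j).
Proof.
move=> r0; have gA := geo_lagr_coef j b0.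
have [Ii IE] := integral_V_egf P mV V0 VM b0 (2 * j) gA (ltW r0).
have E w : lagr b j (r * V w) * Vcos w ^+ j =
    (r `^ b / Gamma b / n%:R ^+ j) * (V w `^ (b + (2 * j)%:R) * egf (lagr_coef b j) (r * V w)).
  rewrite /lagr powRM ?(ltW r0) ?(ltW (V0 w))// gt0_powRD// powR_mulrn ?(ltW (V0 w))//.
  rewrite exprM expr_div_n.
  by move: (Gamma b) (egf _ _) => *; ring.
split.
  have := integrableZl measurableT (r `^ b / Gamma b / n%:R ^+ j) Ii.
  by apply: eq_integrable => // w _; rewrite /= E.
rewrite expansion_termE// /expansion_coef -IE.
rewrite [RHS](@eq_Rintegral _ _ _ P setT (fun w => (r `^ b / Gamma b / n%:R ^+ j) *
   (V w `^ (b + (2 * j)%:R) * egf (lagr_coef b j) (r * V w)))); last by move=> w _; rewrite E.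
by rewrite RintegralZl// mulrAC.
Qed.

Context (C2 : R) (tail : forall j, (0 < j)%N ->
  \int[P]_w Vcos w ^+ j <= C2 * j%:R `^ (- ((n%:R - 1) / 2))).

Let Vcos_ge0 w : 0 <= Vcos w. Proof. by rewrite divr_ge0 ?sqr_ge0// ltW. Qed.

Let Vcos_lt1 w : Vcos w < 1. Proof. by rewrite ltr_pdivrMr// mul1r. Qed.

Let mVcos j : measurable_fun setT (fun w => Vcos w ^+ j).
Proof. by apply: measurable_funX; apply: measurable_funM => //; exact: measurable_funX. Qed.

Let iVcos j : P.-integrable setT (EFin \o (fun w => Vcos w ^+ j)).
Proof.
apply: (bounded_integrable (M := 1) P (mVcos j) _).1 => w.
by rewrite normrX (ger0_norm (Vcos_ge0 w)) exprn_ile1// ltW.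
Qed.

Let abs_term_le C j r : (forall j x, (0 < j)%N -> 0 < x -> `|lagr b j x| <= C / j%:R) ->
  (0 < j)%N -> 0 < r ->
  (\int[P]_w (`|lagr b j (r * V w) * Vcos w ^+ j|%R)%:E <=
    (C * C2 * j%:R `^ (- ((n%:R + 1) / 2)))%R%:E)%E.
Proof.
move=> hC j0 r0; have j0' : 0 < j%:R :> R by rewrite ltr0n.
have C0 : 0 <= C / j%:R by apply: le_trans (hC j 1 j0 ltr01).
have [/integrableP[mI _] _] := expansion_term_integral j r0.
apply: (@le_trans _ _ (\int[P]_w (C / j%:R * Vcos w ^+ j)%:E)%E).
  apply: ge0_le_integral => //.
  - by apply/measurable_EFinP; apply: measurableT_comp => //; exact/measurable_EFinP.
  - by apply/measurable_EFinP; apply: measurable_funM => //; exact: mVcos.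
  - move=> w _; rewrite lee_fin normrM (ger0_norm (exprn_ge0 _ (Vcos_ge0 w))).
    by rewrite ler_wpM2r ?exprn_ge0// hC// mulr_gt0.
under eq_integral do rewrite EFinM.
rewrite ge0_integralZl_EFin//; last 2 first.
- by move=> w _; rewrite lee_fin exprn_ge0.
- by apply/measurable_EFinP; exact: mVcos.
have -> : (\int[P]_w (Vcos w ^+ j)%:E)%E = (\int[P]_w Vcos w ^+ j)%:E.
  by rewrite /Rintegral fineK//; exact: (integrable_fin_num measurableT (iVcos j)).
rewrite -EFinM lee_fin.
apply: (le_trans (ler_wpM2l C0 (tail j0))).
rewrite (_ : - ((n%:R + 1) / 2) = - ((n%:R - 1) / 2) - 1); last by field.
rewrite gt0_powRD// powR_inv1 ?(ltW j0')//.
move: (_ `^ _) => p; rewrite [leLHS](_ : _ = C * C2 * (p / j%:R))//; by ring.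
Qed.

Lemma expansion_term_le C j r : (forall j x, (0 < j)%N -> 0 < x -> `|lagr b j x| <= C / j%:R) ->
  (0 < j)%N -> 0 < r ->
  `|expansion_term (r ^+ 2) j| <= C * C2 * j%:R `^ (- ((n%:R + 1) / 2)).
Proof.
move=> hC j0 r0; have [Ii ->] := expansion_term_integral j r0.
apply: (le_trans (le_normr_Rintegral measurableT Ii)).
rewrite -lee_fin /Rintegral fineK; first exact: abs_term_le.
exact: (integrable_fin_num measurableT (integrable_norm Ii)).
Qed.

(** The L1 norms of [lagr b j (r * V w) * Vcos w ^+ j] are summable because (n + 1)/2 >= 3/2, so sum
    and expectation commute; [lagr_series] sums the integrand. *)
Lemma cvg_expansion_term r : 0 < r ->
  cvgn (series (fun j => `|expansion_term (r ^+ 2) j|)) /\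
  series (expansion_term (r ^+ 2)) @ \oo -->
    \int[P]_w gamma_cdf b (r * V w / Num.sqrt (1 - Vcos w)).
Proof.
move=> r0; have [C hC] := lagr_bounded b0.
(* The bound C / j is void at j = 0, where the norm itself is taken. *)
pose c j : R := if j == 0%N then (\int[P]_w `|lagr b 0 (r * V w) * Vcos w ^+ 0|)
  else C * C2 * j%:R `^ (- ((n%:R + 1) / 2)).
have C0 : 0 <= C by have := hC 1%N 1 isT ltr01; rewrite divr1; apply: le_trans.
have C20 : 0 <= C2.
  have := tail (ltn0Sn 0); rewrite powR1 mulr1; apply: le_trans.
  by apply: Rintegral_ge0 => w _; rewrite exprn_ge0.
have n2 : 2 <= n%:R :> R by rewrite ler_nat.
have cc : cvgn (series c).
  apply: is_cvg_series_change0.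
  apply: (@le_series_cvgn _ _ (fun j => C * C2 * (j%:R : R) `^ (- (3 / 2)))); last first.
    by apply: is_cvg_seriesZ; exact: is_cvg_pseries32.
  move=> k; rewrite ger0_norm ?mulr_ge0 ?powR_ge0//.
  rewrite ler_wpM2l ?mulr_ge0//.
  case: k => [|k]; first by rewrite !powR0// oppr_eq0 gt_eqF//; lra.
  by apply: ler_powR; [rewrite ler1n | lra].
have [|||Ii Is] := @integral_series _ T R P setT measurableT
  (fun j w => lagr b j (r * V w) * Vcos w ^+ j) c _ cc.
- move=> j; have [/integrableP[mI _] _] := expansion_term_integral j r0.
  exact/measurable_EFinP.
- move=> j; rewrite /c; case: eqP => [->|/eqP j0].
    rewrite /Rintegral fineK//; have [Ij _] := expansion_term_integral 0 r0.
    exact: (integrable_fin_num measurableT (integrable_norm Ij)).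
  by apply: abs_term_le => //; rewrite lt0n.
(* Pointwise, t < 1 provides a geometric majorant; no uniformity in w is needed here. *)
- move=> w _; apply: (@le_series_cvgS _ _ (geometric C (Vcos w))); last first.
    by apply: is_cvg_geometric_series; rewrite ger0_norm.
  move=> k; rewrite /geometric/= normrM normrX (ger0_norm (Vcos_ge0 w)).
  rewrite ler_wpM2r ?exprn_ge0//; apply: (le_trans (hC _ _ _ _)) => //.
    by rewrite mulr_gt0.
  by rewrite ler_piMr// invf_le1// ler1n.
split.
  apply: (@le_series_cvgS _ _ c) cc => k; exact: expansion_term_le.
rewrite (_ : expansion_term _ = fun k => \int[P]_w (lagr b k (r * V w) * Vcos w ^+ k)); last first.
  by apply/funext => k; have [] := expansion_term_integral k r0.
rewrite (@eq_Rintegral _ _ _ P setT (fun w => limn (series (fun k => lagr b k (r * V w) * Vcos w ^+ k)))).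
  exact: Is.
move=> w _; apply/esym; apply/cvg_lim => //; apply: lagr_series => //.
  by rewrite Vcos_ge0 Vcos_lt1.
by rewrite mulr_gt0.
Qed.

End Expansion.

(** * Binomial transform and the inner sums of the second and third expansions *)

Section BinomialTransform.
Context {R : realType}.

Lemma sum_triangle {V : zmodType} (u : nat -> nat -> V) N :
  \sum_(0 <= k < N) \sum_(l < k.+1) u l (k - l)%N =
  \sum_(0 <= l < N) series (u l) (N - l)%N.
Proof.
elim: N => [|N IH]; first by rewrite !big_geq.
rewrite !big_nat_recr//= IH big_ord_recr/= subnn subSn// subnn seriesSr.
rewrite [series _ 0%N](_ : _ = 0) ?add0r; last by rewrite /series/= big_geq.
rewrite addrA; congr (_ + _).
rewrite -(big_mkord xpredT (fun l => u l (N - l)%N)) -big_split/=.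
apply: eq_big_nat => l /andP[_ lN].
by rewrite subSn ?(ltnW lN)// seriesSr.
Qed.

(** By [gbinom_Gamma] the k-th term contains igamma(b + k, x) / (k! Gamma(b)), and binom(k, l) / k!
    = 1 / (l! (k - l)!). With m = k - l, the sum over m of igamma(b + l + m, x) / m! is x^(b + l) /
    (b + l) by [igamma_series]. *)
Lemma binomial_transform_igamma (q : nat -> R) b x : geo q -> 0 < b -> 0 < x ->
  series (fun k => (\sum_(l < k.+1) (-1) ^+ l * 'C(k, l)%:R * q l)
    * gbinom (b + k%:R - 1) k * gamma_cdf (b + k%:R) x) @ \oo -->
  x `^ b / Gamma b * egf (fun l => (-1) ^+ l / (b + l%:R) * q l) x.
Proof.
move=> gq b0 x0; have G0 := Gamma_gt0 b0.
pose v l m := igamma (b + l%:R + m%:R) x / m`!%:R.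
pose dd l := (-1) ^+ l * q l / l`!%:R / Gamma b.
have bl l : 0 < b + l%:R by rewrite ltr_pwDl.
have v0 l m : 0 <= v l m by apply: divr_ge0; [exact: igamma_ge0|exact: ler0n].
have vs l : series (v l) @ \oo --> x `^ (b + l%:R) / (b + l%:R) by exact: igamma_series.
have nd l : nondecreasing_seq (series (v l)).
  by apply/nondecreasing_seqP => n; rewrite seriesSr lerDl.
have vle l n : `|series (v l) n| <= x `^ (b + l%:R) / (b + l%:R).
  rewrite ger0_norm; last by rewrite /series/= sumr_ge0.
  rewrite -(cvg_series_lim (vs l)); apply: nondecreasing_cvgn_le => //.
  by apply/cvg_ex; eexists; exact: vs.
have ge : geo (fun l => (-1) ^+ l / (b + l%:R) * q l).
  by apply: geoM => //; exact: (geo_sign_inv b0).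
have termE k : (\sum_(l < k.+1) (-1) ^+ l * 'C(k, l)%:R * q l)
    * gbinom (b + k%:R - 1) k * gamma_cdf (b + k%:R) x =
    \sum_(l < k.+1) dd l * v l (k - l)%N.
  rewrite -mulrA (_ : gbinom _ _ * _ = igamma (b + k%:R) x / k`!%:R / Gamma b); last first.
    have := gbinom_Gamma k b0; have := Gamma_gt0 (bl k).
    rewrite /gamma_cdf -/(igamma _ _); move: (Gamma (b + k%:R)) (igamma _ _) (gbinom _ _).
    move: (Gamma b) G0 => G G0 Gk i g Gk0 E.
    have k0 : 0 < k`!%:R :> R by rewrite ltr0n fact_gt0.
    have -> : g = Gk / k`!%:R / G by rewrite -E mulfK// gt_eqF.
    by move: (k`!%:R) k0 => f f0; field; rewrite !gt_eqF.
  rewrite mulr_suml; apply: eq_bigr => -[l/= lk] _; rewrite ltnS in lk.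
  rewrite /dd /v -addrA -natrD subnKC// -(bin_fact lk) !natrM.
  have a1 : 0 < 'C(k, l)%:R :> R by rewrite ltr0n bin_gt0.
  have a2 : 0 < l`!%:R :> R by rewrite ltr0n fact_gt0.
  have a3 : 0 < (k - l)`!%:R :> R by rewrite ltr0n fact_gt0.
  move: (Gamma b) (igamma _ _) (q l) G0 a1 a2 a3 => G i ql.
  move: ('C(k, l)%:R) (l`!%:R) ((k - l)`!%:R) => u1 u2 u3 *.
  by field; rewrite !gt_eqF.
have -> : x `^ b / Gamma b * egf (fun l => (-1) ^+ l / (b + l%:R) * q l) x =
    limn (series (fun l => dd l * (x `^ (b + l%:R) / (b + l%:R)))).
  rewrite egfE -[LHS]lim_seriesZ; last exact: is_cvg_egf.
  apply: eq_limn_series => l; rewrite gt0_powRD// powR_mulrn ?(ltW x0)// /dd fctE/= -[_ *: _]/(_ * _).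
  by move: (Gamma b)^-1 (b + l%:R)^-1 (l`!%:R^-1) => *; ring.
(* Up to [N] the triangle gives, for each l, the partial sum of length N - l over m. Truncated
   subtraction makes it empty for l >= N, so the finite sum over l is also a full series, the form
   that [tannery] expects. *)
rewrite (_ : series _ = fun N => limn (series (fun l => dd l * series (v l) (N - l)%N))).
  apply: (@tannery _ _ _ (fun l => `|dd l * (x `^ (b + l%:R) / (b + l%:R))|)).
  - move=> N k; rewrite !normrM ler_wpM2l// -normrM; exact: le_trans (vle _ _) (ler_norm _).
  - have := @is_cvg_egf_norm _ _ x (geoZ (x `^ b / Gamma b) ge).
    set f := (f in series f); set g := (g in _ -> cvgn (series g)).
    suff -> : f = g by [].
    apply/funext => l; congr `|_|.
    rewrite gt0_powRD// powR_mulrn ?(ltW x0)// /dd.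
    by move: (Gamma b)^-1 (b + l%:R)^-1 (l`!%:R^-1) => *; ring.
  - move=> k; apply: cvgMr; apply: cvg_comp (vs k).
    exact: cvg_subnr.
apply/funext => N; apply/esym.
have -> : series (fun k : nat => (\sum_(l < k.+1) (-1) ^+ l * 'C(k, l)%:R * q l)
    * gbinom (b + k%:R - 1) k * gamma_cdf (b + k%:R) x) N =
   \sum_(0 <= l < N) dd l * series (v l) (N - l)%N.
  rewrite /series/= (eq_bigr (fun k => \sum_(l < k.+1) dd l * v l (k - l)%N) (fun k _ => termE k)).
  rewrite (sum_triangle (fun l m => dd l * v l m)); apply: eq_bigr => l _.
  by rewrite /series/= mulr_sumr.
apply: lim_near_cst => //; near=> M.
have NM : (N <= M)%N by near: M; exact: nbhs_infty_ge.
rewrite {1}/series/= (big_cat_nat (leq0n N) NM)//= [X in _ + X]big1_seq ?addr0//.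
move=> l; rewrite mem_index_iota => /andP[_ /andP[Nl _]].
by rewrite (eqP (_ : N - l == 0)%N) ?subn_eq0// /series/= big_geq// mulr0.
Unshelve. all: by end_near. Qed.

End BinomialTransform.

Section InnerExpansions.
Context {d : measure_display} {T : measurableType d} {R : realType}.
Variable P : probability T R.
Context (n : nat) (hn : (2 <= n)%N) (V : T -> R) (mV : measurable_fun setT V).
Context (V0 : forall w, 0 < V w) (Vn : forall w, V w ^+ 2 < n%:R).
Context (b : R) (b0 : 0 < b).

Let VM w : V w <= Num.sqrt n%:R.
Proof. by rewrite -[leLHS]ger0_norm ?(ltW (V0 w))// -sqrtr_sqr ler_wsqrtr// ltW. Qed.

Let geo_momD m : geo (fun k => mom P V b (m + k)).
Proof.
elim: m => [|m IH]; first exact: (geo_mom P mV V0 VM b0).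
by apply: (geo_ext _ (geoS IH)) => k; rewrite addnS.
Qed.

Lemma expansion_coef_power_series j r :
  series (fun k => gbinom ((b + k%:R) / 2 + j%:R - 1) j
    * (mom P V b (2 * j + k) / (b + k%:R)) * ((- r) ^+ k / k`!%:R)) @ \oo -->
  expansion_coef P V b j r.
Proof.
have gA : geo (fun k => lagr_coef b j k * mom P V b (2 * j + k)).
  by apply: geoM => //; exact: geo_lagr_coef.
rewrite /expansion_coef egfE.
have := is_cvg_egf (y := r) gA.
rewrite (_ : (fun k => _ / _ * _) = (fun k => gbinom ((b + k%:R) / 2 + j%:R - 1) j
    * (mom P V b (2 * j + k) / (b + k%:R)) * ((- r) ^+ k / k`!%:R)))//.
apply/funext => k; rewrite /lagr_coef [(- r) ^+ k]exprNn.
by move: (gbinom _ _) (mom _ _ _ _) (b + k%:R)^-1 (k`!%:R^-1) => *; ring.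
Qed.

(** The factor lambda^-l goes into the transformed sequence and reduces the argument lambda r of the
    power series to r; the factors lambda^b cancel and lambda^(-2 j) remains. *)
Lemma expansion_coef_gamma_series j r lambda : 0 < r -> 0 < lambda ->
  series (fun k => (\sum_(l < k.+1) (-1) ^+ l * 'C(k, l)%:R
      * gbinom ((b + l%:R) / 2 + j%:R - 1) j
      * (mom P V b (2 * j + l) / lambda `^ (b + (2 * j)%:R + l%:R)))
    * gbinom (b + k%:R - 1) k * gamma_cdf (b + k%:R) (lambda * r)) @ \oo -->
  r `^ b / Gamma b * expansion_coef P V b j r / lambda ^+ (2 * j).
Proof.
move=> r0 l0.
pose q0 l := gbinom ((b + l%:R) / 2 + j%:R - 1) j * mom P V b (2 * j + l).
pose q l := q0 l * lambda^-1 ^+ l / lambda `^ (b + (2 * j)%:R).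
have gq0 : geo q0 by apply: geoM => //; exact: geo_gbinom.
have gq : geo q.
  apply: (geo_ext _ (geoZ (lambda `^ (b + (2 * j)%:R))^-1 (geoM gq0 (geo_exp lambda^-1)))).
  by move=> k; rewrite mulrC.
have := binomial_transform_igamma gq b0 (mulr_gt0 l0 r0).
have -> : (lambda * r) `^ b / Gamma b * egf (fun l => (-1) ^+ l / (b + l%:R) * q l) (lambda * r)
    = r `^ b / Gamma b * expansion_coef P V b j r / lambda ^+ (2 * j).
  rewrite -egf_scale /expansion_coef powRM ?(ltW r0) ?(ltW l0)//.
  have -> : (fun k => (-1) ^+ k / (b + k%:R) * q k * lambda ^+ k) =
     (fun k => (lambda `^ (b + (2 * j)%:R))^-1 * (lagr_coef b j k * mom P V b (2 * j + k))).
    apply/funext => k; rewrite /q /q0 /lagr_coef.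
    have lk : 0 < lambda ^+ k by rewrite exprn_gt0.
    have bk : 0 < b + k%:R by rewrite ltr_pwDl.
    rewrite exprVn; move: (lambda ^+ k) lk (b + k%:R)^-1 (gbinom _ _) (mom _ _ _ _).
    move: (lambda `^ _)^-1 => ? u u0 *.
    by field; rewrite gt_eqF.
  rewrite egfZ; last by apply: geoM => //; exact: geo_lagr_coef.
  rewrite gt0_powRD// powR_mulrn ?(ltW l0)//.
  have := powR_gt0 b l0; have := exprn_gt0 (2 * j) l0.
  move: (lambda ^+ _) (lambda `^ b) (Gamma b)^-1 (egf _ _) (r `^ b) => u v w x y u0 v0.
  by field; rewrite !gt_eqF.
set f := (f in series f @ _ --> _); set g := (g in _ -> series g @ _ --> _).
suff -> : f = g by [].
apply/funext => k; congr (_ * _ * _); apply: eq_bigr => -[l/= _] _.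
rewrite /q /q0 (gt0_powRD (b + (2 * j)%:R))// powR_mulrn ?(ltW l0)// exprVn invfM.
by move: (lambda `^ _)^-1 (lambda ^+ l)^-1 (gbinom _ _) (mom _ _ _ _) => *; ring.
Qed.

End InnerExpansions.

(** * Scaling of gamma vectors and the law of the sample variance *)

Section Weights.
Context {d1 d2} {T1 : measurableType d1} {T2 : measurableType d2} {R : realType}.
Variables (mu : {measure set T1 -> \bar R}) (nu : {measure set T2 -> \bar R}).
Import HBNNSimple.
Local Open Scope ereal_scope.

(** The hypothesis on indicators says that the image under [Z] of the measure with density [w] is
    [c] times [nu]. Approximation by simple functions extends it to integrals of nonnegative
    functions. *)
Lemma ge0_integral_weight (w : T1 -> R) (Z : T1 -> T2) (c : R) (f : T2 -> R) :
  measurable_fun setT w -> (forall x, 0 <= w x)%R -> measurable_fun setT Z ->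
  (0 <= c)%R ->
  (forall B, measurable B -> \int[mu]_x (w x * \1_B (Z x))%:E = c%:E * nu B) ->
  measurable_fun setT f -> (forall y, 0 <= f y)%R ->
  \int[mu]_x (w x * f (Z x))%:E = c%:E * \int[nu]_y (f y)%:E.
Proof.
move=> mw w0 mZ c0 wB mf f0.
have mf' : measurable_fun setT (EFin \o f) by exact/measurable_EFinP.
pose h := nnsfun_approx measurableT mf'.
have hf y : EFin (h n y) @[n --> \oo] --> (f y)%:E.
  by apply: (cvg_nnsfun_approx measurableT mf' _ (x := y)) => // x _; rewrite lee_fin.
have ndh y : {homo (fun n => h n y) : a b / (a <= b)%N >-> (a <= b)%R}.
  by move=> a b ab; exact/lefP/nd_nnsfun_approx.
have hcvg : \int[nu]_y (h n y)%:E @[n --> \oo] --> \int[nu]_y (f y)%:E.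
  have -> : \int[nu]_y (f y)%:E = \int[nu]_y limn (fun n => (h n y)%:E).
    by apply: eq_integral => y _; apply/esym/cvg_lim => //; exact: hf.
  apply: cvg_monotone_convergence => //.
  - by move=> n; exact/measurable_EFinP.
  - by move=> n y _; rewrite lee_fin.
  - by move=> y _ a b ab; rewrite lee_fin ndh.
have hcvg' : \int[mu]_x (w x * h n (Z x))%:E @[n --> \oo] --> \int[mu]_x (w x * f (Z x))%:E.
  have -> : \int[mu]_x (w x * f (Z x))%:E = \int[mu]_x limn (fun n => (w x * h n (Z x))%:E).
    apply: eq_integral => x _; apply/esym/cvg_lim => //.
    under eq_fun do rewrite EFinM. rewrite EFinM.
    by apply: cvgeZl => //; exact: hf.
  apply: cvg_monotone_convergence => //.
  - move=> n; apply/measurable_EFinP; apply: measurable_funM => //.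
    exact: measurableT_comp.
  - by move=> n x _; rewrite lee_fin mulr_ge0.
  - by move=> x _ a b ab; rewrite lee_fin ler_wpM2l// ndh.
suff E n : \int[mu]_x (w x * h n (Z x))%:E = c%:E * \int[nu]_y (h n y)%:E.
  move/cvg_lim : hcvg' => <- //; apply/cvg_lim => //.
  under eq_fun do rewrite E.
  by apply: cvgeZl.
have hE y : h n y = (\sum_(k \in range (h n)) k * \1_(h n @^-1` [set k]) y)%R.
  exact: fimfunE.
have mset k : measurable (h n @^-1` [set k]) by [].
have ge0 k x : (0 <= k * (w x * \1_(h n @^-1` [set k]) (Z x)))%R.
  rewrite mulrCA mulr_ge0//.
  by have := nnfun_muleindic_ge0 (h n) k (Z x); rewrite -EFinM lee_fin.
have mk k : measurable_fun setT (fun x => w x * \1_(h n @^-1` [set k]) (Z x))%R.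
  apply: measurable_funM => //.
  by apply: (measurableT_comp _ mZ) => //; exact: measurable_indic.
transitivity (\sum_(k \in range (h n)) \int[mu]_x (k * (w x * \1_(h n @^-1` [set k]) (Z x)))%:E).
  rewrite -ge0_integral_fsum//.
  - apply: eq_integral => x _; rewrite hE fsumEFin//; congr EFin.
    by rewrite mulr_fsumr//; apply: eq_fsbigr => k _; rewrite mulrCA.
  - move=> k; apply/measurable_EFinP; exact: measurable_funM.
  - by move=> k x _; rewrite lee_fin.
rewrite integralT_nnsfun sintegralE ge0_mule_fsumr; last first.
  by move=> k; exact: nnsfun_mulemu_ge0.
apply: eq_fsbigr => k; rewrite inE => -[t _ kE].
under eq_integral do rewrite EFinM.
rewrite ge0_integralZl_EFin//.
- by rewrite wB// muleCA.
- by move=> x _; rewrite lee_fin mulr_ge0.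
- exact/measurable_EFinP.
- by rewrite -kE.
Qed.
End Weights.

Section Independence.
Context {d : measure_display} {T : measurableType d} {R : realType}.
Variables (P : probability T R) (n : nat) (X : 'I_n -> {RV P >-> R}).
Hypothesis indep : mutually_independent X.
Local Open Scope ereal_scope.

Let prodEFin (I : finType) (p : pred I) (g : I -> R) :
  \prod_(i | p i) (g i)%:E = (\prod_(i | p i) g i)%:E.
Proof. by elim/big_rec2 : _ => // i x y _ ->; rewrite EFinM. Qed.

Lemma expectation_prod_indep (f : 'I_n -> R -> R) :
  (forall i, measurable_fun setT (f i)) -> (forall i y, (0 <= f i y)%R) ->
  (forall i, \int[P]_w (f i (X i w))%:E < +oo) ->
  \int[P]_w (\prod_i f i (X i w))%:E = \prod_i \int[P]_w (f i (X i w))%:E.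
Proof.
have mfX (g : R -> R) i : measurable_fun setT g -> measurable_fun setT (fun w => g (X i w)).
  by move=> mg; apply: (measurableT_comp mg).
have intB i B : measurable B -> \int[P]_w (\1_B (X i w))%:E = P (X i @^-1` B).
  move=> mB; rewrite -[X in P X]setIT -integral_indic//.
  rewrite -[X in measurable X]setTI; exact: measurable_funPT.
(* Indicators are replaced by general functions one coordinate at a time. *)
suff main k : forall f : 'I_n -> R -> R, (forall i, measurable_fun setT (f i)) ->
    (forall i y, (0 <= f i y)%R) -> (forall i, \int[P]_w (f i (X i w))%:E < +oo) ->
    (forall i : 'I_n, (k <= i)%N -> exists2 B, measurable B & f i = \1_B) ->
    \int[P]_w (\prod_i f i (X i w))%:E = \prod_i \int[P]_w (f i (X i w))%:E.
  move=> mf f0 foo; apply: (main n) => // i ni.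
  by have := ltn_ord i; rewrite ltnNge ni.
elim: k => [|k IH] {}f mf f0 foo fB.
  have {}fB i : exists2 B, measurable B & f i = \1_B by exact: fB.
  have [B mB fE] : exists2 B : 'I_n -> set R, (forall i, measurable (B i)) & forall i, f i = \1_(B i).
    exists (fun i => sval (cid2 (fB i))) => i; by case: (cid2 (fB i)).
  transitivity (P (\bigcap_(i in [set` [set: 'I_n]%SET]) (X i @^-1` B i))).
    rewrite -[X in P X]setIT -integral_indic//; last first.
      apply: fin_bigcap_measurable => [|i _]; first exact: finite_finset.
      rewrite -[X in measurable X]setTI; exact: measurable_funPT.
    apply: eq_integral => w _; congr EFin.
    rewrite indicE; have [h|h] := boolP (w \in _).
      rewrite big1// => i _; rewrite fE indicE mem_set//.
      by move: h; rewrite inE => /(_ i) h; apply: h; rewrite /= inE.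
    apply/eqP; rewrite prodf_seq_eq0; apply/hasP.
    apply: contraNP h => h; rewrite inE => i _.
    apply: contrapT => hi; apply: h; exists i; rewrite ?mem_index_enum//=.
    by rewrite fE indicE memNset.
  rewrite indep//; under eq_bigl do rewrite inE.
  by apply: eq_bigr => i _; rewrite fE intB.
case: (ltnP k n) => kn; last first.
  apply: IH => // i ki; apply: fB.
  by have := leq_ltn_trans (leq_trans kn ki) (ltn_ord i); rewrite ltnn.
pose i0 := Ordinal kn.
pose w x := (\prod_(i | i != i0) f i (X i x))%R.
have fin i : \int[P]_w (f i (X i w))%:E \is a fin_num.
  by rewrite ge0_fin_numE//; apply: integral_ge0 => x _; rewrite lee_fin.
pose c := (\prod_(i | i != i0) fine (\int[P]_w (f i (X i w))%:E))%R.
have cE : c%:E = \prod_(i | i != i0) \int[P]_w (f i (X i w))%:E.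
  by rewrite -prodEFin; apply: eq_bigr => i _; rewrite fineK.
rewrite [RHS](bigD1 i0)//= -cE muleC.
under eq_integral => x _ do rewrite (bigD1 i0)//= mulrC.
have -> : \int[P]_w (f i0 (X i0 w))%:E = \int[distribution P (X i0)]_y (f i0 y)%:E.
  rewrite ge0_integral_distribution//; first exact/measurable_EFinP.
  by move=> y; rewrite lee_fin.
apply: (@ge0_integral_weight _ _ _ _ _ P (distribution P (X i0)) w (X i0)) => //.
- rewrite /w; under eq_fun do rewrite -big_filter.
  by apply: measurable_prod => i _; exact: mfX.
- by move=> x; apply: prodr_ge0.
- by apply: prodr_ge0 => i _; apply: fine_ge0; apply: integral_ge0 => x _; rewrite lee_fin.
move=> B mB.
(* The weight of the event that X_(i0) lies in B is the same expectation with an indicator in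
   coordinate k, so the induction hypothesis computes it. *)
pose f' i : R -> R := if i == i0 then \1_B else f i.
transitivity (\int[P]_x (\prod_i f' i (X i x))%:E).
  apply: eq_integral => x _; rewrite (bigD1 i0)//= mulrC /f' eqxx; congr (_ * _)%:E.
  by apply: eq_bigr => i /negbTE ->.
rewrite IH /f'; first 1 last.
- by move=> i; case: ifP => // _; exact: measurable_indic.
- by move=> i y; case: ifP.
- move=> i; case: ifP => // _; rewrite intB// (le_lt_trans (probability_le1 _ _)) ?ltry//.
  rewrite -[X in measurable X]setTI; exact: measurable_funPT.
- move=> i ki; case: eqVneq => [_|ii0]; first by exists B.
  by apply: fB; rewrite ltn_neqAle ki andbT; apply: contra ii0 => /eqP kE; apply/eqP/val_inj.
rewrite (bigD1 i0)//= eqxx intB// muleC cE; congr (_ * _).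
by apply: eq_bigr => i /negbTE ->.
Qed.
End Independence.

Section DensityMeasure.
Context {d : measure_display} {T : measurableType d} {R : realType}.
Variables (mu : {measure set T -> \bar R}) (g : T -> R).
Hypotheses (mg : measurable_fun setT g) (g0 : forall x, 0 <= g x).
Local Open Scope ereal_scope.

(** The two proofs are arguments so that the measure structure can be attached to the term
    [density_measure mg g0]. *)
Definition density_measure of measurable_fun setT g & (forall x, 0 <= g x)%R :=
  fun A : set T => \int[mu]_(x in A) (g x)%:E.
Let m := density_measure mg g0.

Let m0 : m set0 = 0. Proof. exact: integral_set0. Qed.

Let m_ge0 A : 0 <= m A.
Proof. by apply: integral_ge0 => x _; rewrite lee_fin. Qed.

Let m_sigma_additive : semi_sigma_additive m.
Proof.
move=> F mF tF mUF; rewrite /m /density_measure; apply: cvg_toP.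
  apply: ereal_nondecreasing_is_cvgn => a b ab.
  by apply: lee_sum_nneg_natr => // k _ _; exact: m_ge0.
rewrite ge0_integral_bigcup//=; last by move=> x _; rewrite lee_fin.
by apply: measurable_funTS; exact/measurable_EFinP.
Qed.

HB.instance Definition _ := isMeasure.Build _ _ _ m m0 m_ge0 m_sigma_additive.

Lemma density_measureE A : measurable A -> m A = \int[mu]_x (g x * \1_A x)%:E.
Proof.
move=> mA; rewrite /m /density_measure integral_mkcond; apply: eq_integral => x _.
by rewrite patchE indicE; case: ifPn => _; rewrite ?mulr1 ?mulr0.
Qed.

End DensityMeasure.

Section GammaScaling.
Context {d : measure_display} {T : measurableType d} {R : realType}.
Variable P : probability T R.
Local Open Scope ereal_scope.
Implicit Types (Y : {RV P >-> R}) (g : R -> R).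

Lemma integral_has_density Y f g : has_density Y f ->
  measurable_fun setT f -> (forall x, 0 <= f x)%R ->
  measurable_fun setT g -> (forall x, 0 <= g x)%R ->
  \int[P]_w (g (Y w))%:E = \int[lebesgue_measure]_x (f x * g x)%:E.
Proof.
move=> Yf mf f0 mg g0.
rewrite (@ge0_integral_weight _ _ _ _ _ lebesgue_measure (distribution P Y) f id 1)//.
- rewrite mul1e ge0_integral_distribution//; exact/measurable_EFinP.
- move=> B mB; rewrite mul1e [RHS](Yf B mB) [RHS]integral_mkcond; apply: eq_integral => x _.
  by rewrite patchE indicE; case: ifPn => _; rewrite ?mulr1 ?mulr0.
Qed.

Lemma gamma_pdf_ge0 (a x : R) : (0 < a -> 0 <= gamma_pdf a x)%R.
Proof.
move=> a0; rewrite /gamma_pdf; case: ifP => // x0.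
by rewrite !mulr_ge0 ?invr_ge0 ?(ltW (Gamma_gt0 a0)) ?powR_ge0// expR_ge0.
Qed.

Lemma gamma_pdfE (a x : R) : gamma_pdf a x =
  ((Gamma a)^-1 * (x `^ (a - 1) * expR (- x)) * \1_(`]0, +oo[%classic : set R) x)%R.
Proof.
rewrite /gamma_pdf indicE; case: ifPn => x0.
  by rewrite mem_set ?mulr1 -1?mulrA 1?[(expR _ * _)%R]mulrC//= in_itv/= x0.
by rewrite memNset ?mulr0//= in_itv/= andbT; exact/negP.
Qed.

Lemma measurable_gamma_pdf (a : R) : measurable_fun setT (gamma_pdf a).
Proof.
rewrite (funext (gamma_pdfE a)).
apply: measurable_funM; last exact: measurable_indic.
by apply: measurable_funM => //; exact: measurable_powRexp.
Qed.

Lemma integral_gamma (a : R) Y g : (0 < a)%R -> has_density Y (gamma_pdf a) ->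
  measurable_fun setT g -> (forall x, 0 <= g x)%R ->
  \int[P]_w (g (Y w))%:E =
  \int[lebesgue_measure]_(x in `]0%R, +oo[) ((Gamma a)^-1 * (x `^ (a - 1) * expR (- x)) * g x)%:E.
Proof.
move=> a0 Yf mg g0; rewrite (integral_has_density Yf)//; last 2 first.
- exact: measurable_gamma_pdf.
- by move=> x; exact: gamma_pdf_ge0.
rewrite [RHS]integral_mkcond; apply: eq_integral => x _.
rewrite patchE gamma_pdfE indicE; case: ifPn => _; first by rewrite mulr1.
by rewrite mulr0 mul0r.
Qed.

Lemma integral_gamma_scale (a u : R) Y g : (0 < a)%R -> (0 < u)%R ->
  has_density Y (gamma_pdf a) ->
  measurable_fun setT g -> (forall x, 0 <= g x)%R ->
  \int[P]_w (g (u * Y w))%:E =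
  \int[P]_w (u `^ (- a) * (g (Y w) * expR ((1 - u^-1) * Y w)))%:E.
Proof.
move=> a0 u0 Yf mg g0.
have mu : measurable_fun setT (fun x : R => u * x)%R by exact: mulrl_measurable.
rewrite (@integral_gamma a Y (fun x => g (u * x)%R))//; last first.
  exact: (measurableT_comp mg).
have mge : measurable_fun setT (fun x => u `^ (- a) * (g x * expR ((1 - u^-1) * x)))%R.
  apply: measurable_funM => //; apply: measurable_funM => //.
  by apply: measurableT_comp => //; exact: mulrl_measurable.
have ge0 x : (0 <= u `^ (- a) * (g x * expR ((1 - u^-1) * x)))%R.
  by rewrite mulr_ge0 ?powR_ge0// mulr_ge0// expR_ge0.
rewrite (@integral_gamma a Y (fun x => u `^ (- a) * (g x * expR ((1 - u^-1) * x)))%R)//.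
rewrite [RHS](@ge0_integral_scale _ u)//; last 2 first.
- apply/measurable_EFinP; apply: measurable_funM => //; apply: measurable_funM => //.
  exact: measurable_powRexp.
- move=> x; rewrite lee_fin mulr_ge0// mulr_ge0 ?invr_ge0 ?(ltW (Gamma_gt0 a0))//.
  by rewrite mulr_ge0 ?powR_ge0 ?expR_ge0.
rewrite -ge0_integralZl_EFin//; last 3 first.
- move=> x _; rewrite lee_fin mulr_ge0// mulr_ge0 ?invr_ge0 ?(ltW (Gamma_gt0 a0))//.
  by rewrite mulr_ge0 ?powR_ge0 ?expR_ge0.
- apply: measurable_funTS.
  apply/measurable_EFinP; apply: measurable_funM; last exact: (measurableT_comp mge mu).
  by apply: measurable_funM => //; apply: (measurableT_comp (measurable_powRexp _) mu).
- exact: ltW.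
apply: eq_integral => x; rewrite inE/= in_itv/= andbT => x0.
rewrite -EFinM; congr EFin; rewrite powRM ?(ltW u0) ?(ltW x0)//.
rewrite (_ : (1 - u^-1) * (u * x) = u * x - x)%R; last by field; rewrite gt_eqF.
rewrite expRD [expR (- (u * x))]expRN.
have -> : (u `^ (a - 1) = u `^ a / u)%R.
  by rewrite gt0_powRD// powR_inv1// ltW.
rewrite powRN.
have := expR_gt0 (u * x)%R; have := powR_gt0 a u0.
move: (Gamma a)^-1%R (expR (u * x))%R (u `^ a)%R (x `^ _)%R (g _) (expR _) => *.
by field; rewrite !gt_eqF.
Qed.

End GammaScaling.

Lemma prod_indicE {R : realType} n (B : 'I_n -> set R) (y : 'I_n -> R) :
  \prod_i \1_(B i) (y i) = `[< forall i, B i (y i) >]%:R :> R.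
Proof.
have [h|h] := asboolP.
  by rewrite big1// => i _; rewrite indicE mem_set.
have [i hi] : exists i, ~ B i (y i) by apply/existsNP.
by rewrite (bigD1 i)//= indicE memNset// mul0r.
Qed.

Section VectorScaling.
Context {d : measure_display} {T : measurableType d} {R : realType}.
Variables (P : probability T R) (n : nat) (X : 'I_n -> {RV P >-> R}) (a : R).
Hypotheses (indep : mutually_independent X) (a0 : 0 < a).
Hypothesis (Xa : forall i, has_density (X i) (gamma_pdf a)).
Local Open Scope ereal_scope.

Definition vec w : n.-tuple (measurableTypeR R) := [tuple X i w | i < n].

Lemma measurable_vec : measurable_fun setT vec.
Proof.
have mX i : measurable_fun setT (X i) by exact: measurable_funPT.
apply/measurable_fun_tnthP => i; rewrite (_ : _ \o _ = X i); first exact: mX.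
by apply/funext => w /=; rewrite tnth_mktuple.
Qed.

Definition rectangles : set (set (n.-tuple (measurableTypeR R))) :=
  [set A | exists2 B : 'I_n -> set R, (forall i, measurable (B i)) &
    A = [set t | forall i, B i (tnth t i)]].

Lemma setI_closed_rectangles : setI_closed rectangles.
Proof.
move=> _ _ [B mB ->] [B' mB' ->]; exists (fun i => B i `&` B' i).
  by move=> i; exact: measurableI.
apply/seteqP; split=> t /=; first by move=> [h h'] i.
by move=> h; split=> i; have [] := h i.
Qed.

Lemma measurable_rectangles : measurable = <<s rectangles >>.
Proof.
apply/seteqP; split.
  apply: smallest_sub; first exact: smallest_sigma_algebra.
  move=> A; rewrite -bigcup_seq/= => -[i _ [B mB <-]].
  apply: sub_sigma_algebra; exists (fun j => if j == i then B else setT).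
    by move=> j; case: ifP.
  apply/seteqP; split=> t /=.
    by move=> [_ Bt] j; case: eqVneq => // ->.
  by move=> /(_ i); rewrite eqxx.
apply: smallest_sub; first exact: sigma_algebra_measurable.
move=> A [B mB ->].
rewrite (_ : [set _ | _] = \bigcap_(i in [set: 'I_n]) (fun t : n.-tuple (measurableTypeR R) => tnth t i) @^-1` B i).
  apply: fin_bigcap_measurable => [|i _]; first exact: finite_finset.
  rewrite -[X in measurable X]setTI.
  have mt : measurable_fun setT (fun t : n.-tuple (measurableTypeR R) => tnth t i).
    exact: measurable_tnth.
  exact: (mt measurableT (B i) (mB i)).
by apply/seteqP; split=> t /= h i; [move=> _; exact: h|exact: (h i I)].
Qed.

(** The law of u X and the weighted law of X are measures on tuples. Independence and the scaling of
    a single gamma variable make them agree on rectangles, a generating family closed under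
    intersection. *)
Lemma expectation_vec_scale (u : R) (F : n.-tuple (measurableTypeR R) -> R) : (0 < u)%R ->
  measurable_fun setT F -> (forall t, 0 <= F t)%R ->
  \int[P]_w (F (map_tuple ( *%R u) (vec w)))%:E =
  \int[P]_w (u `^ (- (a * n%:R)) * expR ((1 - u^-1) * \sum_(i < n) X i w) * F (vec w))%:E.
Proof.
move=> u0 mF F0.
pose g w := (u `^ (- (a * n%:R)) * expR ((1 - u^-1) * \sum_(i < n) X i w))%R.
have mX i : measurable_fun setT (X i) by exact: measurable_funPT.
have mg : measurable_fun setT g.
  apply: measurable_funM => //; apply: measurableT_comp => //.
  by apply: measurable_funM => //; exact: measurable_sum.
have g0 w : (0 <= g w)%R by rewrite mulr_ge0 ?powR_ge0 ?expR_ge0.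
have mu' : measurable_fun setT (fun x : R => u * x)%R by exact: mulrl_measurable.
pose Z w : n.-tuple (measurableTypeR R) := map_tuple ( *%R u) (vec w).
have mZ : measurable_fun setT Z.
  have muX i : measurable_fun setT (fun w => u * X i w)%R by exact: measurable_funM.
  apply/measurable_fun_tnthP => i; rewrite (_ : _ \o _ = fun w => u * X i w)%R; first exact: muX.
  by apply/funext => w /=; rewrite tnth_map tnth_mktuple.
pose m1_0 : {measure set (n.-tuple (measurableTypeR R)) -> \bar R} := pushforward P Z.
pose m1 := m1_0 mZ.
pose m2_0 : {measure set (n.-tuple (measurableTypeR R)) -> \bar R} :=
  pushforward (density_measure P mg g0) vec.
pose m2 := m2_0 measurable_vec.
have m12 A : measurable A -> m1 A = m2 A.
  apply: (measure_unique rectangles (fun=> setT)).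
  - exact: measurable_rectangles.
  - exact: setI_closed_rectangles.
  - move=> _; exists (fun=> setT) => //; apply/seteqP; split => //.
  - by rewrite bigcup_const.
  - move=> {}A [B mB ->].
    pose f i (y : R) : R := \1_(B i) (u * y)%R.
    pose h i (y : R) : R := (u `^ (- a) * (\1_(B i) y * expR ((1 - u^-1) * y)))%R.
    have mf i : measurable_fun setT (f i).
      by apply: (measurableT_comp _ mu') => //; exact: measurable_indic.
    have f0 i y : (0 <= f i y)%R by [].
    have mh i : measurable_fun setT (h i).
      apply: measurable_funM => //; apply: measurable_funM; first exact: measurable_indic.
      by apply: measurableT_comp => //; exact: mulrl_measurable.
    have h0 i y : (0 <= h i y)%R.
      by rewrite mulr_ge0 ?powR_ge0// mulr_ge0// expR_ge0.
    have fh i : \int[P]_w (f i (X i w))%:E = \int[P]_w (h i (X i w))%:E.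
      by apply: (integral_gamma_scale (g := \1_(B i)) a0 u0 (Xa i)).
    have foo i : \int[P]_w (f i (X i w))%:E < +oo.
      have mfX : measurable_fun setT (fun w => f i (X i w)) by exact: (measurableT_comp (mf i)).
      have f1 w : (`|f i (X i w)| <= 1)%R by rewrite ger0_norm// /f indicE; case: (_ \in _).
      have [_ hf] := bounded_integrable P mfX f1.
      apply: (@le_lt_trans _ _ 1%:E); last exact: ltry.
      by apply: le_trans hf; under eq_integral do rewrite -[X in X%:E]ger0_norm//.
    have mA : measurable [set t : n.-tuple (measurableTypeR R) | forall i, B i (tnth t i)].
      by rewrite measurable_rectangles; apply: sub_sigma_algebra; exists B.
    transitivity (\int[P]_w (\prod_i f i (X i w))%:E).
      rewrite /m1/= /pushforward -[X in P X]setIT -integral_indic//.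
        apply: eq_integral => w _; congr EFin; rewrite prod_indicE indicE.
        congr (_ : bool)%:R; apply/idP/asboolP; rewrite inE/=.
          by move=> h' i; have := h' i; rewrite tnth_map tnth_mktuple.
        by move=> h' i; rewrite tnth_map tnth_mktuple.
      rewrite -[X in measurable X]setTI; exact (mZ measurableT _ mA).
    rewrite (expectation_prod_indep indep)// (eq_bigr _ (fun i _ => fh i)).
    rewrite -(expectation_prod_indep indep)//; last by move=> i; rewrite -fh.
    rewrite /m2/= /pushforward -/(density_measure P mg g0 _) density_measureE//; last first.
      rewrite -[X in measurable X]setTI; exact: measurable_vec.
    apply: eq_integral => w _; congr EFin; rewrite /h big_split/= big_split/= prod_indicE.
    have -> : \1_(vec @^-1` [set t | forall i, B i (tnth t i)]) w =
        `[< forall i, B i (X i w) >]%:R :> R.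
      rewrite indicE; congr (_ : bool)%:R; apply/idP/asboolP; rewrite inE/=.
        by move=> h' i; have := h' i; rewrite tnth_mktuple.
      by move=> h' i; rewrite tnth_mktuple.
    rewrite prodr_const card_ord -powR_mulrn ?powR_ge0// -powRrM mulNr -expR_sum -mulr_sumr.
    by rewrite /g -mulrA; congr (_ * _)%R; exact: mulrC.
  - by move=> _; rewrite /m1/= /pushforward preimage_setT probability_setT ltry.
have -> : \int[P]_w (F (map_tuple ( *%R u) (vec w)))%:E = 1%:E * \int[m1]_t (F t)%:E.
  rewrite mul1e ge0_integral_pushforward//; first exact/measurable_EFinP.
  by move=> t _; rewrite lee_fin.
apply/esym; apply: (@ge0_integral_weight _ _ _ _ _ P m1 g vec 1) => //.
  exact: measurable_vec.
move=> B mB; rewrite mul1e m12// /m2/= /pushforward -/(density_measure P mg g0 _) density_measureE//.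
rewrite -[X in measurable X]setTI; exact: measurable_vec.
Qed.
End VectorScaling.

Section Inversion.
Context {R : realType}.
Notation mu := (@lebesgue_measure R).
Implicit Types (x b s : R).

Let derive1_inv x : 0 < x -> derive1 (GRing.inv : R -> R) x = - x ^- 2.
Proof.
move=> x0; rewrite derive1E.
have x1 : (id : R -> R) x != 0 by rewrite gt_eqF.
have -> := @derive_val _ _ _ _ _ _ _ (is_deriveV x1 (is_derive_id x 1)).
by rewrite /GRing.scale/= mulr1.
Qed.

Let derivable_inv x : 0 < x -> derivable (GRing.inv : R -> R) x 1.
Proof.
move=> x0; have x1 : (id : R -> R) x != 0 by rewrite gt_eqF.
by have [] := is_deriveV x1 (is_derive_id x 1).
Qed.

Let continuous_inv2 x : 0 < x -> {for x, continuous (derive1 (GRing.inv : R -> R))}.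
Proof.
move=> x0; rewrite /prop_for /continuous_at derive1_inv//.
have h : \forall y \near x, - y ^- 2 = derive1 (GRing.inv : R -> R) y.
  by near=> y; rewrite derive1_inv//; near: y; exact: lt_nbhsr.
apply: cvg_trans (near_eq_cvg h) _.
apply: cvgN; apply: cvgV; first by rewrite gt_eqF// exprn_gt0.
exact: exprn_continuous.
Unshelve. all: by end_near. Qed.

(** The substitution x -> 1/x on the intervals [1 / (n + 1), n + 1], which it preserves and which
    exhaust the half-line. The transformed integrand is a separate [G'], tied to [G] only for x > 0,
    so that it can be written with real powers. *)
Lemma ge0_integral_inversion (G G' : R -> R) :
  measurable_fun setT G -> measurable_fun setT G' ->
  (forall x, 0 < x -> {for x, continuous G}) -> (forall x, 0 <= G x) ->
  (forall x, 0 <= G' x) -> (forall x, 0 < x -> G' x = G x^-1 / x ^+ 2) ->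
  (\int[mu]_(x in `]0%R, +oo[) (G x)%:E = \int[mu]_(x in `]0%R, +oo[) (G' x)%:E)%E.
Proof.
move=> mG mG' cG G0 G'0 GG'.
pose F n : set (measurableTypeR R) := `[n.+1%:R^-1, n.+1%:R]%classic.
have nF : {homo F : n m / (n <= m)%N >-> (n <= m)%O}.
  apply/nondecreasing_seqP => n; apply/subsetPset => t.
  rewrite /F/= !in_itv/= => /andP[nt tn]; apply/andP; split.
    by apply: le_trans nt; rewrite lef_pV2 ?posrE// ler_nat.
  by apply: le_trans tn _; rewrite ler_nat.
have FE : \bigcup_n F n = `]0, +oo[%classic.
  apply/seteqP; split => t /=.
    by move=> [n _]; rewrite /F/= !in_itv/= andbT => /andP[nt _]; apply: lt_le_trans nt.
  rewrite in_itv/= andbT => t0.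
  exists (Num.truncn (Num.max t t^-1)) => //; rewrite /F/= in_itv/=.
  have := Num.Theory.truncnS_gt (Num.max t t^-1); rewrite gt_max => /andP[h1 h2].
  by rewrite (ltW h1) andbT -[leRHS]invrK lef_pV2 ?posrE ?invr_gt0 ?(ltW h2)//.
have L (g : R -> R) : measurable_fun setT g -> (forall x, 0 <= g x) ->
    (\int[mu]_(x in F n) (g x)%:E @[n --> \oo] --> \int[mu]_(x in `]0%R, +oo[) (g x)%:E)%E.
  move=> mg g0; rewrite -FE.
  apply: (@ge0_nondecreasing_set_cvg_integral _ (measurableTypeR R) R F (EFin \o g) mu nF).
  - by move=> n; exact: measurable_itvR.
  - by move=> n; apply: measurable_funTS; exact/measurable_EFinP.
  - by move=> n x _; rewrite lee_fin.
have /(cvg_lim (@ereal_hausdorff R)) <- := L _ mG G0.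
have /(cvg_lim (@ereal_hausdorff R)) <- := L _ mG' G'0.
apply: congr_lim; apply/funext => -[|n].
  by rewrite /F invr1 set_itv1 !integral_set1.
have n0 : 0 < n.+2%:R^-1 :> R by rewrite invr_gt0.
have nn : n.+2%:R^-1 < n.+2%:R :> R by rewrite (lt_trans _ (_ : 1 < _)) ?invf_lt1 ?ltr1n.
have Fpos x : n.+2%:R^-1 <= x -> 0 < x by apply: lt_le_trans.
have c0 x : n.+2%:R^-1 <= x -> {for x, continuous (derive1 (GRing.inv : R -> R))}.
  by move=> /Fpos; exact: continuous_inv2.
rewrite /F -{2}[n.+2%:R](invrK).
rewrite (integration_by_substitution_decreasing (F := GRing.inv) (a := n.+2%:R^-1) (b := n.+2%:R))//.
- apply: eq_integral => x; rewrite inE/= in_itv/= => /andP[/Fpos x0 _]; congr EFin.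
  by rewrite GG'// -[LHS]/(G x^-1 * - derive1 (GRing.inv : R -> R) x) derive1_inv// opprK.
- exact: ltW.
- move=> x y; rewrite !in_itv/= => /andP[/Fpos x0 _] /andP[/Fpos y0 _] xy.
  by rewrite ltf_pV2 ?posrE.
- by move=> x; rewrite in_itv/= => /andP[/ltW /c0].
- by apply/cvg_ex; eexists; apply: cvg_at_right_filter; exact: c0.
- by apply/cvg_ex; eexists; apply: cvg_at_left_filter; apply: c0; exact: ltW.
- split.
  + by move=> x; rewrite in_itv/= => /andP[/ltW /Fpos /derivable_inv].
  + by apply: cvg_at_right_filter; apply: inv_continuous; rewrite gt_eqF.
  + by apply: cvg_at_left_filter; apply: inv_continuous; rewrite gt_eqF.
- apply: continuous_in_subspaceT => x; rewrite inE/= in_itv/= => /andP[/Fpos x0 _].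
  exact: cG.
Qed.

Lemma integral_gamma_inv b s : 0 < b -> 0 < s ->
  (\int[mu]_(v in `]0%R, +oo[) (v `^ (- b - 1) * expR (- (s * v `^ (-1))))%:E
    = (s `^ (- b) * Gamma b)%:E)%E.
Proof.
move=> b0 s0; rewrite -(Rintegral_gamma_scale b0 s0); apply/esym; apply: ge0_integral_inversion.
- apply: measurable_funM; first exact: measurable_powR.
  by apply: measurableT_comp => //; apply: measurableT_comp => //; exact: mulrl_measurable.
- apply: measurable_funM; first exact: measurable_powR.
  apply: measurableT_comp => //; apply: measurableT_comp => //.
  by apply: measurable_funM => //; exact: measurable_powR.
- move=> x x0; apply: differentiable_continuous; apply/derivable1_diffP.
  apply: derivableM => //; apply: derivable_powR.
  by rewrite in_itv/= andbT.
- by move=> x; rewrite mulr_ge0 ?powR_ge0 ?expR_ge0.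
- by move=> x; rewrite mulr_ge0 ?powR_ge0 ?expR_ge0.
- move=> x x0; rewrite -powR_inv1 ?(ltW x0)// mulrAC; congr (_ * _).
  rewrite -powRrM -powR_invn ?(ltW x0)// -gt0_powRD//; congr (_ `^ _); ring.
Qed.
End Inversion.

Lemma measurable_fun_divsqrt {d} {T : measurableType d} {R : realType} (f g : T -> R) :
  measurable_fun setT f -> measurable_fun setT g -> (forall w, 0 <= g w) ->
  measurable_fun setT (fun w => f w / Num.sqrt (g w)).
Proof.
move=> mf mg g0; rewrite (_ : (fun w => _) = (fun w => f w * (g w `^ 2^-1) `^ (-1))); last first.
  by apply/funext => w; rewrite powR_inv1 ?powR_ge0// powR12_sqrt.
apply: measurable_funM => //; apply: (measurableT_comp (measurable_powR _)).
exact: (measurableT_comp (measurable_powR _)).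
Qed.

Lemma measurable_fun_leR {d} {T : measurableType d} {R : realType} (f g : T -> R) :
  measurable_fun setT f -> measurable_fun setT g ->
  measurable_fun setT (fun x => (f x <= g x)%R%:R : R).
Proof.
move=> mf mg; rewrite (_ : (fun x => _) = \1_[set x | f x <= g x]).
  by apply: measurable_indic; rewrite -[X in measurable X]setTI; exact: measurable_fun_le.
by apply/funext => x; rewrite indicE; congr (_ : bool)%:R; apply/idP/idP; rewrite inE.
Qed.

Section GammaCdf.
Context {R : realType}.
Notation mu := (@lebesgue_measure R).
Implicit Types (x b s r v : R).

Lemma gamma_cdfE b x : gamma_cdf b x = (Gamma b)^-1 * igamma b x.
Proof. by []. Qed.

Lemma igamma_le0 b x : x <= 0 -> igamma b x = 0.
Proof.
rewrite le_eqVlt /igamma => /predU1P[->|x0].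
  by rewrite set_itv1 Rintegral_set1.
by rewrite set_itv_ge ?Rintegral_set0// bnd_simp -ltNge.
Qed.

Lemma nondecreasing_gamma_cdf b : 0 < b -> {homo gamma_cdf b : x y / x <= y}.
Proof.
move=> b0 x y xy; rewrite !gamma_cdfE ler_wpM2l ?invr_ge0 ?(ltW (Gamma_gt0 b0))//.
have [x0|x0] := leP x 0; first by rewrite igamma_le0// igamma_ge0.
exact: le_igamma.
Qed.

Lemma measurable_gamma_cdf b : 0 < b -> measurable_fun setT (gamma_cdf b).
Proof. by move=> b0; apply: nondecreasing_measurable => //; exact: nondecreasing_gamma_cdf. Qed.

Lemma gamma_cdf_ge0 b x : 0 < b -> 0 <= gamma_cdf b x.
Proof.
by move=> b0; rewrite gamma_cdfE mulr_ge0 ?igamma_ge0// invr_ge0 (ltW (Gamma_gt0 b0)).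
Qed.

(** The substitution t = s v turns t <= r s / sqrt w into v^2 w <= r^2, where s no longer occurs. *)
Lemma igamma_ratio b s w r : 0 < b -> 0 < s -> 0 < w -> 0 < r ->
  ((igamma b (r * (s / Num.sqrt w)))%:E =
  \int[mu]_(v in `]0%R, +oo[) (v `^ (b - 1) * s `^ b * expR (- (s * v)) *
     (v ^+ 2 * w <= r ^+ 2)%R%:R)%:E)%E.
Proof.
move=> b0 s0 w0 r0; set x := r * _.
have sw : 0 < Num.sqrt w by rewrite sqrtr_gt0.
have x0 : 0 < x by rewrite mulr_gt0// divr_gt0.
pose g t := t `^ (b - 1) * expR (- t).
have mg : measurable_fun setT g by exact: measurable_powRexp.
rewrite /igamma /Rintegral fineK; last first.
  exact: (integrable_fin_num (measurable_itvR _) (integrable_igamma b0 x0)).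
have mle (c : R) : measurable_fun setT (fun t : R => (t <= c)%R%:R : R).
  exact: measurable_fun_leR.
transitivity (\int[mu]_(t in `]0%R, +oo[) (g t * (t <= x)%R%:R)%:E)%E.
  rewrite -integral_itv_obnd_cbnd; last first.
    by apply: measurable_funTS; apply/measurable_EFinP; exact: mg.
  rewrite integral_mkcond [RHS]integral_mkcond; apply: eq_integral => t _.
  rewrite !patchE !mem_setE !in_itv/= andbT.
  by case: ltP => //= t0; case: leP => _; rewrite ?mulr1 ?mulr0.
rewrite (@ge0_integral_scale _ s)//; last 2 first.
- by apply/measurable_EFinP; apply: measurable_funM.
- by move=> t; rewrite lee_fin mulr_ge0// mulr_ge0 ?powR_ge0 ?expR_ge0.
rewrite -ge0_integralZl_EFin//; last 3 first.
- by move=> t _; rewrite lee_fin mulr_ge0// mulr_ge0 ?powR_ge0 ?expR_ge0.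
- apply: measurable_funTS; apply/measurable_EFinP.
  apply: (measurableT_comp (f := fun t => g t * (t <= x)%R%:R)); first exact: measurable_funM.
  exact: mulrl_measurable.
- exact: ltW.
apply: eq_integral => v; rewrite inE/= in_itv/= andbT => v0.
rewrite -EFinM; congr EFin; rewrite /g powRM ?(ltW v0) ?(ltW s0)//.
have -> : s * v <= x = (v ^+ 2 * w <= r ^+ 2).
  rewrite /x mulrCA ler_pM2l// ler_pdivlMr// -{2}(sqr_sqrtr (ltW w0)) -exprMn.
  by rewrite ler_sqr ?nnegrE ?(ltW r0)// mulr_ge0// ltW.
have -> : s `^ b = s `^ (b - 1) * s.
  by rewrite gt0_powRD// powR_inv1 ?(ltW s0)// mulfVK// gt_eqF.
by move: (s `^ _) (v `^ _) (expR _) (_%:R) => *; ring.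
Qed.
End GammaCdf.

(** This is (n - 1) S^2 of the theorem. *)
Definition spread {R : realType} {n} (x : 'I_n -> R) : R :=
  \sum_(i < n) (x i - n%:R^-1 * \sum_(i < n) x i) ^+ 2.

Lemma spreadZ {R : realType} n (c : R) (x : 'I_n -> R) :
  spread (fun i => c * x i) = c ^+ 2 * spread x.
Proof.
rewrite /spread [RHS]mulr_sumr; apply: eq_bigr => i _.
by rewrite -exprMn mulrBr -!mulr_sumr mulrCA.
Qed.

Lemma measurable_spread {d} {T : measurableType d} {R : realType} n (X : 'I_n -> T -> R) :
  (forall i, measurable_fun setT (X i)) -> measurable_fun setT (fun w => spread (X^~ w)).
Proof.
move=> mX; apply: measurable_sum => i; apply: measurable_funX.
by apply: measurable_funB => //; apply: measurable_funM => //; exact: measurable_sum.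
Qed.

Section Lukacs.
Context {d : measure_display} {T : measurableType d} {R : realType}.
Variables (P : probability T R) (n : nat) (X : 'I_n -> {RV P >-> R}) (a : R).
Hypotheses (indep : mutually_independent X) (a0 : 0 < a) (n0 : (0 < n)%N).
Hypothesis (Xa : forall i, has_density (X i) (gamma_pdf a)).
Local Open Scope ereal_scope.
Notation mu := (@lebesgue_measure R).
Notation S w := (\sum_(i < n) X i w)%R.
Notation W w := (spread (fun i => X i w)).
Let b : R := (a * n%:R)%R.
Hypothesis good : {ae P, forall w, 0 < S w /\ 0 < W w}%R.

Let b0 : (0 < b)%R. Proof. by rewrite mulr_gt0// ltr0n. Qed.

Let mX i : measurable_fun setT (X i). Proof. exact: measurable_funPT. Qed.
Let mS : measurable_fun setT (fun w => S w).
Proof. exact: measurable_sum. Qed.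
Let mW : measurable_fun setT (fun w => W w).
Proof. exact: measurable_spread. Qed.

(** The scaling law with u = v, applied to [F]. On the left W(v X) = v^2 W(X); on the right the
    density turns e^(-S) into e^(-S / v), and v has left the indicator. *)
Let scale (r v : R) : (0 < v)%R ->
  \int[P]_w (v `^ (b - 1) * `|S w| `^ b * expR (- (S w * v)) * (v ^+ 2 * W w <= r ^+ 2)%R%:R)%:E =
  \int[P]_w (v `^ (- b - 1) * `|S w| `^ b * expR (- (S w * v `^ (-1))) * (W w <= r ^+ 2)%R%:R)%:E.
Proof.
move=> v0.
(* The absolute value keeps the power homogeneous even where the sum is not positive; the factor
   v^-1 adjusts v^b to v^(b - 1). *)
pose F (t : n.-tuple (measurableTypeR R)) : R :=
  (v^-1 * `|\sum_(i < n) tnth t i| `^ b * expR (- (\sum_(i < n) tnth t i)) *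
  (spread (tnth t) <= r ^+ 2)%R%:R)%R.
have mt (i : 'I_n) : measurable_fun setT (fun t : n.-tuple (measurableTypeR R) => tnth t i : R).
  exact: measurable_tnth.
have msum : measurable_fun setT (fun t : n.-tuple (measurableTypeR R) => (\sum_(i < n) tnth t i)%R : R).
  exact: measurable_sum.
have mF : measurable_fun setT F.
  apply: measurable_funM; last first.
    by apply: measurable_fun_leR => //; exact: (measurable_spread (X := fun i t => tnth t i)).
  apply: measurable_funM; last by apply: measurableT_comp => //; exact: measurableT_comp.
  apply: measurable_funM => //; apply: (measurableT_comp (measurable_powR b)).
  by apply: measurableT_comp.
have F0 t : (0 <= F t)%R.
  by rewrite !mulr_ge0 ?powR_ge0 ?expR_ge0 ?invr_ge0 ?(ltW v0).
have := expectation_vec_scale indep a0 Xa v0 mF F0.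
set L := \int[P]_w _; set L' := \int[P]_w _ => LL'.
transitivity L; first apply: eq_integral => w _; last rewrite LL'; last apply: eq_integral => w _.
  congr EFin; rewrite /F.
  have -> : (\sum_(i < n) tnth (map_tuple ( *%R v) (vec X w)) i = v * S w)%R.
    by rewrite mulr_sumr; apply: eq_bigr => i _; rewrite tnth_map tnth_mktuple.
  have -> : spread (tnth (map_tuple ( *%R v) (vec X w))) = (v ^+ 2 * W w)%R.
    by rewrite -spreadZ; congr spread; apply/funext => i; rewrite tnth_map tnth_mktuple.
  rewrite normrM (gtr0_norm v0) powRM ?(ltW v0)// (mulrC (S w)).
  by rewrite gt0_powRD// powR_inv1 ?(ltW v0)// !mulrA (mulrC v^-1%R).
congr EFin; rewrite /F.
have -> : (\sum_(i < n) tnth (vec X w) i = S w)%R.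
  by apply: eq_bigr => i _; rewrite tnth_mktuple.
have -> : spread (tnth (vec X w)) = W w.
  by congr spread; apply/funext => i; rewrite tnth_mktuple.
rewrite gt0_powRD// powR_inv1 ?(ltW v0)//.
have -> : expR (- (S w / v)) = (expR ((1 - v^-1) * S w) * expR (- S w))%R.
  by rewrite -expRD; congr expR; ring.
by rewrite -/b; move: (expR _) (expR _) (_ `^ b)%R (_ `^ _)%R (_%:R)%R => *; ring.
Qed.

Let measurable_pow (c : R) (f : T * measurableTypeR R -> R) : measurable_fun setT f ->
  measurable_fun setT (fun wv => f wv `^ c)%R.
Proof. by move=> mf; apply: (measurableT_comp (measurable_powR c)). Qed.

(** Tonelli's theorem over pairs (w, v). Integrating over v first gives Gamma(b) G_b(r S / sqrt W)
    for one integrand and Gamma(b) times the indicator of W <= r^2 for the other; integrating over w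
    first, the two agree for each v by [scale]. *)
Let fubini (r : R) : (0 < r)%R -> exists A B : T -> \bar R,
  [/\ measurable_fun setT A, measurable_fun setT B,
     (forall w, 0 <= A w) /\ (forall w, 0 <= B w),
     \int[P]_w A w = \int[P]_w B w &
     forall w, (0 < S w)%R -> (0 < W w)%R ->
       (gamma_cdf b (r * (S w / Num.sqrt (W w))))%:E = (Gamma b)^-1%:E * A w /\
       B w = (Gamma b * (W w <= r ^+ 2)%R%:R)%:E].
Proof.
move=> r0.
(* The restriction to v > 0 becomes a factor, so that Tonelli's theorem applies on the full product
   space. *)
pose pos (v : R) : R := (\1_(`]0%R, +oo[%classic : set R) v).
pose phi (wv : T * measurableTypeR R) : R :=
  (pos wv.2 * (wv.2 `^ (b - 1) * `|S wv.1| `^ b * expR (- (S wv.1 * wv.2))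
    * (wv.2 ^+ 2 * W wv.1 <= r ^+ 2)%R%:R))%R.
pose psi (wv : T * measurableTypeR R) : R :=
  (pos wv.2 * (wv.2 `^ (- b - 1) * `|S wv.1| `^ b * expR (- (S wv.1 * wv.2 `^ (-1)))
    * (W wv.1 <= r ^+ 2)%R%:R))%R.
have mpos : measurable_fun setT (fun wv : T * measurableTypeR R => pos wv.2).
  by apply: (measurableT_comp _ measurable_snd); exact: measurable_indic.
have mSp : measurable_fun setT (fun wv : T * measurableTypeR R => S wv.1).
  exact: (measurableT_comp mS measurable_fst).
have mWp : measurable_fun setT (fun wv : T * measurableTypeR R => W wv.1).
  exact: (measurableT_comp mW measurable_fst).
have mv : measurable_fun setT (fun wv : T * measurableTypeR R => wv.2 : R).
  exact: measurable_snd.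
have mphi : measurable_fun setT (EFin \o phi).
  apply/measurable_EFinP; apply: measurable_funM => //.
  apply: measurable_funM; last first.
    by apply: measurable_fun_leR => //; apply: measurable_funM => //; exact: measurable_funX.
  apply: measurable_funM; last first.
    by apply: measurableT_comp => //; apply: measurableT_comp => //; exact: measurable_funM.
  by apply: measurable_funM; apply: measurable_pow => //; exact: measurableT_comp.
have mpsi : measurable_fun setT (EFin \o psi).
  apply/measurable_EFinP; apply: measurable_funM => //.
  apply: measurable_funM; last exact: measurable_fun_leR.
  apply: measurable_funM; last first.
    apply: measurableT_comp => //; apply: measurableT_comp => //; apply: measurable_funM => //.
    exact: measurable_pow.
  by apply: measurable_funM; apply: measurable_pow => //; exact: measurableT_comp.
have pos0 v : (0 <= pos v)%R by [].
have phi0 x : (0 <= phi x)%R.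
  by rewrite /phi !mulr_ge0 ?powR_ge0 ?expR_ge0.
have psi0 x : (0 <= psi x)%R.
  by rewrite /psi !mulr_ge0 ?powR_ge0 ?expR_ge0.
have intpos (f : R -> R) : \int[mu]_v (pos v * f v)%:E = \int[mu]_(v in `]0%R, +oo[) (f v)%:E.
  rewrite [RHS]integral_mkcond; apply: eq_integral => v _.
  by rewrite patchE /pos indicE; case: (v \in _); rewrite ?mul1r ?mul0r.
have key : \int[P]_w \int[mu]_v (phi (w, v))%:E = \int[P]_w \int[mu]_v (psi (w, v))%:E.
  rewrite (fubini_tonelli (EFin \o phi) mphi (fun x => phi0 x)).
  rewrite (fubini_tonelli (EFin \o psi) mpsi (fun x => psi0 x)).
  apply: eq_integral => v _ /=; rewrite /phi /psi/= /pos indicE.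
  have [v0|_] := boolP (v \in _); last first.
    by under eq_integral do rewrite mul0r; under [RHS]eq_integral do rewrite mul0r.
  under eq_integral do rewrite mul1r; under [RHS]eq_integral do rewrite mul1r.
  by apply: scale; move: v0; rewrite inE/= in_itv/= andbT.
exists (fun w => \int[mu]_v (phi (w, v))%:E), (fun w => \int[mu]_v (psi (w, v))%:E).
split.
- exact: (measurable_fun_fubini_tonelli_F (m2 := mu) (EFin \o phi) mphi (fun x => phi0 x)).
- exact: (measurable_fun_fubini_tonelli_F (m2 := mu) (EFin \o psi) mpsi (fun x => psi0 x)).
- by split=> w; apply: integral_ge0 => v _; rewrite lee_fin.
- exact: key.
move=> w S0 W0; rewrite /phi /psi /= !intpos (gtr0_norm S0).
move: S0 W0; move: (S w) (W w); clear -r0 b0 => s q s0 q0; split.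
  by rewrite gamma_cdfE EFinM igamma_ratio.
transitivity ((s `^ b * (q <= r ^+ 2)%R%:R)%:E *
    \int[mu]_(v in `]0%R, +oo[) (v `^ (- b - 1) * expR (- (s * v `^ (-1))))%:E).
  rewrite -ge0_integralZl_EFin.
  - by apply: eq_integral => v _; rewrite -EFinM; congr EFin; ring.
  - exact: measurable_itvR.
  - by move=> v _; rewrite lee_fin mulr_ge0 ?powR_ge0 ?expR_ge0.
  - apply: measurable_funTS; apply/measurable_EFinP.
    apply: measurable_funM; first exact: measurable_powR.
    apply: measurableT_comp; first exact: measurable_expR.
    apply: measurableT_comp; first exact: oppr_measurable.
    by apply: measurable_funM; [exact: measurable_cst | exact: measurable_powR].
  - by rewrite mulr_ge0 ?powR_ge0// ler0n.
rewrite (integral_gamma_inv b0 s0) -EFinM; congr EFin; rewrite powRN.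
have := powR_gt0 b s0; move: (_ `^ _)%R (Gamma b) (_%:R)%R => p G q' p0.
by rewrite mulrACA mulfV ?mul1r 1?mulrC ?gt_eqF.
Qed.

(** S and W are positive only almost surely, so the pointwise identities of [fubini] enter through
    equality almost everywhere. *)
Lemma lukacs (r : R) : (0 < r)%R ->
  \int[P]_w (gamma_cdf b (r * (S w / Num.sqrt (W w))))%:E =
  P [set w | W w <= r ^+ 2]%R.
Proof.
move=> r0; have G0 := Gamma_gt0 b0.
have mWr : measurable_fun setT (fun w => (W w <= r ^+ 2)%R%:R : R) by exact: measurable_fun_leR.
have G0' : (0 <= (Gamma b)^-1)%R by rewrite invr_ge0 ltW.
have [A [B [mA mB [A0 B0] AB h]]] := fubini r0.
transitivity ((Gamma b)^-1%:E * \int[P]_w A w).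
  rewrite -ge0_integralZl_EFin//.
  apply: ge0_ae_eq_integral => //.
  - apply/measurable_EFinP; apply: (measurableT_comp (measurable_gamma_cdf b0)).
    apply: measurable_funM; first exact: measurable_cst.
    by apply: measurable_fun_divsqrt => // w; apply: sumr_ge0 => i _; exact: sqr_ge0.
  - exact: emeasurable_funM.
  - by move=> w _; rewrite lee_fin gamma_cdf_ge0.
  - by move=> w _; rewrite mule_ge0// lee_fin.
  by apply: filterS good => w [S0 W0] _; have [] := h w S0 W0.
rewrite AB.
have -> : \int[P]_w B w = \int[P]_w (Gamma b * (W w <= r ^+ 2)%R%:R)%:E.
  apply: ge0_ae_eq_integral => //.
  - by apply/measurable_EFinP; exact: measurable_funM.
  - by move=> w _; rewrite lee_fin mulr_ge0// ltW.
  by apply: filterS good => w [S0 W0] _; have [] := h w S0 W0.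
under eq_integral do rewrite EFinM.
rewrite ge0_integralZl_EFin ?(ltW G0)//; last by exact/measurable_EFinP.
rewrite muleA -EFinM mulVf ?gt_eqF// mul1e.
rewrite -[X in P X]setIT -integral_indic//; last first.
  by rewrite -[X in measurable X]setTI; exact: measurable_fun_le.
apply: eq_integral => w _; rewrite indicE; congr (_ : bool)%:R%:E.
by apply/idP/idP; rewrite inE.
Qed.
End Lukacs.

(** * Concentration near the diagonal *)

(** Two deviations from the mean give (x_j - x_k)^2 <= 2 W, hence x_j^2 <= 2 x_k^2 + 4 W and W <= n
    eps (2 x_k^2 + 4 W). As 4 n eps <= 1/2, the term in W is absorbed: W <= 4 n eps x_k^2. *)
Lemma spread_close {R : realType} n (x : 'I_n -> R) (eps : R) (i k : 'I_n) :
  0 <= eps -> 8 * n%:R * eps <= 1 -> spread x <= eps * \sum_j x j ^+ 2 ->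
  (x i - x k) ^+ 2 <= 8 * n%:R * eps * x k ^+ 2.
Proof.
move=> e0 en; set W := spread x => WQ.
have n0 : 0 < n%:R :> R by rewrite ltr0n (leq_ltn_trans _ (ltn_ord k)).
set m := n%:R^-1 * \sum_j x j.
have pair j l : j != l -> (x j - m) ^+ 2 + (x l - m) ^+ 2 <= W.
  move=> jl; rewrite /W /spread -/m (bigD1 j)//= (bigD1 l) ?(eq_sym l)//= addrA lerDl.
  by apply: sumr_ge0 => *; exact: sqr_ge0.
have W0 : 0 <= W by apply: sumr_ge0 => *; exact: sqr_ge0.
have d2 j : (x j - x k) ^+ 2 <= 2 * W.
  have [->|jk] := eqVneq j k; first by rewrite subrr expr0n/= mulr_ge0.
  by have := pair j k jk; have := sqr_ge0 ((x j - m) + (x k - m)); nra.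
have Qle : \sum_j x j ^+ 2 <= n%:R * (2 * x k ^+ 2 + 4 * W).
  apply: (@le_trans _ _ (\sum_(j < n) (2 * x k ^+ 2 + 4 * W))).
    by apply: ler_sum => j _; have := d2 j; have := sqr_ge0 (x j - x k - x k); nra.
  by rewrite sumr_const card_ord [leRHS]mulr_natl.
have : W <= eps * (n%:R * (2 * x k ^+ 2 + 4 * W)).
  by apply: (le_trans WQ); rewrite ler_wpM2l.
have := d2 i; have : 8 * n%:R * eps * W <= W by rewrite ler_piMl.
by move: W0 WQ en => _ _ _; move: (x i - x k) (x k) => u v; nra.
Qed.

Section Tail.
Context {d : measure_display} {T : measurableType d} {R : realType}.
Variables (P : probability T R) (n : nat) (X : 'I_n -> {RV P >-> R}) (a : R).
Hypotheses (indep : mutually_independent X) (a0 : 0 < a).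
Hypothesis (Xa : forall i, has_density (X i) (gamma_pdf a)).
Variable M : R.
Hypothesis (pdfM : forall x, 0 < x -> x * gamma_pdf a x <= M).
Local Open Scope ereal_scope.

Let mX i : measurable_fun setT (X i). Proof. exact: measurable_funPT. Qed.

Let mXB i B : measurable B -> measurable (X i @^-1` B).
Proof. by move=> mB; rewrite -[X in measurable X]setTI; exact: mX. Qed.

(** For a < 1 the density f is unbounded at 0, but x f(x) <= M always, so f is at most 2 M / s
    beyond s / 2. *)
Lemma gamma_itv i (s u v : R) : (0 < s)%R -> (s / 2 <= u)%R -> (u <= v)%R ->
  P (X i @^-1` `[u, v]%classic) <= ((v - u) * (2 * M / s))%:E.
Proof.
move=> s0 su uv; have u0 : (0 < u)%R by apply: lt_le_trans su; rewrite divr_gt0.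
rewrite -[leLHS](_ : distribution P (X i) `[u, v]%classic = _)// (Xa i)//.
apply: (@le_trans _ _ (\int[lebesgue_measure]_(x in `[u, v]) (2 * M / s)%:E)).
  apply: ge0_le_integral => //.
  - by move=> x _; rewrite lee_fin gamma_pdf_ge0.
  - by apply: measurable_funTS; apply/measurable_EFinP; exact: measurable_gamma_pdf.
  move=> x; rewrite /= in_itv/= => /andP[ux _]; rewrite lee_fin.
  have x0 : (0 < x)%R by exact: lt_le_trans ux.
  have xs : (s <= 2 * x)%R by lra.
  have g0 := gamma_pdf_ge0 x a0.
  rewrite ler_pdivlMr//; have := pdfM x0; nra.
rewrite integral_cst/=; last exact: measurable_itvR.
rewrite lebesgue_measure_itv/= lte_fin; case: ltP => h.
  by rewrite -EFinB -EFinM mulrC.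
by rewrite (le_anti (introT andP (conj uv h))) subrr mul0r mule0.
Qed.

Lemma gamma_pos i : P (X i @^-1` `]-oo, 0%R]%classic) = 0.
Proof.
rewrite -[LHS](_ : distribution P (X i) `]-oo, 0%R]%classic = _)// (Xa i)//.
rewrite integral0_eq// => x; rewrite /= in_itv/= => x0.
by rewrite /gamma_pdf ltNge x0.
Qed.

Let M0 : (0 <= M)%R.
Proof. by apply: le_trans (pdfM ltr01); rewrite mul1r gamma_pdf_ge0. Qed.

Let rectangle_le (B : 'I_n -> set R) k (c : R) : (forall i, measurable (B i)) ->
  (forall i, i != k -> P (X i @^-1` B i) <= c%:E) -> (0 <= c)%R ->
  P (\bigcap_(i in [set` [set: 'I_n]%SET]) X i @^-1` B i) <= P (X k @^-1` B k) * (c ^+ n.-1)%:E.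
Proof.
move=> mB Bc c0; rewrite indep//; under eq_bigl do rewrite inE.
rewrite (bigD1 k)//=; apply: lee_wpmul2l => //.
have -> : (c ^+ n.-1)%:E = \prod_(i < n | i != k) c%:E.
  have -> : \prod_(i < n | i != k) c%:E = (\prod_(i < n | i != k) c)%:E.
    by elim/big_rec2 : _ => // i x y _ ->; rewrite EFinM.
  rewrite prodr_const; congr (_ ^+ _)%:E.
  by rewrite -[n in n.-1]card_ord -(cardC1 k); apply: eq_card => i.
suff [] : 0 <= \prod_(i < n | i != k) P (X i @^-1` B i) /\
   \prod_(i < n | i != k) P (X i @^-1` B i) <= \prod_(i < n | i != k) c%:E by [].
elim/big_rec2 : _ => // i x y ik [h0 h]; split; first by rewrite mule_ge0.
by apply: lee_pmul => //; exact: Bc.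
Qed.

Lemma measurable_close k (e : R) :
  measurable [set w | 0 < X k w /\ forall i, (X i w - X k w) ^+ 2 <= (e * X k w) ^+ 2]%R.
Proof.
rewrite (_ : mkset _ = X k @^-1` `]0%R, +oo[%classic `&`
    \bigcap_(i in [set: 'I_n]) [set w | (X i w - X k w) ^+ 2 <= (e * X k w) ^+ 2]%R).
  apply: measurableI; first by apply: mXB; exact: measurable_itvR.
  apply: fin_bigcap_measurable => [|i _]; first exact: finite_finset.
  rewrite -[X in measurable X]setTI; apply: measurable_fun_le => //.
    by apply: measurable_funX; exact: measurable_funB.
  by apply: measurable_funX; exact: measurable_funM.
apply/seteqP; split => w /=; rewrite in_itv/= andbT => -[w0 h]; split=> // i; first by move=> _; exact: h.
exact: (h i I).
Qed.

(* On each cell e^(m e) <= X_k < e^((m + 1) e) the event is contained in a rectangle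
   whose other sides have probability at most 8 e M. *)
Lemma close_prob k (e : R) : (0 < e)%R -> (e <= 1 / 4)%R ->
  P [set w | 0 < X k w /\ forall i, (X i w - X k w) ^+ 2 <= (e * X k w) ^+ 2]%R
    <= ((8 * e * M) ^+ n.-1)%:E.
Proof.
move=> e0 e4; set E := [set w | _].
have c1 : (0 <= 8 * e * M)%R by rewrite mulr_ge0// mulr_ge0// ltW.
have c0 : (0 <= (8 * e * M) ^+ n.-1)%R by rewrite exprn_ge0.
have mE : measurable E by exact: measurable_close.
(* An enumeration of the integers by natural numbers; an index that codes no integer receives the
   empty cell. *)
have [p [u [pu up]]] : exists (p : int -> nat) (u : nat -> option int),
    (forall m, u (p m) = Some m) /\ (forall q m, u q = Some m -> p m = q).
  exists pickle, pickle_inv; split=> [m|q m h]; first exact: pickleK_inv.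
  by have := pickle_invK (T := int) q; rewrite h.
pose cell (m : int) : set R := `[expR (m%:~R * e), expR ((m + 1)%:~R * e)[%classic.
pose F q := X k @^-1` (if u q is Some m then cell m else set0).
have mcell m : measurable (cell m) by exact: measurable_itvR.
have cellP m x : cell m x -> (Num.floor (ln x / e) = m)%R.
  rewrite /cell/= in_itv/= => /andP[h1 h2].
  have x0 : (0 < x)%R by apply: lt_le_trans h1; exact: expR_gt0.
  apply: floor_def; rewrite ler_pdivlMr// ltr_pdivrMr//.
  by rewrite -ler_expR lnK// h1/= -ltr_expR lnK.
have mF q : measurable (F q).
  by apply: mXB; case: (u q).
have tF : trivIset setT F.
  move=> q q' _ _ [w []]; rewrite /F/=.
  case E1 : (u q) => [m|//]; case E2 : (u q') => [m'|//] /cellP h /cellP h'.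
  by rewrite -(up _ _ E1) -(up _ _ E2) -h -h'.
have step q : P (E `&` F q) <= P (F q) * ((8 * e * M) ^+ n.-1)%:E.
  rewrite /F; case: (u q) => [m|]; last by rewrite preimage_set0 setI0 measure0 mul0e.
  pose s := expR (m%:~R * e); pose g := expR e.
  have s0 : (0 < s)%R by exact: expR_gt0.
  have g0 : (0 < g)%R by exact: expR_gt0.
  (* From exp(-e) >= 1 - e and e <= 1/4, which give exp(e) <= 1 / (1 - e) <= 1 + 4 e / 3. *)
  have ge : (g <= 1 + 4 / 3 * e)%R.
    have : (1 - e <= g^-1)%R by rewrite -expRN; exact: expR_ge1Dx.
    rewrite -[(_ <= g^-1)%R](ler_pM2r g0) mulVf ?gt_eqF//; nra.
  (* For X_k in [s, s g[ the event places X_i between s (1 - e) and (1 + e) s g, an interval of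
     length at most 4 e s; the density bound 2 M / s then yields 8 e M. *)
  pose B i : set R := if i == k then cell m else `[(s * (1 - e))%R, ((1 + e) * (s * g))%R]%classic.
  have sub : E `&` X k @^-1` cell m `<=` \bigcap_(i in [set` [set: 'I_n]%SET]) X i @^-1` B i.
    move=> w [[Xk0 h] Xkm] i _; rewrite /B/=; case: eqVneq => [->//|ik].
    move: Xkm; rewrite /cell/= !in_itv/= intrD mulrDl mul1r expRD -/s -/g => /andP[h1 h2].
    have := h i; rewrite -ler_sqrt ?sqr_ge0// !sqrtr_sqr (ger0_norm (_ : 0 <= e * _)%R); last first.
      by rewrite mulr_ge0// ltW.
    rewrite ler_norml => /andP[h3 h4]; apply/andP; split; nra.
  have mB i : measurable (B i) by rewrite /B; case: ifP => // _; exact: measurable_itvR.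
  apply: (@le_trans _ _ (P (\bigcap_(i in [set` [set: 'I_n]%SET]) X i @^-1` B i))).
    apply: le_measure => //; rewrite inE.
    - by apply: measurableI => //; exact: mXB.
    - apply: fin_bigcap_measurable => [|i _]; first exact: finite_finset.
      exact: mXB.
  have BkE : B k = cell m by rewrite /B eqxx.
  rewrite -BkE; apply: rectangle_le => //.
  move=> i ik; rewrite /B (negbTE ik).
  apply: le_trans (gamma_itv i s0 _ _) _; first by nra.
    have := expR_ge1Dx e; rewrite -/g => g1.
    by rewrite [leRHS]mulrCA ler_wpM2l ?(ltW s0)//; nra.
  rewrite lee_fin mulrA ler_pdivrMr// mulrCA.
  rewrite (_ : 8 * e * M * s = (2 * M) * (4 * e * s))%R; last by ring.
  rewrite -[leRHS]mulrA ler_wpM2l// mulrC ler_wpM2l//.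
  have : ((1 + e) * g <= (1 + e) * (1 + 4 / 3 * e))%R by rewrite ler_wpM2l// addr_ge0// ltW.
  rewrite (_ : (1 + e) * (s * g) - s * (1 - e) = s * ((1 + e) * g - (1 - e)))%R; last by ring.
  rewrite (mulrC _ s) => h; rewrite ler_wpM2l ?(ltW s0)//; nra.
have EF : E `<=` \bigcup_q (E `&` F q).
  move=> w Ew; case: (Ew) => Xk0 _.
  exists (p (Num.floor (ln (X k w) / e))) => //; split; first exact: Ew.
  rewrite /F/= pu /cell/= in_itv/= -{2 3}(lnK (x := X k w)) ?posrE//.
  rewrite ler_expR ltr_expR -ler_pdivlMr// -ltr_pdivrMr//.
  exact: floor_itv.
apply: (le_trans (measure_sigma_subadditive P (fun q => measurableI _ _ mE (mF q)) mE EF)).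
apply: (le_trans (lee_nneseries (v := fun q => ((8 * e * M) ^+ n.-1)%:E * P (F q)) _ _)) => //.
  by move=> q _; rewrite muleC; exact: step.
(* The cells are disjoint, so the probabilities of X_k lying in them add up to at most 1. *)
rewrite nneseriesZl//.
rewrite -[leRHS]mule1; apply: lee_wpmul2l; first by rewrite lee_fin.
rewrite -(measure_semi_bigcup P mF tF); last by apply: bigcupT_measurable.
by apply: probability_le1; apply: bigcupT_measurable.
Qed.

End Tail.

Lemma gamma_pdf_bounded {R : realType} (a : R) : 0 < a ->
  exists M, forall x, 0 < x -> x * gamma_pdf a x <= M.
Proof.
move=> a0; have [B [B0 hB]] := powR_expRN_bounded (ltW a0).
exists ((Gamma a)^-1 * B) => x x0; rewrite /gamma_pdf x0.
rewrite (_ : x * _ = (Gamma a)^-1 * (x `^ a * expR (- x))).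
  by rewrite ler_wpM2l ?invr_ge0 ?(ltW (Gamma_gt0 a0))// hB// ltW.
rewrite (_ : x `^ a = x `^ (a - 1) * x).
  by move: (Gamma a)^-1 (x `^ _) (expR _) => *; ring.
by rewrite gt0_powRD// powR_inv1 ?(ltW x0)// mulfVK// gt_eqF.
Qed.

(** [spread_close] puts all X_i within relative distance sqrt (8 n eps) of the first one, so the
    power n - 1 of [close_prob] becomes eps^((n - 1)/2). The constant precedes the probability
    space. *)
Lemma spread_prob_le {R : realType} n (a : R) : (0 < n)%N -> 0 < a -> exists C : R, 0 < C /\
  forall d (T : measurableType d) (P : probability T R) (X : 'I_n -> {RV P >-> R}),
  mutually_independent X -> (forall i, has_density (X i) (gamma_pdf a)) ->
  forall eps : R, 0 < eps ->
  (P [set w | spread (fun i => X i w) <= eps * \sum_(i < n) X i w ^+ 2]%R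
    <= (C * eps `^ ((n%:R - 1) / 2))%R%:E)%E.
Proof.
case: n => // n _ a0; have [M hM] := gamma_pdf_bounded a0.
have M0 : 0 <= M by apply: le_trans (hM 1 ltr01); rewrite mul1r gamma_pdf_ge0.
pose m : R := (n.+1%:R - 1) / 2.
have mE : m = n%:R / 2 by rewrite /m -natr1 addrK.
have m0 : 0 <= m by rewrite mE divr_ge0.
(* For eps <= e0 the relative distance is at most 1/4, as [close_prob] requires. Above e0 the
   summand (e0^m)^-1 of the constant makes the bound at least 1. *)
pose e0 : R := (128 * n.+1%:R)^-1.
have e00 : 0 < e0 by rewrite invr_gt0 mulr_gt0.
exists ((8 * M * Num.sqrt (8 * n.+1%:R)) ^+ n + (e0 `^ m)^-1); split.
  by rewrite ltr_wpDl ?invr_gt0 ?powR_gt0// exprn_ge0// mulr_ge0 ?sqrtr_ge0// mulr_ge0.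
move=> d T P X indep Xa eps eps0; rewrite -/m.
have mX i : measurable_fun setT (X i) by exact: measurable_funPT.
have mA : measurable [set w | spread (fun i => X i w) <= eps * \sum_(i < n.+1) X i w ^+ 2]%R.
  rewrite -[X in measurable X]setTI; apply: measurable_fun_le => //.
    exact: measurable_spread.
  apply: measurable_funM => //; apply: measurable_sum => i; exact: measurable_funX.
have [ee0|ee0] := leP eps e0; last first.
  apply: (le_trans (probability_le1 _ mA)); rewrite lee_fin mulrDl.
  apply: ler_wpDl; first by rewrite mulr_ge0 ?powR_ge0// exprn_ge0// mulr_ge0 ?sqrtr_ge0// mulr_ge0.
  rewrite ler_pdivlMl ?powR_gt0// mulr1; by apply: ge0_ler_powR; rewrite ?nnegrE ?m0// ltW.
set A := [set w | _] in mA *.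
pose e := Num.sqrt (8 * n.+1%:R * eps).
have en : 8 * n.+1%:R * eps <= 1 / 16.
  have : n.+1%:R * eps <= n.+1%:R * e0 by rewrite ler_wpM2l.
  have -> : n.+1%:R * e0 = 1 / 128 by rewrite /e0 invfM mulrCA divff ?pnatr_eq0// mulr1 div1r.
  by rewrite -[8 * _ * eps]mulrA; lra.
have e2 : e ^+ 2 = 8 * n.+1%:R * eps by rewrite sqr_sqrtr// !mulr_ge0// ltW.
have ep : 0 < e by rewrite sqrtr_gt0 !mulr_gt0.
have e4 : e <= 1 / 4.
  by rewrite -ler_sqr ?nnegrE ?(ltW ep)// e2; lra.
pose E := [set w | 0 < X ord0 w /\ forall i, (X i w - X ord0 w) ^+ 2 <= (e * X ord0 w) ^+ 2].
pose N := X ord0 @^-1` `]-oo, 0%R]%classic.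
have PN : P N = 0%E by exact: gamma_pos.
have mN : measurable N.
  rewrite -[X in measurable X]setTI; apply: mX => //; exact: measurable_itvR.
have AEN : A `<=` E `|` N.
  move=> w Aw; have [X0|X0] := ltP 0 (X ord0 w); last by right; rewrite /N/= in_itv.
  left; split => // i; rewrite exprMn e2.
  by apply: (spread_close i ord0 (ltW eps0) _ Aw); lra.
have mE' : measurable E by exact: measurable_close.
apply: (@le_trans _ _ (P E)).
  rewrite -(measureU0 mE' mN PN); apply: le_measure => //; rewrite inE//.
  exact: measurableU.
apply: (le_trans (close_prob indep a0 Xa hM ord0 ep e4)).
have eE : e = Num.sqrt (8 * n.+1%:R) * Num.sqrt eps.
  by rewrite /e [LHS]sqrtrM ?mulr_ge0.
rewrite lee_fin/= eE.
rewrite (_ : 8 * _ * M = 8 * M * Num.sqrt (8 * n.+1%:R) * Num.sqrt eps); last by ring.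
rewrite exprMn [leRHS]mulrDl (_ : Num.sqrt eps ^+ n = eps `^ m).
  by rewrite lerDl mulr_ge0 ?powR_ge0// invr_ge0 powR_ge0.
by rewrite -powR_mulrn ?sqrtr_ge0// -powR12_sqrt ?(ltW eps0)// -powRrM mE mulrC.
Qed.

Section AlmostSure.
Context {d : measure_display} {T : measurableType d} {R : realType}.
Variables (P : probability T R) (n : nat) (X : 'I_n -> {RV P >-> R}) (a : R).
Hypotheses (hn : (2 <= n)%N) (indep : mutually_independent X) (a0 : 0 < a).
Hypothesis (Xa : forall i, has_density (X i) (gamma_pdf a)).

Lemma ae_gt0 : {ae P, forall w, forall i, 0 < X i w}.
Proof.
apply: filter_forall => i; exists (X i @^-1` `]-oo, 0]%classic); split.
- rewrite -[X in measurable X]setTI; apply: measurable_funPT => //; exact: measurable_itvR.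
- exact: gamma_pos (Xa) i.
- by move=> w /=; rewrite in_itv/= => /negP; rewrite -leNgt.
Qed.

(** [spread_prob_le] bounds the probability of W <= 0 by C eps^((n - 1)/2) for every eps > 0, and
    the exponent is positive since n >= 2. *)
Lemma ae_spread_gt0 : {ae P, forall w, 0 < spread (fun i => X i w)}.
Proof.
have mX i : measurable_fun setT (X i) by exact: measurable_funPT.
have [C [C0 hC]] := spread_prob_le (ltnW hn) a0.
have {}hC := hC d T P X indep Xa.
pose A := [set w | spread (fun i => X i w) <= 0].
have mA : measurable A.
  by rewrite -[X in measurable X]setTI; apply: measurable_fun_le => //; exact: measurable_spread.
exists A; split=> //; last by move=> w /= /negP; rewrite -leNgt.
have m0 : 0 < (n%:R - 1) / 2 :> R by rewrite divr_gt0// subr_gt0 ltr1n.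
have pA : fine (P A) = 0; last by rewrite -[LHS]fineK ?pA// fin_num_measure.
apply/eqP; rewrite eq_le fine_ge0// andbT leNgt; apply/negP => p0.
(* Chosen so that the bound is half the probability of [A]. *)
pose eps := (fine (P A) / (2 * C)) `^ (((n%:R - 1) / 2)^-1).
have eps0 : 0 < eps by rewrite powR_gt0// divr_gt0// mulr_gt0.
have : (P A <= (C * eps `^ ((n%:R - 1) / 2))%:E)%E.
  apply: le_trans (hC _ eps0); apply: le_measure; rewrite ?inE//.
    rewrite -[X in measurable X]setTI; apply: measurable_fun_le => //; first exact: measurable_spread.
    by apply: measurable_funM => //; apply: measurable_sum => i; exact: measurable_funX.
  move=> w Aw; apply: (le_trans Aw); rewrite mulr_ge0 ?(ltW eps0)//.
  by apply: sumr_ge0 => i _; exact: sqr_ge0.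
rewrite -powRrM mulVf ?gt_eqF// powRr1 ?(ltW (divr_gt0 _ _)) ?mulr_gt0//.
rewrite -[X in (X <= _)%E]fineK ?fin_num_measure// lee_fin.
rewrite (_ : C * _ = fine (P A) / 2); first by lra.
by field; rewrite gt_eqF.
Qed.

End AlmostSure.

(** With x = (1 - y) j one has y^j <= e^-x, and the single term at l = floor x already bounds e^-x.
    The sum turns a moment into probabilities of the events 1 - y <= (l + 1) / j. *)
Lemma exprn_le_sum_expR {R : realType} (y : R) j : 0 <= y -> y <= 1 ->
  y ^+ j <= \sum_(l < j.+1) expR (- l%:R) * ((1 - y) * j%:R <= l.+1%:R)%R%:R.
Proof.
move=> y0 y1; set x := (1 - y) * j%:R.
have x0 : 0 <= x by rewrite mulr_ge0// subr_ge0.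
have xj : x <= j%:R by rewrite ler_piMl//; lra.
have lj : (Num.truncn x < j.+1)%N.
  by rewrite ltnS -(ler_nat R) (le_trans _ xj)// truncn_le.
rewrite (bigD1 (Ordinal lj))//= ler_wpDr//.
  by apply: sumr_ge0 => l _; rewrite mulr_ge0// expR_ge0.
rewrite (ltW (truncnS_gt x)) mulr1.
apply: (@le_trans _ _ (expR (- x))); last by rewrite ler_expR lerN2 truncn_le.
rewrite /x -mulNr expRM_natr lerXn2r ?nnegrE ?expR_ge0//.
have := expR_ge1Dx (- (1 - y)); lra.
Qed.

Section TailMoment.
Context {R : realType}.
(** One half of the exponential absorbs the power, the other half is a geometric majorant of ratio
    e^(-1/2). *)
Lemma is_cvg_expR_powR (m : R) : 0 <= m ->
  cvgn (series (fun l => expR (- l%:R) * l.+1%:R `^ m)).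
Proof.
move=> m0; have [B [B0 hB]] := powR_expRN_bounded m0.
have h := @is_cvg_geometric_series R (B * expR 1 * 2 `^ m) (expR (- (1 / 2))).
apply: le_series_cvgn (h _); last by rewrite ger0_norm ?expR_ge0// expR_lt1; lra.
move=> l; rewrite /geometric/= ger0_norm ?mulr_ge0 ?expR_ge0 ?powR_ge0//.
have := hB (l.+1%:R / 2); rewrite divr_ge0// => /(_ isT) h1.
rewrite (_ : l.+1%:R = 2 * (l.+1%:R / 2) :> R); last by field.
rewrite [leLHS](_ : _ = 2 `^ m * expR (1 / 2) * expR (- (1 / 2)) ^+ l *
    ((l.+1%:R / 2) `^ m * expR (- (l.+1%:R / 2)))); last first.
  rewrite powRM ?divr_ge0// -expRM_natr.
  have -> : expR (- l%:R) = expR (1 / 2) * expR (- (1 / 2) * l%:R) * expR (- (l.+1%:R / 2)) :> R.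
    by rewrite -!expRD; congr expR; rewrite -natr1; field.
  by move: (2 `^ m) (_ `^ m) (expR _) (expR _) (expR _) => *; ring.
rewrite [leRHS](_ : _ = 2 `^ m * expR (1 / 2) * expR (- (1 / 2)) ^+ l * (B * expR (1/2))); last first.
  have -> : expR 1 = expR (1 / 2) * expR (1 / 2) :> R by rewrite -expRD; congr expR; field.
  by move: (2 `^ m) (expR _) (expR _) => *; ring.
rewrite ler_wpM2l ?mulr_ge0 ?powR_ge0 ?exprn_ge0 ?expR_ge0//.
apply: (le_trans h1); rewrite ler_peMr ?(ltW B0)//.
by have := expR_ge1Dx (1 / 2 : R); lra.
Qed.
End TailMoment.

(** [exprn_le_sum_expR] bounds the moment by a sum of e^-l P(1 - Y <= (l + 1)/j). Up to a null set
    each event lies in W <= ((l + 1)/j) Q, of probability O(((l + 1)/j)^((n - 1)/2)), and the sum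
    over l converges. *)
Lemma spread_moment_le {R : realType} n (a : R) : (2 <= n)%N -> 0 < a -> exists C : R,
  forall d (T : measurableType d) (P : probability T R) (X : 'I_n -> {RV P >-> R}),
  mutually_independent X -> (forall i, has_density (X i) (gamma_pdf a)) ->
  forall Y : T -> R, measurable_fun setT Y -> (forall w, 0 <= Y w <= 1) ->
  {ae P, forall w, (1 - Y w) * \sum_(i < n) X i w ^+ 2 = spread (fun i => X i w)} ->
  forall j, (0 < j)%N -> \int[P]_w Y w ^+ j <= C * j%:R `^ (- ((n%:R - 1) / 2)).
Proof.
move=> hn a0; have [C [C0 hC]] := spread_prob_le (ltnW hn) a0.
set m : R := (n%:R - 1) / 2.
have m0 : 0 <= m by rewrite divr_ge0// subr_ge0 ler1n ltnW.
pose c l : R := expR (- l%:R) * l.+1%:R `^ m.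
have c0 l : 0 <= c l by rewrite mulr_ge0 ?expR_ge0 ?powR_ge0.
have cc : cvgn (series c) by exact: is_cvg_expR_powR.
exists (C * limn (series c)) => d T P X indep Xa Y mY Y01 YE j j0.
have j0' : 0 < j%:R :> R by rewrite ltr0n.
pose A l := [set w | (1 - Y w) * j%:R <= l.+1%:R].
have mA l : measurable (A l).
  rewrite -[X in measurable X]setTI; apply: measurable_fun_le => //.
  by apply: measurable_funM => //; exact: measurable_funB.
have mX i : measurable_fun setT (X i) by exact: measurable_funPT.
have PA l : (P (A l) <= (C * (l.+1%:R / j%:R) `^ m)%:E)%E.
  have e0 : 0 < l.+1%:R / j%:R :> R by rewrite divr_gt0.
  apply: le_trans (hC d T P X indep Xa _ e0).
  set B := [set w | _].
  have mB : measurable B.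
    rewrite -[X in measurable X]setTI; apply: measurable_fun_le => //; first exact: measurable_spread.
    by apply: measurable_funM => //; apply: measurable_sum => i; exact: measurable_funX.
  have [N [mN PN hN]] := YE.
  rewrite -(measureU0 mB mN PN); apply: le_measure; rewrite ?inE//; first exact: measurableU.
  move=> w Aw; have [h|h] := pselect ((1 - Y w) * \sum_(i < n) X i w ^+ 2 = spread (fun i => X i w)).
    left; rewrite /B/= -h ler_wpM2r//; last by rewrite ler_pdivlMr.
    by apply: sumr_ge0 => i _; exact: sqr_ge0.
  by right; apply: hN.
have Yj0 w : 0 <= Y w ^+ j by rewrite exprn_ge0//; case/andP: (Y01 w).
have mYj : measurable_fun setT (fun w => Y w ^+ j) by exact: measurable_funX.
have Yint : P.-integrable setT (EFin \o (fun w => Y w ^+ j)).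
  apply: (bounded_integrable (M := 1) P mYj _).1 => w; rewrite ger0_norm//.
  by have /andP[y0 y1] := Y01 w; rewrite exprn_ile1.
rewrite -lee_fin /Rintegral fineK; last exact: (integrable_fin_num measurableT Yint).
pose ind l w : R := ((1 - Y w) * j%:R <= l.+1%:R)%R%:R.
have mind l : measurable_fun setT (ind l).
  by apply: measurable_fun_leR => //; apply: measurable_funM => //; exact: measurable_funB.
apply: (@le_trans _ _ (\int[P]_w (\sum_(l < j.+1) (expR (- l%:R) * ind l w)%:E))%E).
  apply: ge0_le_integral => //.
  - by move=> w _; rewrite lee_fin.
  - exact/measurable_EFinP.
  - apply: emeasurable_sum => l; apply/measurable_EFinP; exact: measurable_funM.
  move=> w _; rewrite sumEFin lee_fin; have /andP[y0 y1] := Y01 w.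
  exact: exprn_le_sum_expR.
rewrite ge0_integral_sum//; last 2 first.
- by move=> l; apply/measurable_EFinP; exact: measurable_funM.
- by move=> l w _; rewrite lee_fin mulr_ge0 ?expR_ge0// /ind.
apply: (@le_trans _ _ (\sum_(l < j.+1) (C * j%:R `^ (- m) * c l)%:E)%E).
  apply: lee_sum => l _.
  under eq_integral do rewrite EFinM.
  rewrite ge0_integralZl_EFin ?expR_ge0//; last 2 first.
  - by move=> w _; rewrite lee_fin /ind.
  - exact/measurable_EFinP.
  have -> : (\int[P]_w (ind l w)%:E = P (A l))%E.
    rewrite -[X in P X]setIT -integral_indic//; apply: eq_integral => w _.
    by rewrite indicE /ind; congr (_ : bool)%:R%:E; apply/idP/idP; rewrite inE.
  apply: (le_trans (lee_wpmul2l _ (PA l))); first by rewrite lee_fin expR_ge0.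
  rewrite -EFinM lee_fin powRM ?invr_ge0 ?ler0n// -powR_inv1 ?ler0n// -powRrM mulN1r /c.
  rewrite le_eqVlt; apply/orP; left; apply/eqP.
  by move: (_ `^ m) (_ `^ (- m)) (expR _) => *; ring.
rewrite sumEFin lee_fin -mulr_sumr [leRHS]mulrAC ler_wpM2l ?mulr_ge0 ?powR_ge0 ?(ltW C0)//.
rewrite -(big_mkord xpredT c); apply: nondecreasing_cvgn_le => //.
by apply/nondecreasing_seqP => k; rewrite seriesSr lerDl.
Qed.

Lemma spreadE {R : realType} n (x : 'I_n -> R) : (0 < n)%N ->
  spread x = \sum_i x i ^+ 2 - (\sum_i x i) ^+ 2 / n%:R.
Proof.
move=> n0; have n1 : n%:R != 0 :> R by rewrite pnatr_eq0 -lt0n.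
rewrite /spread; set s := \sum_i x i; set m := n%:R^-1 * s.
rewrite (eq_bigr (fun i => x i ^+ 2 + (- (2 * m) * x i + m ^+ 2))); last by move=> i _; ring.
rewrite !big_split/= -mulr_sumr -/s sumr_const card_ord -mulr_natr /m.
by field.
Qed.

Lemma spread_ge0 {R : realType} n (x : 'I_n -> R) : 0 <= spread x.
Proof. by apply: sumr_ge0 => i _; exact: sqr_ge0. Qed.

(** Cauchy-Schwarz, in the form [spread_ge0], keeps the argument of [acos] in [-1, 1]. For x = 0
    both sides vanish, since acos 0 is pi / 2. *)
Lemma sqrt_cos_angle {R : realType} n (x : 'I_n -> R) : (0 < n)%N ->
  Num.sqrt n%:R * cos (angle x (fun=> 1)) =
  (\sum_i x i) / Num.sqrt (\sum_i x i ^+ 2).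
Proof.
move=> n0; have n1 : 0 < n%:R :> R by rewrite ltr0n.
have sn : 0 < Num.sqrt n%:R :> R by rewrite sqrtr_gt0.
rewrite /angle.
have -> : dot x (fun=> 1) = \sum_i x i by apply: eq_bigr => i _; rewrite mulr1.
have -> : dot x x = \sum_i x i ^+ 2 by apply: eq_bigr => i _; rewrite expr2.
have -> : @dot R n (fun=> 1) (fun=> 1) = n%:R.
  by rewrite /dot (eq_bigr (fun=> 1)) ?sumr_const ?card_ord// => i _; rewrite mulr1.
have := spread_ge0 x; rewrite (spreadE _ n0).
have : 0 <= \sum_i x i ^+ 2 by apply: sumr_ge0 => i _; exact: sqr_ge0.
move: (\sum_i x i) (\sum_i x i ^+ 2) => s q q0.
rewrite subr_ge0 ler_pdivrMr// => sq.
have [q1|q1] := leP q 0.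
  have s0 : s = 0.
    by apply/eqP; rewrite -sqrf_eq0 eq_le sqr_ge0 andbT (le_trans sq)// mulr_le0_ge0// ltW.
  by rewrite s0 !mul0r acos0 cos_pihalf mulr0.
have sq0 : 0 < Num.sqrt q by rewrite sqrtr_gt0.
rewrite acosK; first by field; rewrite !gt_eqF.
rewrite in_itv/= -ler_norml normrM normfV (ger0_norm (_ : 0 <= _ * _)) ?mulr_ge0 ?sqrtr_ge0//.
rewrite ler_pdivrMr ?mulr_gt0// mul1r -sqrtrM// -sqrtr_sqr ler_wsqrtr//.
Qed.

(** * The variable sqrt n cos Phi and the proof of the theorem *)

Section CosineVariable.
Context {d : measure_display} {T : measurableType d} {R : realType}.
Variables (P : probability T R) (n : nat) (X : 'I_n -> {RV P >-> R}) (a : R).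
Hypotheses (hn : (2 <= n)%N) (indep : mutually_independent X) (a0 : 0 < a).
Hypothesis (Xa : forall i, has_density (X i) (gamma_pdf a)).
Notation S w := (\sum_(i < n) X i w).
Notation Q w := (\sum_(i < n) X i w ^+ 2).
Notation W w := (spread (fun i => X i w)).
Let b : R := a * n%:R.

Let n0 : (0 < n)%N. Proof. exact: ltnW. Qed.
Let n1 : 0 < n%:R :> R. Proof. by rewrite ltr0n. Qed.
Let b0 : 0 < b. Proof. by rewrite mulr_gt0. Qed.
Let mX i : measurable_fun setT (X i). Proof. exact: measurable_funPT. Qed.

Definition regular : set T := [set w | (forall i, 0 < X i w) /\ 0 < W w].

Let ae_regular : {ae P, forall w, regular w}.
Proof.
apply: filterS2 (ae_gt0 Xa) (ae_spread_gt0 hn indep a0 Xa).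
by move=> w h1 h2; split.
Qed.

Let regularP w : regular w -> [/\ 0 < S w, 0 < Q w, 0 < W w & W w = Q w - S w ^+ 2 / n%:R].
Proof.
move=> [X0 W0]; split=> //; last exact: spreadE.
- rewrite (bigD1 (Ordinal n0))//= ltr_wpDr//.
  by apply: sumr_ge0 => i _; apply: ltW.
- rewrite (bigD1 (Ordinal n0))//= ltr_wpDr ?exprn_gt0//.
  by apply: sumr_ge0 => i _; exact: sqr_ge0.
Qed.

Definition ratio w := S w / Num.sqrt (Q w).

(* [ratio] away from the null event where it leaves the interval (0, sqrt n). *)
Definition cosvar w := if `[< regular w >] then ratio w else 1.

Let cosvarE w : regular w -> cosvar w = ratio w.
Proof. by move=> h; rewrite /cosvar asboolT. Qed.

Lemma measurable_ratio : measurable_fun setT ratio.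
Proof.
apply: measurable_fun_divsqrt.
- exact: measurable_sum.
- by apply: measurable_sum => i; exact: measurable_funX.
- by move=> w; apply: sumr_ge0 => i _; exact: sqr_ge0.
Qed.

Lemma measurable_cosvar : measurable_fun setT cosvar.
Proof.
have mr : measurable regular.
  rewrite (_ : regular = (\bigcap_(i in [set: 'I_n]) (X i @^-1` `]0, +oo[%classic)) `&`
     ((fun w => W w) @^-1` `]0, +oo[%classic)).
    apply: measurableI.
      apply: fin_bigcap_measurable => [|i _]; first exact: finite_finset.
      rewrite -[X in measurable X]setTI; apply: mX => //; exact: measurable_itvR.
    rewrite -[X in measurable X]setTI; apply: measurable_spread => //; exact: measurable_itvR.
  apply/seteqP; split => w /=; rewrite in_itv/= andbT => -[h W0]; split=> // i.
    by move=> _ /=; rewrite in_itv/= h.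
  by have := h i I; rewrite /= in_itv/= andbT.
rewrite (_ : cosvar = fun w => \1_regular w * ratio w + (1 - \1_regular w)).
  have mi : measurable_fun setT (\1_regular : T -> R) by exact: measurable_indic.
  apply: measurable_funD; last exact: measurable_funB.
  by apply: measurable_funM => //; exact: measurable_ratio.
apply/funext => w; rewrite /cosvar indicE -[w \in regular]/(`[< _ >]).
by case: asboolP => _ /=; rewrite ?mul1r ?mul0r ?subrr ?subr0 ?addr0 ?add0r.
Qed.

Lemma cosvar_gt0 w : 0 < cosvar w.
Proof.
rewrite /cosvar; case: asboolP => // /regularP[S0 Q0 _ _].
by rewrite divr_gt0// sqrtr_gt0.
Qed.

Lemma cosvar_lt w : cosvar w ^+ 2 < n%:R.
Proof.
rewrite /cosvar; case: asboolP => [/regularP[S0 Q0 W0 WE]|_]; last by rewrite expr1n ltr1n.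
rewrite expr_div_n sqr_sqrtr ?(ltW Q0)// ltr_pdivrMr//.
by move: W0; rewrite WE subr_gt0 ltr_pdivrMr// mulrC.
Qed.

Let spread_ratio w : regular w -> 1 - cosvar w ^+ 2 / n%:R = W w / Q w.
Proof.
move=> h; rewrite cosvarE//; have [S0 Q0 W0 ->] := regularP h.
by rewrite expr_div_n sqr_sqrtr ?(ltW Q0)//; field; rewrite !gt_eqF.
Qed.

Let Rintegral_ratio (f : R -> R) : measurable_fun setT f ->
  fine (\int[P]_w (f (ratio w))%:E)%E = \int[P]_w f (cosvar w).
Proof.
move=> mf; rewrite /Rintegral; congr fine; apply: ae_eq_integral => //.
- by apply/measurable_EFinP; apply: (measurableT_comp mf); exact: measurable_ratio.
- by apply/measurable_EFinP; apply: (measurableT_comp mf); exact: measurable_cosvar.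
- by apply: filterS ae_regular => w h _; rewrite cosvarE.
Qed.

Let sqrt_cosPhi w : Num.sqrt n%:R * cos (Phi X w) = ratio w.
Proof. exact: sqrt_cos_angle. Qed.

Lemma moment_cosvar k : moment X a k = mom P cosvar b k.
Proof.
rewrite /moment unlock; under eq_integral do rewrite sqrt_cosPhi.
exact: (Rintegral_ratio (@measurable_powR R (b + k%:R))).
Qed.

Lemma H_cosvar m r : H X a m r = mean_gamma_cdf P cosvar b m r.
Proof.
rewrite /H unlock; under eq_integral do rewrite sqrt_cosPhi.
have bm : 0 < b + m%:R by rewrite ltr_pwDl.
apply: (Rintegral_ratio (f := fun x => gamma_cdf (b + m%:R) (r * x))).
apply: (measurableT_comp (measurable_gamma_cdf bm)); exact: mulrl_measurable.
Qed.

Lemma termA_cosvar z : termA X a z = expansion_term P n cosvar b z.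
Proof.
apply/funext => j; rewrite /termA /expansion_term; congr (_ * _).
by congr derive1n; apply/funext => y; rewrite H_cosvar.
Qed.

Lemma prob_sample_var r : 0 < r ->
  fine (P [set w | (n%:R - 1) * sample_var X w <= r ^+ 2]) =
  \int[P]_w gamma_cdf b (r * cosvar w / Num.sqrt (1 - cosvar w ^+ 2 / n%:R)).
Proof.
move=> r0; have good : {ae P, forall w, 0 < S w /\ 0 < W w}.
  by apply: filterS ae_regular => w /regularP[].
rewrite (_ : [set w | _] = [set w | W w <= r ^+ 2]); last first.
  apply/seteqP; split=> w /=; rewrite /sample_var mulrA divff ?mul1r//;
  by rewrite subr_eq0 pnatr_eq1 gtn_eqF.
congr fine; transitivity (\int[P]_w (gamma_cdf b (r * (S w / Num.sqrt (W w))))%:E)%E.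
  by apply/esym; exact: (lukacs indep a0 n0 Xa good r0).
have mc : measurable_fun setT (fun w => r * cosvar w / Num.sqrt (1 - cosvar w ^+ 2 / n%:R)).
  apply: measurable_fun_divsqrt; [|apply: measurable_funB => //|].
  - by apply: measurable_funM => //; exact: measurable_cosvar.
  - by apply: measurable_funM => //; apply: measurable_funX; exact: measurable_cosvar.
  - by move=> w; rewrite subr_ge0 ler_pdivrMr// mul1r ltW// cosvar_lt.
apply: ae_eq_integral => //.
- apply/measurable_EFinP; apply: (measurableT_comp (measurable_gamma_cdf b0)).
  apply: measurable_funM => //; apply: measurable_fun_divsqrt; first exact: measurable_sum.
    exact: measurable_spread.
  by move=> w; exact: spread_ge0.
- by apply/measurable_EFinP; exact: (measurableT_comp (measurable_gamma_cdf b0) mc).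
apply: filterS ae_regular => w h _.
rewrite spread_ratio// cosvarE//; have [S0 Q0 W0 _] := regularP h.
congr (gamma_cdf _ _)%:E; rewrite /ratio -mulrA; congr (_ * _).
have sQ : 0 < Num.sqrt (Q w) by rewrite sqrtr_gt0.
have sW : 0 < Num.sqrt (W w) by rewrite sqrtr_gt0.
rewrite sqrtrM ?(ltW W0)// sqrtrV ?(ltW Q0)//.
by move: (Num.sqrt (Q w)) (Num.sqrt (W w)) sQ sW => q v q0 v0; field; rewrite !gt_eqF.
Qed.

(** The moment bound is a hypothesis so that [C] can be the constant chosen before the probability
    space. *)
Lemma cosvar_tail j C : 
  (forall Y : T -> R, measurable_fun setT Y -> (forall w, 0 <= Y w <= 1) ->
   {ae P, forall w, (1 - Y w) * Q w = W w} ->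
   forall j, (0 < j)%N -> \int[P]_w Y w ^+ j <= C * j%:R `^ (- ((n%:R - 1) / 2))) ->
  (0 < j)%N ->
  \int[P]_w (cosvar w ^+ 2 / n%:R) ^+ j <= C * j%:R `^ (- ((n%:R - 1) / 2)).
Proof.
move=> hC j0; apply: (hC (fun w => cosvar w ^+ 2 / n%:R)) => //.
- by apply: measurable_funM => //; apply: measurable_funX; exact: measurable_cosvar.
- move=> w; rewrite divr_ge0 ?sqr_ge0 ?ler0n//= ler_pdivrMr// mul1r.
  exact: ltW (cosvar_lt w).
apply: filterS ae_regular => w h; have [_ Q0 _ _] := regularP h.
by rewrite spread_ratio// divfK// gt_eqF.
Qed.

End CosineVariable.

Section InnerSeries.
Context {d : measure_display} {T : measurableType d} {R : realType}.
Variables (P : probability T R) (n : nat) (X : 'I_n -> {RV P >-> R}) (a : R).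
Hypotheses (hn : (2 <= n)%N) (indep : mutually_independent X) (a0 : 0 < a).
Hypothesis (Xa : forall i, has_density (X i) (gamma_pdf a)).
Variable r : R.
Hypothesis r0 : 0 < r.
Let b : R := a * n%:R.
Let V := cosvar X.
Let term := expansion_term P n V b (r ^+ 2).

Let b0 : 0 < b. Proof. by rewrite mulr_gt0// ltr0n ltnW. Qed.
Let nj j : 0 < n%:R ^+ j :> R. Proof. by rewrite exprn_gt0// ltr0n ltnW. Qed.
Let rb : 0 < r `^ b / Gamma b. Proof. by rewrite divr_gt0 ?powR_gt0 ?Gamma_gt0. Qed.
Let V0 w : 0 < V w. Proof. exact: cosvar_gt0. Qed.
Let Vn w : V w ^+ 2 < n%:R. Proof. exact: cosvar_lt. Qed.
Let mV : measurable_fun setT V. Proof. exact: measurable_cosvar. Qed.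

Lemma innerB_cvg j : series (innerB X a r j) @ \oo --> expansion_coef P V b j r.
Proof.
have := expansion_coef_power_series (P := P) mV V0 Vn b0 (j := j) (r := r).
rewrite (_ : (fun k => _) = innerB X a r j)//.
by apply/funext => k; rewrite /innerB (moment_cosvar hn indep a0 Xa).
Qed.

Lemma term_innerB j :
  term j = r `^ b / Gamma b * (limn (series (innerB X a r j)) * (1 / n%:R ^+ j)).
Proof.
rewrite (cvg_series_lim (@innerB_cvg j)) /term (expansion_termE P hn mV V0 Vn b0 j r0).
by rewrite div1r mulrA.
Qed.

Lemma innerC_cvg lambda j : 0 < lambda ->
  series (innerC X a r lambda j) @ \oo -->
  r `^ b / Gamma b * expansion_coef P V b j r / lambda ^+ (2 * j).
Proof.
move=> l0; have := expansion_coef_gamma_series (P := P) mV V0 Vn b0 (j := j) r0 l0.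
rewrite (_ : (fun k => _) = innerC X a r lambda j)//.
apply/funext => k; rewrite /innerC; congr (_ * _ * _).
by apply: eq_bigr => l _; rewrite (moment_cosvar hn indep a0 Xa).
Qed.

Lemma term_innerC lambda j : 0 < lambda ->
  term j = limn (series (innerC X a r lambda j)) * (lambda ^+ 2 / n%:R) ^+ j.
Proof.
move=> l0; rewrite (cvg_series_lim (@innerC_cvg lambda j l0)) /term (expansion_termE P hn mV V0 Vn b0 j r0).
rewrite expr_div_n -exprM; have := exprn_gt0 (2 * j) l0; have := nj j.
move: (r `^ b / _) (expansion_coef _ _ _ _ _) (n%:R ^+ j) (lambda ^+ _) => x y u v u1 v1.
by field; rewrite !gt_eqF.
Qed.

End InnerSeries.

Theorem theorem4p1 (R : realType) (n : nat) (hn : (2 <= n)%N)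
    (alpha : R) (halpha : 0 < alpha) :
  exists K : R,
  forall (d : measure_display) (T : measurableType d) (P : probability T R)
    (X : 'I_n -> {RV P >-> R}),
    mutually_independent X ->
    (forall i, has_density (X i) (gamma_pdf alpha)) ->
  forall r : R, 0 < r -> forall z : R, z = r ^+ 2 ->
  let Pr := fine (P [set w | (n%:R - 1) * sample_var X w <= z]) in
  [/\ (* the derivatives in (A) exist *)
      (forall j i : nat, (i < j)%N ->
        derivable (derive1n i (fun y => H X alpha (2 * j) (Num.sqrt y))) z 1),
      (* (A), its absolute convergence and the size of its terms *)
      [/\ Pr = limn (series (termA X alpha z)),
          cvgn (series (fun j => `|termA X alpha z j|)) &
          forall j : nat, (0 < j)%N ->
            `|termA X alpha z j| <= K * j%:R `^ (- ((n%:R + 1) / 2))],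
      (* second expansion *)
      [/\ forall j : nat, cvgn (series (innerB X alpha r j)),
          cvgn (series (fun j =>
            limn (series (innerB X alpha r j)) * (1 / n%:R ^+ j))) &
          Pr = r `^ (alpha * n%:R) / Gamma (alpha * n%:R) *
            limn (series (fun j =>
              limn (series (innerB X alpha r j)) * (1 / n%:R ^+ j)))] &
      (* third expansion *)
      forall lambda : R, 0 < lambda ->
      [/\ forall j : nat, cvgn (series (innerC X alpha r lambda j)),
          cvgn (series (fun j =>
            limn (series (innerC X alpha r lambda j))
              * (lambda ^+ 2 / n%:R) ^+ j)) &
          Pr = limn (series (fun j =>
            limn (series (innerC X alpha r lambda j))
              * (lambda ^+ 2 / n%:R) ^+ j))]].
Proof.
have b0 : 0 < alpha * n%:R by rewrite mulr_gt0// ltr0n ltnW.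
have [C hC] := lagr_bounded b0.
have [C2 hC2] := spread_moment_le hn halpha.
(* Both constants depend only on alpha and n: [C] comes from the bound C / j on the coefficients,
   [C2] from the decay of the moments of t. *)
exists (C * C2) => d T P X indep Xa r r0 _ ->.
have mV := measurable_cosvar X.
have V0 w : 0 < cosvar X w by exact: cosvar_gt0.
have Vn w : cosvar X w ^+ 2 < n%:R by exact: cosvar_lt.
have tail j (j0 : (0 < j)%N) := cosvar_tail hn indep halpha Xa (hC2 d T P X indep Xa) j0.
have [absc sumc] := cvg_expansion_term hn mV V0 Vn b0 tail r0.
set term := expansion_term P n (cosvar X) (alpha * n%:R) (r ^+ 2) in absc sumc.
move=> Pr; have {}sumc : series term @ \oo --> Pr.
  by rewrite /Pr (prob_sample_var hn indep halpha Xa r0).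
have PrE : Pr = limn (series term) by rewrite (cvg_series_lim sumc).
have cterm : cvgn (series term) by apply/cvg_ex; exists Pr.
split.
- move=> j i _; have := derivable_mean_gamma_cdf (P := P) mV V0 Vn b0 (j := j) (i := i) r0.
  rewrite (_ : (fun y => mean_gamma_cdf _ _ _ _ _) = fun y => H X alpha (2 * j) (Num.sqrt y))//.
  by apply/funext => y; rewrite (H_cosvar hn indep halpha Xa).
- rewrite (termA_cosvar hn indep halpha Xa); split=> // j j0.
  exact: (expansion_term_le hn mV V0 Vn b0 tail hC j0 r0).
- have rb : r `^ (alpha * n%:R) / Gamma (alpha * n%:R) != 0.
    by rewrite gt_eqF// divr_gt0 ?powR_gt0 ?Gamma_gt0.
  have E : (fun j => limn (series (innerB X alpha r j)) * (1 / n%:R ^+ j)) =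
      (fun j => (r `^ (alpha * n%:R) / Gamma (alpha * n%:R))^-1 * term j).
    apply/funext => j; rewrite /term (term_innerB hn indep halpha Xa r0).
    by rewrite mulKf.
  rewrite E; split.
  + by move=> j; apply/cvg_ex; eexists; exact: (innerB_cvg hn indep halpha Xa).
  + exact: is_cvg_seriesZ.
  + have -> : series (fun j => (r `^ (alpha * n%:R) / Gamma (alpha * n%:R))^-1 * term j) =
      series (fun j => (r `^ (alpha * n%:R) / Gamma (alpha * n%:R))^-1 *: term j) by [].
    by rewrite lim_seriesZ// PrE /GRing.scale/= mulVKf.
- move=> lambda l0.
  have <- : term = (fun j => limn (series (innerC X alpha r lambda j)) * (lambda ^+ 2 / n%:R) ^+ j).
    by apply/funext => j; exact: (term_innerC hn indep halpha Xa r0).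
  split=> // j; apply/cvg_ex; eexists; exact: (innerC_cvg hn indep halpha Xa r0 l0).
Qed.
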